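(* Let $M$ be a connected non-binary matroid. Then $M$ is orderable if and only if, for some integer $n\geq 4$, $M$ can be obtained (up to isomorphism) from $U_{2,n}$ by a (possibly empty) sequence of the following operations: (i) balanced series extension; and (ii) parallel-path addition.
   Context: All matroids are finite. A reversible cyclic ordering of a finite set $X$ with $|X|=n$ is an arrangement of the elements of $X$ on the vertices of an $n$-gon, one element at each vertex (considered up to rotation and reflection); two elements are adjacent in the ordering when their vertices lie on a common edge of the $n$-gon. An ordering of a matroid $M$ is a choice of a reversible cyclic ordering for each circuit of $M$. It is consistent if, for every pair $\{e,f\}$ of distinct elements of $E(M)$ and every pair $\{C,C'\}$ of circuits with $\{e,f\}\subseteq C\cap C'$, if $e$ and $f$ are adjacent in the ordering of $C$, then they are adjacent in the ordering of $C'$. A matroid is orderable if it has a consistent ordering. Balanced series extension: for a matroid $M$ without coloops, a balanced series extension of $M$ is a matroid obtained by replacing each element of $M$ by $k$ elements in series, for some integer $k>1$ (the same $k$ for all elements). Parallel-path addition: a theta-graph is a graph consisting of a pair of distinct vertices and three internally disjoint paths between them. Let $P$ be a nonempty subset of a series class of a matroid $M$. Fix $t\in P$, contract $P-t$ from $M$, and relabel $t$ as $t'$ to obtain $M'$. Let $N$ be the cycle matroid of a theta-graph with series classes $\{t'\}$, $P$, and $P'$, where $|P'|=|P|$ (and $P'$ consists of new elements). Let $M''$ be the 2-sum of $M'$ and $N$ with basepoint $t'$ (as usual for a 2-sum, $\{t'\}$ is not a separator of $M'$). The operation transforming $M$ into $M''$ is called parallel-path addition. *)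

(* Defs.v *)
(* Terminology follows Oxley, Matroid Theory. *)
From mathcomp Require Import all_boot all_order all_algebra.
From mathcomp Require Import zify.

Set Implicit Arguments.
Unset Strict Implicit.
Unset Printing Implicit Defensive.

(* The ground set is a subset of an ambient finite type, so that deletion,
   contraction and 2-sum stay within one type; [indep] is only meaningful
   together with [indep_ground]. *)
Record matroid (T : finType) := Matroid {
  ground : {set T};
  indep : pred {set T};
  indep_ground : forall I, indep I -> I \subset ground;
  indep0 : indep set0;
  indepS : forall I J : {set T}, I \subset J -> indep J -> indep I;
  indep_aug : forall I J : {set T}, indep I -> indep J -> #|I| < #|J| ->
    exists2 e, e \in J :\: I & indep (e |: I)
}.

Section Matroids.
Variable T : finType.
Implicit Types (M N : matroid T) (X Y C B I J P : {set T}) (e f p t : T).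

Definition basis M B : bool := maxset (indep M) B.

Definition circuit M C : bool :=
  minset (fun X => (X \subset ground M) && ~~ indep M X) C.

Lemma basis_indep M B : basis M B -> indep M B.
Proof. by case/maxsetP. Qed.

Lemma indep_ext M I B : indep M I -> basis M B ->
  exists B', [/\ basis M B', I \subset B' & B' \subset I :|: B].
Proof.
move=> iI bB.
pose Q J := [&& indep M J & J \subset I :|: B].
have QI : Q I by rewrite /Q iI subsetUl.
have [B' /maxsetP [/andP [iB' sB'] maxB'] sIB'] := maxset_exists QI.
exists B'; split=> //.
have leB : #|B| <= #|B'|.
  rewrite leqNgt; apply/negP => lt.
  have [e] := indep_aug iB' (basis_indep bB) lt.
  rewrite !inE => /andP [eB' eB] ie.
  have := maxB' (e |: B').
  rewrite /Q ie subUset sub1set inE eB orbT sB' /= subsetUr => /(_ isT isT) E.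
  by move: eB'; rewrite -E setU11.
apply/maxsetP; split=> // J iJ sJ.
apply/eqP; rewrite eq_sym eqEcard sJ /= leqNgt; apply/negP => lt.
have [e] := indep_aug (basis_indep bB) iJ (leq_ltn_trans leB lt).
rewrite !inE => /andP [eB _] ie.
have /maxsetP [_ mB] := bB.
by have E := mB _ ie (subsetUr _ _); move: eB; rewrite -E setU11.
Qed.

Lemma basis_card M B B' : basis M B -> basis M B' -> #|B| = #|B'|.
Proof.
have le : forall B1 B2, basis M B1 -> basis M B2 -> #|B1| <= #|B2|.
  move=> B1 B2 b1 b2; rewrite leqNgt; apply/negP => lt.
  have [e] := indep_aug (basis_indep b2) (basis_indep b1) lt.
  rewrite !inE => /andP [eB _] ie.
  have /maxsetP [_ mB] := b2.
  by have E := mB _ ie (subsetUr _ _); move: eB; rewrite -E setU11.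
by move=> b b'; apply/eqP; rewrite eqn_leq !le.
Qed.

Lemma basis_exists M : exists B, basis M B.
Proof. by have [B bB _] := maxset_exists (indep0 M); exists B. Qed.

Definition coindep M X : bool :=
  (X \subset ground M) && [exists B, basis M B && [disjoint X & B]].

Lemma coindep_ground M X : coindep M X -> X \subset ground M.
Proof. by case/andP. Qed.

Lemma coindep0 M : coindep M set0.
Proof.
rewrite /coindep sub0set /=; have [B bB] := basis_exists M.
by apply/existsP; exists B; rewrite bB -setI_eq0 set0I eqxx.
Qed.

Lemma coindepS M X Y : X \subset Y -> coindep M Y -> coindep M X.
Proof.
move=> s /andP [sY /existsP [B /andP [bB d]]]; apply/andP; split.
  exact: subset_trans sY.
by apply/existsP; exists B; rewrite bB (disjointWl s d).
Qed.

Lemma coindep_aug M X Y : coindep M X -> coindep M Y -> #|X| < #|Y| ->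
  exists2 e, e \in Y :\: X & coindep M (e |: X).
Proof.
move=> /andP [sX /existsP [B /andP [bB dX]]] /andP [sY /existsP [B' /andP [bB' dY]]] lt.
have iD : indep M (B' :\: X) by apply: indepS (basis_indep bB'); apply: subsetDl.
have [B2 [b2 s1 s2]] := indep_ext iD bB.
have dX2 : [disjoint X & B2].
  rewrite disjoint_sym disjoint_subset; apply/subsetP => x /(subsetP s2).
  rewrite !inE => /orP [/andP [] //|xB].
  by apply: contraL xB => xX; rewrite (disjointFr dX xX).
have [sub|/subsetPn [e eYX eB2]] := boolP (Y :\: X \subset B2).
  exfalso.
  have d3 : (Y :\: X) :&: (B' :\: X) = set0.
    apply/setP => x; rewrite !inE; apply/negP.
    by case/andP => /andP [_ xY] /andP [_ xB]; rewrite (disjointFr dY xY) in xB.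
  have c1 : #|Y :\: X| + #|B' :\: X| <= #|B2|.
    by rewrite -cardsUI d3 cards0 addn0 subset_leq_card // subUset sub s1.
  have c2 : #|B' :&: X| <= #|X :\: Y|.
    apply/subset_leq_card/subsetP => x; rewrite !inE => /andP [xB xX].
    by rewrite xX andbT; apply: contraL xB => xY; rewrite (disjointFr dY xY).
  have c3 := cardsID X B'; have c4 := cardsID X Y; have c5 := cardsID Y X.
  have c6 := basis_card b2 bB'.
  rewrite [X :&: Y]setIC in c5.
  lia.
exists e => //; apply/andP; split.
  by rewrite subUset sub1set sX andbT (subsetP sY) //; move: eYX; rewrite inE => /andP [].
apply/existsP; exists B2; rewrite b2 /= -setI_eq0 setIUl.
by rewrite setU_eq0 !setI_eq0 dX2 andbT disjoints1.
Qed.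

Definition mdual M : matroid T :=
  Matroid (@coindep_ground M) (coindep0 M) (@coindepS M) (@coindep_aug M).

Section Deletion.
Variables (M : matroid T) (X : {set T}).

Definition del_indep I : bool := indep M I && (I \subset ground M :\: X).

Lemma del_ground I : del_indep I -> I \subset ground M :\: X.
Proof. by case/andP. Qed.

Lemma del_indep0 : del_indep set0.
Proof. by rewrite /del_indep indep0 sub0set. Qed.

Lemma del_indepS I J : I \subset J -> del_indep J -> del_indep I.
Proof.
by move=> s /andP [iJ sJ]; rewrite /del_indep (indepS s iJ) (subset_trans s sJ).
Qed.

Lemma del_aug I J : del_indep I -> del_indep J -> #|I| < #|J| ->
  exists2 e, e \in J :\: I & del_indep (e |: I).
Proof.
move=> /andP [iI sI] /andP [iJ sJ] lt; have [e eJ ie] := indep_aug iI iJ lt.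
exists e => //; rewrite /del_indep ie subUset sI andbT sub1set (subsetP sJ) //.
by move: eJ; rewrite inE => /andP [].
Qed.

Definition deletion : matroid T :=
  Matroid del_ground del_indep0 del_indepS del_aug.

End Deletion.

Definition contraction M X : matroid T := mdual (deletion (mdual M) X).

Definition loop M e : bool := circuit M [set e].
Definition coloop M e : bool := loop (mdual M) e.

Definition parallel M e f : bool := (e != f) && circuit M [set e; f].
Definition in_series M e f : bool := parallel (mdual M) e f.

Definition parallel_class M P : bool :=
  maxset (fun X : {set T} =>
    [&& X \subset ground M,
        [forall e in X, ~~ loop M e] &
        [forall e in X, forall f in X, (e != f) ==> parallel M e f]]) P.
Definition series_class M P : bool := parallel_class (mdual M) P.

Definition same_component M e f : Prop :=
  e = f \/ exists C, [/\ circuit M C, e \in C & f \in C].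

Definition mconnected M : Prop :=
  forall e f, e \in ground M -> f \in ground M -> same_component M e f.

(* A separator is a union of connected components. *)
Definition separator M X : Prop :=
  X \subset ground M /\
  forall e f, e \in X -> f \in ground M -> same_component M e f -> f \in X.

(* [free] is linear independence of the family of vectors indexed by X, so
   repeated vectors count as dependent. *)
Definition representable (F : fieldType) M : Prop :=
  exists (d : nat) (v : T -> 'rV[F]_d), forall X, X \subset ground M ->
    indep M X = free [seq v x | x <- enum X].

Definition binary M : Prop := representable 'F_2 M.

(* A reversible cyclic ordering is given by listing X around the polygon; the
   listing matters only up to rotation and reversal, under which adjacency is
   invariant. *)
Definition cyclic_ordering X (s : seq T) : Prop := uniq s /\ s =i X.

Definition adjacent (s : seq T) e f : bool :=
  [&& e \in s, f \in s & (next s e == f) || (next s f == e)].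

Definition matroid_ordering M (O : {set T} -> seq T) : Prop :=
  forall C, circuit M C -> cyclic_ordering C (O C).

Definition consistent M (O : {set T} -> seq T) : Prop :=
  forall e f C C', e != f -> circuit M C -> circuit M C' ->
    [set e; f] \subset C :&: C' -> adjacent (O C) e f -> adjacent (O C') e f.

Definition orderable M : Prop :=
  exists O, matroid_ordering M O /\ consistent M O.

Definition two_sum p M N (MN : matroid T) : Prop :=
  [/\ ground M :&: ground N = [set p],
      ~ separator M [set p], ~ separator N [set p],
      ground MN = (ground M :|: ground N) :\ p &
      forall C, circuit MN C <->
        [\/ circuit M C /\ p \notin C,
            circuit N C /\ p \notin C |
            exists C1 C2, [/\ circuit M C1, circuit N C2, p \in C1, p \in C2
                            & C = (C1 :\ p) :|: (C2 :\ p)]]].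

End Matroids.

Definition matroid_iso (T1 T2 : finType) (f : T1 -> T2)
    (M1 : matroid T1) (M2 : matroid T2) : Prop :=
  [/\ {in ground M1 &, injective f}, f @: ground M1 = ground M2 &
      forall X : {set T1}, X \subset ground M1 ->
        indep M1 X = indep M2 (f @: X)].

Definition isomorphic (T1 T2 : finType) (M1 : matroid T1) (M2 : matroid T2) :
  Prop := exists f : T1 -> T2, matroid_iso f M1 M2.

Section Uniform.
Variables r n : nat.

Definition uniform_indep : pred {set 'I_n} := fun X => #|X| <= r.

Lemma uniform_ground I : uniform_indep I -> I \subset [set: 'I_n].
Proof. by rewrite subsetT. Qed.

Lemma uniform_indep0 : uniform_indep set0.
Proof. by rewrite /uniform_indep cards0. Qed.

Lemma uniform_indepS (I J : {set 'I_n}) :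
  I \subset J -> uniform_indep J -> uniform_indep I.
Proof. by move=> /subset_leq_card; apply: leq_trans. Qed.

Lemma uniform_aug (I J : {set 'I_n}) :
  uniform_indep I -> uniform_indep J -> #|I| < #|J| ->
  exists2 e, e \in J :\: I & uniform_indep (e |: I).
Proof.
move=> _ iJ lt; have [/subset_leq_card|/subsetPn [e eJ eI]] := boolP (J \subset I).
  by rewrite leqNgt lt.
exists e; first by rewrite inE eI eJ.
by rewrite /uniform_indep cardsU1 eI; apply: leq_trans iJ.
Qed.

Definition uniform : matroid 'I_n :=
  Matroid uniform_ground uniform_indep0 uniform_indepS uniform_aug.

End Uniform.

(* Multigraphs with vertex set V and edges labelled in T; an edge with a
   singleton set of ends is a loop. *)
Record graph (V T : finType) := Graph {
  edges : {set T};
  ends : T -> {set V};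
  ends_card : forall e, e \in edges -> 0 < #|ends e| <= 2
}.

Section Graphs.
Variables V T : finType.
Implicit Type G : graph V T.

(* A walk from x is recorded by its successive steps: the edge used and the
   vertex reached. *)
Fixpoint walk G (x : V) (w : seq (T * V)) : bool :=
  if w is (e, y) :: w' then
    [&& e \in edges G, ends G e == [set x; y] & walk G y w']
  else true.

Definition graph_path G (x y : V) (w : seq (T * V)) : bool :=
  [&& walk G x w, last x (unzip2 w) == y & uniq (x :: unzip2 w)].

Definition closed_path G (x : V) (w : seq (T * V)) : bool :=
  [&& w != [::], walk G x w, last x (unzip2 w) == x,
      uniq (unzip1 w) & uniq (unzip2 w)].

Definition cycle_matroid_of G (M : matroid T) : Prop :=
  ground M = edges G /\
  forall C : {set T}, circuit M C <->
    exists x w, closed_path G x w /\ C = [set e in unzip1 w].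

Definition internal (x : V) (w : seq (T * V)) : seq V :=
  behead (belast x (unzip2 w)).

Definition theta_graph G : Prop :=
  exists (u v : V) (w1 w2 w3 : seq (T * V)),
    let vs := [:: u, v & internal u w1 ++ internal u w2 ++ internal u w3] in
    let es := unzip1 w1 ++ unzip1 w2 ++ unzip1 w3 in
    [/\ [&& graph_path G u v w1, graph_path G u v w2 & graph_path G u v w3],
        uniq vs, uniq es, vs =i V & es =i edges G].

End Graphs.

(* [S e] is the set of the k elements in series that replace e; contracting
   all but one element of each [S e] recovers M. *)
Definition balanced_series_extension (T1 T2 : finType)
    (M : matroid T1) (M' : matroid T2) : Prop :=
  (forall e, ~~ coloop M e) /\
  exists (k : nat) (S : T1 -> {set T2}),
    [/\ 1 < k,
        ground M' = \bigcup_(e in ground M) S e,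
        {in ground M &, forall e f, e != f -> [disjoint S e & S f]},
        {in ground M, forall e, #|S e| = k /\
           {in S e &, forall x y, x != y -> in_series M' x y}} &
        exists2 r : T1 -> T2, {in ground M, forall e, r e \in S e} &
          matroid_iso r M
            (contraction M' (ground M' :\: r @: ground M))].

Definition parallel_path_addition (T : finType) (M M'' : matroid T) : Prop :=
  exists (P Q P' : {set T}) (t t' : T) (M' N : matroid T)
         (V : finType) (G : graph V T),
    [/\ [/\ series_class M Q, P \subset Q & t \in P],
        [/\ t' \notin ground M, [disjoint P' & ground M], t' \notin P'
          & #|P'| = #|P|],
        matroid_iso (fun x => if x == t then t' else x)
          (contraction M (P :\ t)) M',
        [/\ theta_graph G, cycle_matroid_of G N &
            forall S, series_class N S <-> [\/ S = [set t'], S = P | S = P']] &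
        two_sum t' M' N M''].

(* Closure under isomorphism lets each operation take place in an ambient type
   with room for the new elements. *)
Inductive obtainable (n : nat) : forall T : finType, matroid T -> Prop :=
| obtainable_uniform : obtainable n (uniform 2 n)
| obtainable_iso (T1 T2 : finType) (M1 : matroid T1) (M2 : matroid T2) :
    obtainable n M1 -> isomorphic M1 M2 -> obtainable n M2
| obtainable_series (T1 T2 : finType) (M1 : matroid T1) (M2 : matroid T2) :
    obtainable n M1 -> balanced_series_extension M1 M2 -> obtainable n M2
| obtainable_parallel_path (T : finType) (M1 M2 : matroid T) :
    obtainable n M1 -> parallel_path_addition M1 M2 -> obtainable n M2.

(* Main.v *)
(* A consistent ordering is a symmetric relation h such that every circuit C is a hamiltonian cycle
   of the graph induced by h on C.

   Forward direction. A non-binary matroid has a union L of circuits of nullity 2 with at least four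
   series classes; its circuits are the complements in L of these classes. Counting the h-neighbours
   of an element of L inside each circuit shows that there are exactly four classes, all of the same
   size, and that h joins each element to exactly one element of every other class. Adding an ear to
   L therefore has only two outcomes: either the ear is a new class of the same size (locally a
   subdivision of U_{3,5}), or it is a path Z that can replace a subset Q of a class and with which Q
   forms a circuit. If no such pair (Q, Z) exists, the series classes of M have a common size k and
   its circuits are the unions of three of them, so M is U_{2,n} or a balanced series extension of
   it. Otherwise take Q of minimum size. No circuit can split Q or Z,
   so M arises from M \ Z by parallel-path addition, and M \ Z is again connected and contains L.

   Backward direction. To the relation h one adds integer weights w(x, y) on adjacent pairs,
   antisymmetric except on 2-element circuits, that sum to 1 or -1 around every circuit; for U_{2,n}
   take the sign of y - x. Then the k-fold cyclic cover of a circuit with voltages w mod k is again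
   a single cycle, which orders the circuits of a balanced series extension, with weights given by
   the carries. Parallel-path addition copies the data along a bijection of the two paths and orders
   the circuit formed by both paths alternately, as the cover of a 2-element circuit. *)

Require Import Defs.
From mathcomp Require Import all_boot all_order all_algebra.
From mathcomp Require Import zify ring.
From Stdlib Require Import Classical_Prop.

Set Implicit Arguments.
Unset Strict Implicit.
Unset Printing Implicit Defensive.

(** * Nullity and circuits *)

(** Nullity is the working notion because the nullity of a complement is corank in the dual: unions
    of circuits are complements of dual flats, a quad is a dual line with at least four points, and
    a quad with an ear is a dual plane in which the ear is one point and the classes of the quad are
    the lines through it. The outcomes for an ear are point configurations in that plane; what the
    ordering adds is rigidity: the number of classes, their common size, and their trace on a
    circuit shared by two quads. Minimum size of [Q] is what rules out circuits that contain only
    part of [Q]; a 2-sum along [Q] requires that there be none. The weights answer when a lifted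
    cycle is a single one: the total voltage must be prime to k. As k is arbitrary and extensions
    are iterated, the total is kept at 1 or -1, a value that the lift reproduces. Two-element
    circuits must be exempt from antisymmetry, since their total would be 0. The induction also
    carries that elements in series are never adjacent, without which a path and its copy could not
    be ordered alternately. *)

Lemma eq_if (a b : bool) : a = b -> if a then b else ~~ b.
Proof. by move=> ->; case: b. Qed.

Lemma if_eq (a b : bool) : (if a then b else ~~ b) -> a = b.
Proof. by case: a; case: b. Qed.

(* [sets] decides equality, inclusion and disjointness of explicit finite sets
   pointwise, by a truth table over the membership atoms. *)
Ltac set_at x :=
  repeat match goal with
  | H : is_true (_ \subset _) |- _ => move/subsetP: H => /(_ x) /implyP H
  | H : is_true [disjoint _ & _] |- _ =>
      rewrite -setI_eq0 in H; move/eqP: H => /setP /(_ x) /eq_if H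
  | H : @eq {set _} _ _ |- _ => move/setP: H => /(_ x) /eq_if H
  end.

Ltac set_hyps :=
  repeat match goal with
  | H : is_true ?P |- _ => lazymatch P with
      | context [in_mem _ _] => move: H; apply/implyP
      | ~~ (_ == _) => move: H; apply/implyP
      end
  end.

Ltac set_eqs :=
  repeat match goal with
  | |- context [?a == ?b] =>
    tryif constr_eq a b then rewrite eqxx else
    case: (altP (a =P b)) => [?|_]; [subst|]
  end.

Definition allb (f : bool -> bool) : bool := f true && f false.

Lemma allbP f : allb f -> forall b, f b.
Proof. by case/andP => ? ?; case. Qed.

Ltac set_atoms :=
  repeat match goal with
  | |- context [in_mem ?a (mem ?A)] => move: (in_mem a (mem A)) => ?
  end;
  repeat match goal with H : ?P |- _ => lazymatch P with bool => fail | _ => clear H end end;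
  repeat match goal with b : bool |- _ =>
    move: b; match goal with |- forall b, is_true (@?f b) => apply (@allbP f) end
  end;
  vm_compute; reflexivity.

Ltac set_near x :=
  repeat match goal with
  | H : is_true ?P |- _ => lazymatch P with
      | context [in_mem x _] => move: H; apply/implyP
      end
  end.

Ltac set_point at_point hyps_at :=
  lazymatch goal with
  | |- @eq {set _} _ _ => let x := fresh "x" in
       apply/setP => x; at_point x; apply: if_eq; hyps_at x
  | |- is_true (_ \subset _) => let x := fresh "x" in
       apply/subsetP => x; at_point x; apply/implyP; hyps_at x
  | |- is_true [disjoint _ & _] => let x := fresh "x" in
       rewrite -setI_eq0; apply/eqP/setP => x; at_point x; apply: if_eq; hyps_at x
  | |- @eq bool _ _ => apply: if_eq
  | _ => idtac
  end.

Ltac no_hyps x := idtac.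

Ltac set_decide := rewrite ?inE; set_eqs; rewrite ?inE ?eqxx /=; set_atoms.

Ltac sets :=
  repeat match goal with |- _ -> _ => intro end;
  first
  [ set_point no_hyps no_hyps; set_decide
  | set_point set_at set_near; set_decide
  | set_point set_at no_hyps; set_hyps; set_decide ].

(* [lia] becomes very slow in the presence of the many set-valued hypotheses below. *)
Ltac nlia :=
  intros;
  repeat match goal with
  | H : ?P |- _ => lazymatch P with
      | is_true (leq _ _) => fail
      | @eq nat _ _ => fail
      | is_true (?a == _) => tryif (let t := type of a in unify t nat) then fail else clear H
      | is_true (?a != _) => tryif (let t := type of a in unify t nat) then fail else clear H
      | _ => clear H
      end
  end; lia.

Section Nullity.
Variable T : finType.
Implicit Types (M : matroid T) (X Y Z C D I J : {set T}) (x y e f : T).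

Definition rk M X := \max_(I : {set T} | indep M I && (I \subset X)) #|I|.

(* Elements outside the ground set do not count, so they behave as coloops. *)
Definition nul M X := #|X :&: ground M| - rk M X.

Lemma rk_ub M X I : indep M I -> I \subset X -> #|I| <= rk M X.
Proof. by move=> iI sI; apply: leq_bigmax_cond; rewrite iI. Qed.

Lemma rk_ext M X I : indep M I -> I \subset X ->
  exists J, [/\ indep M J, I \subset J, J \subset X & #|J| = rk M X].
Proof.
move=> iI sI; pose Q J := [&& indep M J & J \subset X].
have [J /maxsetP [/andP [iJ sJ] mJ] sIJ] := @maxset_exists _ Q I (introT andP (conj iI sI)).
exists J; split=> //; apply/eqP; rewrite eqn_leq rk_ub //=.
apply/bigmax_leqP => K /andP [iK sK]; rewrite leqNgt; apply/negP => lt.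
have [e eK ie] := indep_aug iJ iK lt.
have eX : e \in X by move: eK; rewrite inE => /andP [_ /(subsetP sK)].
have E := mJ (e |: J) _ (subsetUr _ _).
move: eK; rewrite inE -E ?setU11 //.
by rewrite /Q ie subUset sub1set eX.
Qed.

Lemma rk_le M X : rk M X <= #|X :&: ground M|.
Proof.
apply/bigmax_leqP => I /andP [iI sI].
by apply: subset_leq_card; rewrite subsetI sI indep_ground.
Qed.

Lemma rk_submod M X Y : rk M (X :|: Y) + rk M (X :&: Y) <= rk M X + rk M Y.
Proof.
have [I [iI _ sI cI]] := rk_ext (indep0 M) (sub0set (X :&: Y)).
have sIU : I \subset X :|: Y by sets.
have [J [iJ sIJ sJ cJ]] := rk_ext iI sIU.
have h1 : #|J :&: X| <= rk M X by apply: rk_ub (subsetIr _ _); apply: indepS iJ; apply: subsetIl.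
have h2 : #|J :&: Y| <= rk M Y by apply: rk_ub (subsetIr _ _); apply: indepS iJ; apply: subsetIl.
have := cardsUI (J :&: X) (J :&: Y).
have -> : J :&: X :|: J :&: Y = J by sets.
have : #|I| <= #|(J :&: X) :&: (J :&: Y)| by apply: subset_leq_card; sets.
lia.
Qed.

Lemma nul0 M : nul M set0 = 0.
Proof. by rewrite /nul set0I cards0. Qed.

Lemma nul_super M X Y : nul M X + nul M Y <= nul M (X :|: Y) + nul M (X :&: Y).
Proof.
have := rk_submod M X Y; rewrite /nul.
have := rk_le M X; have := rk_le M Y; have := rk_le M (X :|: Y); have := rk_le M (X :&: Y).
have := cardsUI (X :&: ground M) (Y :&: ground M).
rewrite -setIUl -setIIl; lia.
Qed.

Lemma nulS M X Y : X \subset Y -> nul M X <= nul M Y.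
Proof.
move=> s; have := nul_super M X (Y :\: X).
have -> : X :|: (Y :\: X) = Y by sets.
have -> : X :&: (Y :\: X) = set0 by sets.
rewrite nul0; lia.
Qed.

Lemma nulD1 M X x : nul M X <= (nul M (X :\ x)).+1.
Proof.
have h1 : rk M (X :\ x) <= rk M X.
  have [J [iJ _ sJ <-]] := rk_ext (indep0 M) (sub0set (X :\ x)).
  by apply: rk_ub => //; apply: subset_trans sJ (subsetDl _ _).
have h2 : #|X :&: ground M| <= (#|(X :\ x) :&: ground M|).+1.
  rewrite (cardsD1 x (X :&: ground M)).
  have -> : (X :&: ground M) :\ x = (X :\ x) :&: ground M by sets.
  by case: (x \in _) => /=; lia.
rewrite /nul; lia.
Qed.

Lemma nulI M X : nul M (X :&: ground M) = nul M X.
Proof.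
apply/eqP; rewrite eqn_leq nulS ?subsetIl //= /nul -setIA setIid.
have : rk M (X :&: ground M) <= rk M X; last lia.
have [J [iJ _ sJ <-]] := rk_ext (indep0 M) (sub0set (X :&: ground M)).
by apply: rk_ub => //; apply: subset_trans sJ (subsetIl _ _).
Qed.

Lemma indep_nul M X : indep M X = (X \subset ground M) && (nul M X == 0).
Proof.
apply/idP/andP => [iX | [sX /eqP nX]].
  have sX := indep_ground iX; split=> //.
  have := rk_ub iX (subxx X); rewrite /nul (setIidPl sX); lia.
have [J [iJ _ sJ cJ]] := rk_ext (indep0 M) (sub0set X).
suff -> : X = J by [].
apply/eqP; rewrite eq_sym eqEcard sJ cJ.
by move: nX; rewrite /nul (setIidPl sX); lia.
Qed.

Lemma nulE M X : X \subset ground M -> nul M X = #|X| - rk M X.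
Proof. by move=> s; rewrite /nul (setIidPl s). Qed.

Lemma circuit_nul M C : circuit M C = minset (fun X => 0 < nul M X) C.
Proof.
apply/minsetP/minsetP => -[].
  case/andP => sC; rewrite indep_nul sC /= -lt0n => nC mC; split=> // D nD sD.
  apply: mC => //; rewrite (subset_trans sD sC) indep_nul (subset_trans sD sC) /=.
  by rewrite -lt0n.
move=> nC mC; have sC : C \subset ground M.
  by apply/setIidPl; apply: mC; rewrite ?subsetIl // nulI.
rewrite sC indep_nul sC /= -lt0n; split=> // D /andP [sD]; rewrite indep_nul sD /= -lt0n.
exact: mC.
Qed.

(* The union of the circuits contained in [X]. *)
Definition core M X := locked [set x in X | nul M (X :\ x) < nul M X].

Lemma in_core M X x : (x \in core M X) = (x \in X) && (nul M (X :\ x) < nul M X).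
Proof. by rewrite /core -lock inE. Qed.

Definition cyc M X := core M X == X.

Lemma coreS M X : core M X \subset X.
Proof. by apply/subsetP => x; rewrite in_core => /andP []. Qed.

Lemma cycP M X : reflect (forall x, x \in X -> nul M (X :\ x) < nul M X) (cyc M X).
Proof.
apply: (iffP eqP) => [E x | H]; first by rewrite -{1}E in_core => /andP [].
by apply/setP => x; rewrite in_core; case xX: (x \in X) => //=; apply: H.
Qed.

Lemma nulD1_core M X x : x \in core M X -> nul M X = (nul M (X :\ x)).+1.
Proof. by rewrite in_core => /andP [_]; have := nulD1 M X x; lia. Qed.

Lemma nulD1_ncore M X x : x \notin core M X -> nul M (X :\ x) = nul M X.
Proof.
rewrite in_core negb_and => /orP [nx | ].
  by congr (nul _ _); sets.
by rewrite -leqNgt => h; apply/eqP; rewrite eqn_leq h nulS // subsetDl.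
Qed.

Lemma nul_cyc M X x : cyc M X -> x \in X -> nul M X = (nul M (X :\ x)).+1.
Proof. by move=> /eqP E xX; apply: nulD1_core; rewrite E. Qed.

Lemma core_mono M X Y : X \subset Y -> core M X \subset core M Y.
Proof.
move=> s; apply/subsetP => x xX; have := nulD1_core xX; move: xX.
rewrite !in_core => /andP [xX _] h; rewrite (subsetP s) //=.
have := nul_super M X (Y :\ x).
have -> : X :|: (Y :\ x) = Y by sets.
have -> : X :&: (Y :\ x) = X :\ x by sets.
have := nulS M (subsetDl Y [set x]); lia.
Qed.

Lemma nul_core M X : nul M (core M X) = nul M X.
Proof.
have [n] := ubnP #|X|; elim: n X => // n IH X lt.
have [/eqP -> //|] := boolP (cyc M X); rewrite /cyc => ne.
have /subsetPn [x xX nx] : ~~ (X \subset core M X).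
  by apply: contra ne => s; rewrite eqEsubset coreS s.
have lt' : #|X :\ x| < n by move: lt; rewrite (cardsD1 x) xX; lia.
have := IH _ lt'; rewrite (nulD1_ncore nx) => <-.
apply/eqP; rewrite eqn_leq andbC nulS ?core_mono ?subsetDl //=.
rewrite (IH _ lt') (nulD1_ncore nx); apply: nulS; exact: coreS.
Qed.

Lemma core_cyc M X : cyc M (core M X).
Proof.
apply/cycP => x xX; rewrite nul_core (nulD1_core xX) ltnS.
by apply: nulS; have := coreS M X; sets.
Qed.

Lemma cyc_core M X Y : cyc M X -> X \subset Y -> X \subset core M Y.
Proof. by move=> /eqP {2}<-; apply: core_mono. Qed.

Lemma cycU M X Y : cyc M X -> cyc M Y -> cyc M (X :|: Y).
Proof.
move=> cX cY; rewrite /cyc eqEsubset coreS subUset.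
by rewrite (cyc_core cX) ?subsetUl // (cyc_core cY) ?subsetUr.
Qed.

(** Cyclic sets are the complements of dual flats: removing any element of [Y] costs a unit of
    nullity. Most identifications of sets below rest on this. *)
Lemma cyc_eq M X Y : cyc M Y -> X \subset Y -> nul M Y <= nul M X -> X = Y.
Proof.
move=> cY sX le; apply/eqP; rewrite eqEsubset sX; apply/subsetP => x xY.
apply: contraT => nx; have := nul_cyc cY xY.
have : nul M X <= nul M (Y :\ x) by apply: nulS; sets.
lia.
Qed.

Lemma cyc_ground M X : cyc M X -> X \subset ground M.
Proof.
move=> cX; apply/setIidPl; apply: (@cyc_eq M) => //; first exact: subsetIl.
by rewrite nulI.
Qed.

Lemma circuitP M C : reflect (cyc M C /\ nul M C = 1) (circuit M C).
Proof.
rewrite circuit_nul; apply: (iffP minsetP) => [[nC mC] | [cC nC]].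
  have h : forall x, x \in C -> nul M (C :\ x) = 0.
    move=> x xC; apply/eqP; rewrite -leqn0 leqNgt; apply/negP => nx.
    by have /setP /(_ x) := mC _ nx (subsetDl _ _); rewrite !inE eqxx xC.
  split; first by apply/cycP => x xC; rewrite h.
  have [/eqP C0 | [x xC]] := set_0Vmem C; first by move: nC; rewrite (eqP C0) nul0.
  by have := nulD1 M C x; rewrite h //; lia.
rewrite nC; split=> // D nD sD; apply: (@cyc_eq M) => //; lia.
Qed.

Lemma circuit_cyc M C : circuit M C -> cyc M C.
Proof. by case/circuitP. Qed.

Lemma circuit_nul1 M C : circuit M C -> nul M C = 1.
Proof. by case/circuitP. Qed.

Lemma circuit_core M X C : circuit M C -> C \subset X -> C \subset core M X.
Proof. by move/circuit_cyc; apply: cyc_core. Qed.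

Lemma circuit_eq M C D : circuit M C -> circuit M D -> C \subset D -> C = D.
Proof.
move=> /circuitP [cC nC] /circuitP [cD nD] s; apply: (@cyc_eq M) => //; lia.
Qed.

Lemma circuit_n0 M C : circuit M C -> exists x, x \in C.
Proof.
move=> /circuit_nul1; have [-> |[x xC] _] := set_0Vmem C; first by rewrite nul0.
by exists x.
Qed.

(** Induction on the size. A cyclic [X] of nullity one is itself the circuit. Otherwise some [y]
    lies in a circuit avoiding [x]; deleting [x] and [y] then costs two units of nullity, so [x] is
    still in the core after the deletion of [y] alone. *)
Lemma cyc_circuit M X x : x \in core M X ->
  exists C, [/\ circuit M C, x \in C & C \subset X].
Proof.
have [n] := ubnP #|X|; elim: n X => // n IH X lt xX.
have [/eqP cX|] := boolP (cyc M X); last first.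
  rewrite /cyc => ne; have lt' : #|core M X| < n.
    apply: leq_trans (_ : #|X| <= _); last by lia.
    by apply: proper_card; rewrite properEneq ne coreS.
  have [|C [cC xC sC]] := IH _ lt'; first by rewrite (eqP (core_cyc M X)).
  by exists C; split=> //; apply: subset_trans sC (coreS _ _).
have n1 := nulD1_core xX.
have [E|nz] := posnP (nul M (X :\ x)).
  exists X; split=> //; last by rewrite -cX.
  by apply/circuitP; rewrite /cyc cX n1 E.
have [y yX] : exists y, y \in core M (X :\ x).
  have [E|[y yX]] := set_0Vmem (core M (X :\ x)); last by exists y.
  by move: nz; rewrite -nul_core E nul0.
have n2 := nulD1_core yX; move: (yX); rewrite in_core !inE => /andP [/andP [yx yX'] _].
have lt' : #|X :\ y| < n by move: lt; rewrite (cardsD1 y X) yX'; lia.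
have xX' : x \in X by rewrite -cX.
have [|C [cC xC sC]] := IH _ lt'.
  rewrite in_core !inE eq_sym yx xX' /=.
  have -> : X :\ y :\ x = X :\ x :\ y by sets.
  by have := nulD1 M X y; have := nulS M (subsetDl X [set y]); lia.
by exists C; split=> //; apply: subset_trans sC (subsetDl _ _).
Qed.

Lemma nul_circuit M X : 0 < nul M X -> exists2 C, circuit M C & C \subset X.
Proof.
move=> nX; have [E|[x xX]] := set_0Vmem (core M X).
  by move: nX; rewrite -nul_core E nul0.
by have [C [cC _ sC]] := cyc_circuit xX; exists C.
Qed.

(** Strong elimination by counting: as [D] avoids [f], deleting [f] and then [e] from the union
    costs two units of nullity. Deleting [e] first costs one of them, so [f] is still in the core
    and lies in a circuit. *)
Lemma circuit_elim M C D e f : circuit M C -> circuit M D ->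
  e \in C -> e \in D -> f \in C -> f \notin D ->
  exists C', [/\ circuit M C', f \in C', e \notin C' & C' \subset C :|: D].
Proof.
move=> cC cD eC eD fC fD; set X := C :|: D.
have eX : e \in core M X by apply: (subsetP (circuit_core cC (subsetUl _ _))).
have fX : f \in core M X by apply: (subsetP (circuit_core cC (subsetUl _ _))).
have eX' : e \in core M (X :\ f).
  by apply: (subsetP (circuit_core cD _)) => //; rewrite /X; sets.
have [|C' [c' fC' s']] := @cyc_circuit M (X :\ e) f.
  have := nulD1_core eX; have := nulD1_core fX; have := nulD1_core eX'.
  have -> : X :\ f :\ e = X :\ e :\ f by sets.
  rewrite in_core !inE fC orTb andbT => h1 h2 h3; apply/andP; split; last lia.
  by apply: contraNneq fD => ->.
exists C'; split=> //; last by apply: subset_trans s' (subsetDl _ _).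
by apply/negP => /(subsetP s'); rewrite !inE eqxx.
Qed.

Lemma nul_circuit_sub M X : (forall C, circuit M C -> ~~ (C \subset X)) -> nul M X = 0.
Proof.
move=> h; apply/eqP; rewrite -leqn0 leqNgt; apply/negP => /nul_circuit [C /h].
by move=> /negP.
Qed.

End Nullity.

(** * Lines and their series classes *)

Section Classes.
Variables (T : finType) (M : matroid T).
Implicit Types (L X Y C D : {set T}) (x y e f : T).

(* The series class of [x] in [M | L], for [L] a union of circuits. *)
Definition cls L x := locked (L :\: core M (L :\ x)).

Lemma in_cls L x y : (y \in cls L x) = (y \in L) && (y \notin core M (L :\ x)).
Proof. by rewrite /cls -lock inE andbC. Qed.

Lemma cls_sub L x : cls L x \subset L.
Proof. by apply/subsetP => y; rewrite in_cls => /andP []. Qed.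

Lemma cls_refl L x : x \in L -> x \in cls L x.
Proof. by move=> xL; rewrite in_cls xL; apply/negP => /(subsetP (coreS _ _)); rewrite !inE eqxx. Qed.

Lemma cls_core L x : core M (L :\ x) = L :\: cls L x.
Proof.
apply/setP => y; rewrite inE in_cls negb_and negbK.
have := subsetP (coreS M (L :\ x)) y; rewrite !inE.
by case: (y \in core _ _); case: (y \in L); rewrite ?andbF ?andbT //= => /(_ isT).
Qed.

(** The two cores are cyclic, one contains the other, and both have nullity one less than [L]. *)
Lemma cls_eq L x y : cyc M L -> x \in L -> y \in cls L x -> cls L y = cls L x.
Proof.
move=> cL xL; rewrite in_cls => /andP [yL ny].
have E : core M (L :\ x) = core M (L :\ y).
  apply: (@cyc_eq _ M); first exact: core_cyc.
    apply: cyc_core; first exact: core_cyc.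
    apply/subsetP => z zc; rewrite !inE (subsetP (subset_trans (coreS _ _) (subsetDl _ _)) _ zc).
    by rewrite andbT; apply: contraNneq ny => <-.
  by rewrite !nul_core; have := nul_cyc cL xL; have := nul_cyc cL yL; lia.
by rewrite /cls E.
Qed.

Lemma cls_sym L x y : cyc M L -> x \in L -> y \in L -> (y \in cls L x) = (x \in cls L y).
Proof.
by move=> cL xL yL; apply/idP/idP => h; rewrite (cls_eq cL _ h) ?cls_refl.
Qed.

Lemma cls_circuit L x y C : cyc M L -> circuit M C -> C \subset L ->
  x \in L -> y \in cls L x -> (y \in C) = (x \in C).
Proof.
move=> cL cC sC xL.
have sub u v : u \in L -> v \in cls L u -> v \in C -> u \in C.
  rewrite in_cls => uL /andP [vL nv] vC; apply: contraNT nv => uC.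
  by apply: (subsetP (circuit_core cC _) _ vC); sets.
move=> yx; apply/idP/idP; first exact: sub.
by apply: sub; rewrite ?(subsetP (cls_sub L x)) // -cls_sym // (subsetP (cls_sub L x)).
Qed.

Lemma cls_disj L x y : cyc M L -> x \in L -> y \in L -> y \notin cls L x ->
  [disjoint cls L x & cls L y].
Proof.
move=> cL xL yL; apply: contraNT; case/pred0Pn => z /= /andP [zx zy].
by rewrite -(cls_eq cL _ zx) // (cls_eq cL _ zy) // cls_refl.
Qed.

(* The dual of [M | L] has rank 2: the circuits in [L] are the complements of its series classes. *)
Definition line L : Prop := cyc M L /\ nul M L = 2.

Lemma line_circuit L x : line L -> x \in L -> circuit M (L :\: cls L x).
Proof.
move=> [cL nL] xL; rewrite -cls_core; apply/circuitP; split; first exact: core_cyc.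
by rewrite nul_core; have := nul_cyc cL xL; lia.
Qed.

Lemma line_circuitE L x C : line L -> circuit M C -> C \subset L -> x \in L -> x \notin C ->
  C = L :\: cls L x.
Proof.
move=> lL cC sC xL xC; apply: (@circuit_eq _ M) => //; first exact: line_circuit.
by rewrite -cls_core; apply: circuit_core => //; sets.
Qed.

Lemma line_proper L C : line L -> circuit M C -> C \subset L -> exists2 x, x \in L & x \notin C.
Proof.
move=> [_ nL] cC sC; apply/subsetPn; apply/negP => h.
have E : L = C by apply/eqP; rewrite eqEsubset h.
by have := circuit_nul1 cC; rewrite -E nL.
Qed.

(* The restriction to [L] has a [U_{2,4}]-minor. *)
Definition quad L : Prop := line L /\ 3 < #|cls L @: L|.

Lemma other_class L (s : seq T) : line L -> size s < #|cls L @: L| -> {subset s <= L} ->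
  exists y, [/\ y \in L & forall x, x \in s -> y \notin cls L x].
Proof.
move=> lL cL sL.
have : ~~ (cls L @: L \subset [set:: map (cls L) s]).
  apply/negP => /subset_leq_card; rewrite cardsE leqNgt => /negP; apply.
  by apply: leq_trans cL; rewrite ltnS (leq_trans (card_size _)) // size_map.
case/subsetPn => X /imsetP [y yL ->]; rewrite inE => ny.
exists y; split=> // x xs; apply: contra ny => h.
by rewrite (cls_eq (proj1 lL) _ h) ?sL // map_f.
Qed.

Lemma quad_pick L x : quad L -> x \in L -> exists a b c,
  [/\ [/\ a \in L, b \in L & c \in L],
      [/\ a \notin cls L x, b \notin cls L x & c \notin cls L x] &
      [/\ b \notin cls L a, c \notin cls L a & c \notin cls L b]].
Proof.
move=> [lL cL] xL.
have [||a [aL na]] := @other_class L [:: x] lL; first exact: leq_trans cL.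
  by move=> u; rewrite inE => /eqP ->.
have [||b [bL nb]] := @other_class L [:: x; a] lL; first exact: leq_trans cL.
  by move=> u; rewrite !inE => /orP [] /eqP ->.
have [||c [c' nc]] := @other_class L [:: x; a; b] lL; first exact: leq_trans cL.
  by move=> u; rewrite !inE => /or3P [] /eqP ->.
by exists a, b, c; rewrite aL bL c'; split; split=> //;
  solve [by apply: na; rewrite !inE eqxx ?orbT | by apply: nb; rewrite !inE eqxx ?orbT | by apply: nc; rewrite !inE eqxx ?orbT].
Qed.

Lemma quad_intro L (s : seq T) : line L -> {subset s <= L} -> 4 <= size s ->
  pairwise (fun x y => y \notin cls L x) s -> quad L.
Proof.
move=> lL sL ss pw; split=> //; apply: leq_trans ss _.
have u : uniq (map (cls L) s).
  rewrite uniq_pairwise pairwise_map.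
  apply: sub_in_pairwise pw => // x y xs ys /=.
  by apply: contra => /eqP ->; rewrite cls_refl // sL.
rewrite -(size_map (cls L)) -(card_uniqP u) subset_leq_card //.
by apply/subsetP => X /mapP [x xs ->]; apply: imset_f; apply: sL.
Qed.

Lemma line_meet L x : line L -> x \in L -> nul M (L :\ x) = 1.
Proof. by move=> [cL nL] xL; have := nul_cyc cL xL; lia. Qed.

End Classes.

(** * Cyclic orders *)

Section Cyclic.
Variable T : finType.
Implicit Types (C D U : {set T}) (nx : T -> T) (x y : T).

Definition cyclic_on C nx : Prop :=
  {in C, forall x, nx x \in C} /\ {in C &, forall x y, fconnect nx x y}.

Lemma cyclic_iter C nx n x : cyclic_on C nx -> x \in C -> iter n nx x \in C.
Proof. by move=> [h _] xC; elim: n => //= n; apply: h. Qed.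

Lemma cyclic_reach C nx x y : cyclic_on C nx -> x \in C -> y \in C ->
  exists n, y = iter n nx x.
Proof. by move=> [_ h] xC yC; have /iter_findex <- := h _ _ xC yC; eexists. Qed.

Lemma cyclic_img C nx : cyclic_on C nx -> nx @: C = C.
Proof.
move=> cn; apply/setP => y; apply/imsetP/idP => [[x xC ->]|yC]; first exact: (proj1 cn).
have [n E] := cyclic_reach cn (proj1 cn y yC) yC.
exists (iter n nx y); first exact: cyclic_iter.
by rewrite -iterSr in E; rewrite -iterS.
Qed.

Lemma cyclic_inj C nx : cyclic_on C nx -> {in C &, injective nx}.
Proof. by move=> cn; apply/imset_injP; rewrite cyclic_img. Qed.

Lemma cyclic_prev C nx x : cyclic_on C nx -> x \in C -> exists2 y, y \in C & nx y = x.
Proof.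
by move=> cn; rewrite -{1}(cyclic_img cn) => /imsetP [y yC ->]; exists y.
Qed.

Lemma cyclic_period C nx x d : cyclic_on C nx -> x \in C -> 0 < d ->
  iter d nx x = x -> #|C| <= d.
Proof.
move=> cn xC d0 E.
have per n : iter n nx x = iter (n %% d) nx x.
  rewrite {1}(divn_eq n d) addnC iterD; congr (iter _ _ _).
  by elim: (n %/ d) => //= k IH; rewrite mulSn iterD IH.
have s : C \subset [set:: [seq iter (val i) nx x | i : 'I_d]].
  apply/subsetP => y yC; have [n ->] := cyclic_reach cn xC yC.
  rewrite inE per; have lt : n %% d < d by rewrite ltn_mod.
  by apply/mapP; exists (Ordinal lt); rewrite ?mem_enum.
apply: leq_trans (subset_leq_card s) _; rewrite cardsE.
by apply: leq_trans (card_size _) _; rewrite size_map -cardE card_ord.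
Qed.

Lemma cyclic_closed C nx U x : cyclic_on C nx -> x \in C -> x \in U ->
  (forall y, y \in U -> y \in C -> nx y \in U) -> C \subset U.
Proof.
move=> cn xC xU cl; apply/subsetP => y yC; have [n ->] := cyclic_reach cn xC yC.
by elim: n => //= n IH; apply: cl => //; apply: cyclic_iter.
Qed.

(** Applied with [f] the class in a quad: along a circuit the classes recur every third step and not
    before. *)
Lemma iter_mod3 (L : eqType) (f : T -> L) C nx x n : cyclic_on C nx -> x \in C ->
  (forall y, y \in C -> [/\ f (nx y) != f y, f (nx (nx y)) != f y & f (nx (nx (nx y))) = f y]) ->
  (f (iter n nx x) == f x) = (n %% 3 == 0).
Proof.
move=> cn xC h; have per : forall k, f (iter (k * 3) nx x) = f x.
  elim=> // k IH; rewrite mulSn iterD /=.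
  by have [] := h _ (cyclic_iter (k * 3) cn xC); rewrite IH.
have [] := h _ (cyclic_iter (n %/ 3 * 3) cn xC); rewrite per => h1 h2 _.
rewrite {1}(divn_eq n 3) addnC iterD.
have : n %% 3 < 3 by rewrite ltn_mod.
case: (n %% 3) => [|[|[|]]] //= _; first by rewrite per eqxx.
  by apply/negbTE.
by apply/negbTE.
Qed.

Definition deg (h : rel T) x C := #|[set y in C | h x y]|.

Lemma deg0 h x C : (deg h x C == 0) = [forall y in C, ~~ h x y].
Proof.
rewrite /deg cards_eq0; apply/eqP/forall_inP => [E y yC|H].
  by apply/negP => hy; move/setP: E => /(_ y); rewrite !inE yC hy.
by apply/setP => y; rewrite !inE; apply/negP => /andP [/H /negbTE ->].
Qed.

Lemma degU h x C D : [disjoint C & D] -> deg h x (C :|: D) = deg h x C + deg h x D.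
Proof.
move=> d; rewrite /deg -cardsUI.
have -> : [set y in C | h x y] :&: [set y in D | h x y] = set0.
  apply/setP => y; rewrite !inE; case yC: (y \in C) => //=.
  by rewrite (disjointFr d yC) andbF.
rewrite cards0 addn0; congr #|pred_of_set _|.
by apply/setP => y; rewrite !inE andb_orl.
Qed.

Lemma degS h x C D : C \subset D -> deg h x C <= deg h x D.
Proof.
move=> s; apply: subset_leq_card; apply/subsetP => y; rewrite !inE => /andP [yC ->].
by rewrite (subsetP s).
Qed.

Lemma deg_sum h C D : symmetric h ->
  \sum_(x in C) deg h x D = \sum_(y in D) deg h y C.
Proof.
move=> hs.
have E A B : \sum_(x in A) deg h x B = \sum_(x in A) \sum_(y in B) (h x y : nat).
  apply: eq_bigr => x _; rewrite /deg -sum1_card -big_mkcondr /=.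
  by apply: eq_bigl => y; rewrite inE.
rewrite !E exchange_big /=; apply: eq_bigr => y _; apply: eq_bigr => x _.
by rewrite hs.
Qed.

End Cyclic.

(** * Neighbour counts in a consistent ordering *)

Section Orders.
Variables (T : finType) (M : matroid T) (h : rel T).
Implicit Types (L X Y C D B U : {set T}) (x y z e f : T).

(* A consistent ordering, given by its adjacency relation: each circuit is a hamiltonian cycle of the
   graph that [h] induces on it. *)
Definition ordered : Prop := symmetric h /\
  forall C, circuit M C -> exists nx, cyclic_on C nx /\
    {in C &, forall x y, h x y = (x != y) && ((nx x == y) || (nx y == x))}.

Hypothesis hM : ordered.

Let hsym : symmetric h := proj1 hM.

Lemma deg_circuit C x : circuit M C -> x \in C -> 3 <= #|C| -> deg h x C = 2.
Proof.
move=> cC xC C3; have [nx [cn hn]] := proj2 hM C cC.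
have [p pC pE] := cyclic_prev cn xC.
have nC := proj1 cn x xC.
have np : nx x != p.
  apply/negP => /eqP E; have := @cyclic_period _ C nx x 2 cn xC isT.
  by rewrite /= E pE => /(_ erefl); nlia.
have nxx : x != nx x.
  apply/negP => /eqP E; have := @cyclic_period _ C nx x 1 cn xC isT.
  by rewrite /= -E => /(_ erefl); nlia.
have px : x != p.
  by apply/negP => /eqP E; move: nxx; rewrite {2}E pE eqxx.
have E2 : #|[set nx x; p]| = 2 by rewrite cards2 np.
rewrite /deg -E2; congr #|pred_of_set _|; apply/setP => y; rewrite !inE.
apply/andP/orP => [[yC]|].
  rewrite hn // => /andP [_ /orP [/eqP ->|/eqP E]]; first by left.
  by right; apply/eqP; apply: (cyclic_inj cn) => //; rewrite E.
by case=> /eqP ->; split=> //; rewrite hn // ?nxx ?px ?eqxx // pE eqxx orbT.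
Qed.

Lemma circuit_connected C U x : circuit M C -> x \in C -> x \in U ->
  (forall y z, y \in U -> y \in C -> z \in C -> h y z -> z \in U) -> C \subset U.
Proof.
move=> cC xC xU cl; have [nx [cn hn]] := proj2 hM C cC.
apply: (cyclic_closed cn xC xU) => y yU yC.
have nC := proj1 cn y yC.
have [E|ne] := eqVneq y (nx y); first by rewrite -E.
by apply: (cl y) => //; rewrite hn // ne eqxx.
Qed.

Section Quad.
Variable L : {set T}.
Hypothesis qL : quad M L.
Let lL : line M L := proj1 qL.
Let cL : cyc M L := proj1 lL.
Local Notation cl := (cls M L).

Lemma quad_card3 x : x \in L -> 3 <= #|L :\: cl x|.
Proof.
move=> xL; have [a [b [c [[aL bL c'] [na nb nc] [nab nac nbc]]]]] := quad_pick qL xL.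
have ne u v : u \in L -> v \notin cl u -> u != v.
  by move=> uL; apply: contraNneq => <-; apply: cls_refl.
have -> : 3 = #|[set a; b; c]|.
  by rewrite -setUA cardsU1 cards2 !inE negb_or !ne.
apply: subset_leq_card; apply/subsetP => u; rewrite !inE -orbA.
by move=> /or3P [] /eqP ->; apply/andP.
Qed.

(** The complement of the class of [z] is a circuit through [x], and holds exactly two neighbours of
    [x]. Hence all classes other than that of [x] contain equally many neighbours of [x]. *)
Lemma quad_deg x z : x \in L -> z \in L -> z \notin cl x -> deg h x L = deg h x (cl z) + 2.
Proof.
move=> xL zL nz.
have h2 : deg h x (L :\: cl z) = 2.
  apply: deg_circuit; rewrite ?quad_card3 //; first exact: line_circuit.
  by rewrite !inE xL andbT (cls_sym cL).
rewrite -h2 -degU; last by sets.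
by congr deg; have := cls_sub M L z; sets.
Qed.

Let deg_le x (s : seq T) : x \in L -> {subset s <= L} ->
  pairwise (fun y z => z \notin cl y) s -> \sum_(z <- s) deg h x (cl z) <= deg h x L.
Proof.
move=> xL sL pw.
suff [U [sU dU <-]] : exists U, [/\ U \subset L,
    forall z, z \in L -> all (fun y => z \notin cl y) s -> [disjoint U & cl z]
    & deg h x U = \sum_(z <- s) deg h x (cl z)] by apply: degS.
elim/last_ind: s sL pw => [|s z IH] sL pw.
  exists set0; split; rewrite ?sub0set //; first by move=> z _ _; rewrite -setI_eq0 set0I.
  by rewrite big_nil; apply/eqP; rewrite deg0; apply/forall_inP => y; rewrite inE.
rewrite pairwise_rcons in pw; move/andP: pw => [az pw].
have zL : z \in L by apply: sL; rewrite mem_rcons mem_head.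
have [|//|U [sU dU E]] := IH; first by move=> y ys; apply: sL; rewrite mem_rcons inE ys orbT.
exists (U :|: cl z); split; first by rewrite subUset sU cls_sub.
  move=> y yL; rewrite all_rcons => /andP [yz ys].
  rewrite -setI_eq0 setIUl setU_eq0 !setI_eq0 dU //=.
  by apply: cls_disj.
by rewrite degU ?dU // E -cats1 big_cat big_seq1.
Qed.

(** Let D be the number of neighbours of [x] in [L]. Every class other than that of [x] holds D - 2
    of them, and there are at least three such classes, so 3(D - 2) is at most D and D is 2 or 3.
    For D = 3 the bound is tight: no neighbour in the class of [x], one in each other class, and a
    fifth class would need a fourth neighbour. *)
Lemma quad_nbr x z : x \in L -> z \in L ->
  deg h x (cl z) = (z \notin cl x) /\ #|cl @: L| = 4.
Proof.
have main u : u \in L -> exists a b c,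
    [/\ [/\ a \in L, b \in L & c \in L],
      [/\ a \notin cl u, b \notin cl u & c \notin cl u],
      [/\ b \notin cl a, c \notin cl a & c \notin cl b] &
      deg h u (cl u) + 3 * (deg h u L - 2) <= deg h u L /\ 2 <= deg h u L].
  move=> uL; have [a [b [c [[aL bL c'] [na nb nc] [nab nac nbc]]]]] := quad_pick qL uL.
  exists a, b, c; split=> //.
  have := quad_deg uL aL na; have := quad_deg uL bL nb; have := quad_deg uL c' nc.
  have := @deg_le u [:: u; a; b; c] uL.
  rewrite !big_cons big_nil /= na nb nc nab nac nbc => H.
  have {H} : deg h u (cl u) + (deg h u (cl a) + (deg h u (cl b) + (deg h u (cl c) + 0))) <= deg h u L.
    by apply: H => // v; rewrite !inE => /or4P [] /eqP ->.
  nlia.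
have D3 u : u \in L -> deg h u L = 3.
  move=> uL; have [a [b [c [[aL bL c'] [na nb nc] [nab nac nbc] [le1 le2]]]]] := main u uL.
  have [E|ne] := eqVneq (deg h u L) 2; last first.
    have := quad_deg uL aL na; nlia.
  (* D = 2 is impossible: no neighbour would then lie outside the own class, so the elements of
     degree 2 in the class of [u] would be closed under adjacency and exhaust the circuit
     [L :\: cl a], which also contains [b]. *)
  have sub : L :\: cl a \subset [set v in cl u | deg h v L == 2].
    apply: (@circuit_connected _ _ u); first exact: line_circuit.
    - by rewrite !inE uL andbT (cls_sym cL).
    - by rewrite inE cls_refl // E eqxx.
    move=> v w; rewrite !inE => /andP [vu /eqP E2] _ /andP [wa wL] hvw.
    have vL : v \in L by apply: (subsetP (cls_sub M L u)).
    have wv : w \in cl v.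
      apply: contraT => nw; have := quad_deg vL wL nw; rewrite E2 => E3.
      have : deg h v (cl w) == 0 by apply/eqP; nlia.
      by rewrite deg0 => /forall_inP /(_ w); rewrite cls_refl // hvw => /(_ isT).
    rewrite -(cls_eq cL uL vu) wv /=.
    have [a' [b' [d' [[aL' bL' _] [na' nb' _] _ [le1' le2']]]]] := main w wL.
    apply: contraT => n2; have : deg h w (cl w) == 0 by apply/eqP; nlia.
    rewrite deg0 => /forall_inP /(_ v); rewrite hsym hvw => /(_ _)/negP []//.
    by rewrite (cls_sym cL).
  have := subsetP sub b; rewrite !inE nab bL => /(_ isT) /andP [].
  by rewrite (negbTE nb).
move=> xL zL; split.
  case nz: (z \in cl x) => /=; last first.
    by have := quad_deg xL zL (negbT nz); rewrite D3 //; nlia.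
  rewrite (cls_eq cL xL nz).
  by have [a [b [c [_ _ _ [le1 _]]]]] := main x xL; move: le1; rewrite D3 //; nlia.
apply/eqP; rewrite eqn_leq (proj2 qL) andbT leqNgt; apply/negP => gt4.
have [a [b [c [[aL bL c'] [na nb nc] [nab nac nbc] _]]]] := main x xL.
have [|d [dL nd]] := @other_class _ _ L [:: x; a; b; c] lL gt4.
  by move=> v; rewrite !inE => /or4P [] /eqP ->.
have nx : d \notin cl x by apply: nd; rewrite !inE eqxx ?orbT.
have nda : d \notin cl a by apply: nd; rewrite !inE eqxx ?orbT.
have ndb : d \notin cl b by apply: nd; rewrite !inE eqxx ?orbT.
have ndc : d \notin cl c by apply: nd; rewrite !inE eqxx ?orbT.
have := @deg_le x [:: a; b; c; d] xL.
rewrite !big_cons big_nil /= nab nac nbc nda ndb ndc D3 // => H.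
have {H} : deg h x (cl a) + (deg h x (cl b) + (deg h x (cl c) + (deg h x (cl d) + 0))) <= 3.
  by apply: H => // v; rewrite !inE => /or4P [] /eqP ->.
have := quad_deg xL aL na; have := quad_deg xL bL nb; have := quad_deg xL c' nc.
have := quad_deg xL dL nx; rewrite D3 //; nlia.
Qed.

Lemma quad_nadj x y : x \in L -> y \in cl x -> h x y = false.
Proof.
move=> xL yx; have [+ _] := quad_nbr xL xL; rewrite cls_refl //= => /eqP.
by rewrite deg0 => /forall_inP /(_ y yx) /negbTE.
Qed.

Lemma quad_unique x y z : x \in L -> y \in L -> z \in cl y -> h x y -> h x z -> y = z.
Proof.
move=> xL yL zy hy hz; have zL := subsetP (cls_sub M L y) _ zy.
have ny : y \notin cl x by apply/negP => /(quad_nadj xL); rewrite hy.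
have [+ _] := quad_nbr xL yL; rewrite ny /= => /eqP /cards1P [w E].
have : y \in [set w] by rewrite -E inE cls_refl.
have : z \in [set w] by rewrite -E inE zy.
by rewrite !inE => /eqP -> /eqP ->.
Qed.

(** Between two distinct classes [h] is a perfect matching; its edges are counted from both
    sides. *)
Lemma quad_size x y : x \in L -> y \in L -> #|cl x| = #|cl y|.
Proof.
move=> xL yL; have [yx|nyx] := boolP (y \in cl x); first by rewrite (cls_eq cL xL yx).
have E u v : u \in L -> v \in L -> v \notin cl u -> \sum_(w in cl u) deg h w (cl v) = #|cl u|.
  move=> uL vL nv; rewrite -sum1_card; apply: eq_bigr => w wu.
  have wL := subsetP (cls_sub M L u) _ wu.
  by have [-> _] := quad_nbr wL vL; rewrite (cls_eq cL uL wu) nv.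
by rewrite -(E x y) // deg_sum // E // (cls_sym cL).
Qed.

Lemma quad_cover x a b c : x \in L ->
  [/\ a \in L, b \in L & c \in L] ->
  [/\ a \notin cl x, b \notin cl x & c \notin cl x] ->
  [/\ b \notin cl a, c \notin cl a & c \notin cl b] ->
  L = cl x :|: cl a :|: cl b :|: cl c.
Proof.
move=> xL [aL bL c'] [na nb nc] [nab nac nbc].
apply/eqP; rewrite eqEsubset; apply/andP; split; last by rewrite !subUset !cls_sub.
apply/subsetP => d dL; rewrite !inE; apply: contraT; rewrite !negb_or -!andbA.
move=> /and4P [dx da db dc]; have [_ E] := quad_nbr xL xL.
have u : uniq (map cl [:: x; a; b; c; d]).
  have ne v w : w \in L -> w \notin cl v -> cl v != cl w.
    by move=> wL; apply: contraNneq => ->; apply: cls_refl.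
  by rewrite /= !inE !negb_or !ne.
have : #|[set:: map cl [:: x; a; b; c; d]]| <= #|cl @: L|.
  apply: subset_leq_card; apply/subsetP => X; rewrite inE => /mapP [v vs ->].
  apply: imset_f; move: vs; rewrite !inE.
  by move=> /or4P [/eqP->|/eqP->|/eqP->|/orP [] /eqP->].
by rewrite cardsE (card_uniqP u) E.
Qed.

End Quad.
End Orders.

(** * Ears *)

Section Plane.
Variables (T : finType) (M : matroid T) (h : rel T).
Hypothesis hM : ordered M h.
Implicit Types (L X Y C D B S Q V : {set T}) (x y z e f q v : T).
Local Notation cl := (cls M).

(* Consecutive vertices of the cycle through [B] lie in distinct classes of a
   quad, so the class of a vertex is determined by its position modulo 3. *)
Lemma quad_grid L1 L2 B x y : quad M L1 -> quad M L2 -> circuit M B ->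
  B \subset L1 -> B \subset L2 -> x \in B -> y \in B ->
  (y \in cl L1 x) = (y \in cl L2 x).
Proof.
move=> q1 q2 cB s1 s2 xB yB; have [hsym ho] := hM.
have [nx [cn hn]] := ho B cB.
suff key L : quad M L -> B \subset L -> forall n,
    (iter n nx x \in cl L x) = (n %% 3 == 0).
  by have [n ->] := cyclic_reach cn xB yB; rewrite !key.
move=> qL sB n; have [lL _] := qL; have [cL _] := lL.
have inL z : z \in B -> z \in L := subsetP sB z.
have [b bL bB] := line_proper lL cB sB.
have EB := line_circuitE lL cB sB bL bB.
have B3 : 3 <= #|B| by rewrite EB; apply: (quad_card3 qL bL).
have hB z : z \in B -> h z (nx z).
  move=> zB; have nB := proj1 cn z zB; rewrite hn // eqxx andbT.
  apply/negP => /eqP E; have := @cyclic_period _ B nx z 1 cn zB isT.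
  by rewrite /= -E => /(_ erefl); nlia.
(* [nx z] has only one neighbour in each class, so a return to the class of [z] after two steps
   would be a return to [z] itself. *)
have nn z : z \in B -> nx (nx z) \notin cl L z.
  move=> zB; have n1 := proj1 cn z zB; have n2 := proj1 cn _ n1.
  apply/negP => hc; have := quad_unique hM qL (inL _ n1) (inL _ zB) hc.
  rewrite hsym !hB // => /(_ isT isT) E.
  have := @cyclic_period _ B nx z 2 cn zB isT; rewrite /= -E => /(_ erefl); nlia.
have n1 z : z \in B -> nx z \notin cl L z.
  move=> zB; apply/negP => hc; have := quad_nadj hM qL (inL _ zB) hc.
  by rewrite hB.
have clE u w : u \in L -> w \in L -> (cl L w == cl L u) = (w \in cl L u).
  move=> uL wL; apply/eqP/idP => [<-|]; [exact: cls_refl | exact: cls_eq].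
rewrite -clE ?inL ?cyclic_iter //.
apply: (@iter_mod3 _ _ (cl L) B nx x n cn xB) => z zB.
have zB1 := proj1 cn z zB; have zB2 := proj1 cn _ zB1; have zB3 := proj1 cn _ zB2.
rewrite !clE ?inL // n1 // nn //; split=> //.
apply/eqP; rewrite clE ?inL //.
have nb u : u \in B -> b \notin cl L u.
  move=> uB; rewrite (cls_sym cL (inL _ uB) bL).
  by move: uB; rewrite {1}EB inE => /andP [].
have I1 : [/\ nx z \notin cl L z, nx (nx z) \notin cl L z & b \notin cl L z].
  by split; [apply: n1 | apply: nn | apply: nb].
have I2 : [/\ nx (nx z) \notin cl L (nx z), b \notin cl L (nx z) & b \notin cl L (nx (nx z))].
  by split; [apply: n1 | apply: nb | apply: nb].
(* [z], its two successors and the element [b] missed by the circuit represent all four classes; the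
   third successor can only be in the class of [z]. *)
have E := quad_cover hM qL (inL _ zB) (And3 (inL _ zB1) (inL _ zB2) bL) I1 I2.
have : nx (nx (nx z)) \in L by apply: inL.
rewrite {1}E !inE (negbTE (n1 _ zB2)) (negbTE (nn _ zB1)) /= !orbF => /orP [//|].
by rewrite -(cls_sym cL (inL _ zB3) bL) (negbTE (nb _ zB3)).
Qed.

(** The bound on nullity is attained ([ear_nul]), so the dual of the restriction to [L :|: V] has
    rank 3. In it [V] is a single point, and the classes of [L] are the lines through this point,
    without the point. *)
Definition ear L V : Prop :=
  [/\ quad M L, [disjoint V & L], V != set0, cyc M (L :|: V) & nul M (L :|: V) <= 3].

Section Ear.
Variables L V : {set T}.
Hypothesis eLV : ear L V.
Let A := L :|: V.
Let qL : quad M L. Proof. by case: eLV. Qed.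
Let lL : line M L := proj1 qL.
Let cL : cyc M L := proj1 lL.
Let dVL : [disjoint V & L]. Proof. by case: eLV. Qed.
Let cA : cyc M A. Proof. by case: eLV. Qed.

Let VA v : v \in V -> v \in A. Proof. by rewrite /A inE orbC => ->. Qed.
Let LA x : x \in L -> x \in A. Proof. by rewrite /A inE => ->. Qed.

Lemma ear_nul : nul M A = 3.
Proof.
have [_ _ /set0Pn [v vV] _ n3] := eLV; apply/eqP; rewrite eqn_leq n3 /=.
rewrite (nul_cyc cA (VA vV)) ltnS -(proj2 lL); apply: nulS.
apply/subsetP => x xL; rewrite !inE xL andbT /=.
by apply: contraTneq xL => ->; rewrite (disjointFr dVL vV).
Qed.

Lemma ear_core v : v \in V -> core M (A :\ v) = L.
Proof.
move=> vV; apply/esym/(@cyc_eq _ M); first exact: core_cyc.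
  apply: cyc_core => //; apply/subsetP => x xL; rewrite !inE xL andbT /=.
  by apply: contraTneq xL => ->; rewrite (disjointFr dVL vV).
by rewrite nul_core (proj2 lL); have := nul_cyc cA (VA vV); rewrite ear_nul; nlia.
Qed.

Lemma ear_cls v : v \in V -> cl A v = V.
Proof.
move=> vV; apply/setP => x; rewrite in_cls ear_core // !inE.
case xV: (x \in V); rewrite ?orbT ?orbF; first by rewrite (disjointFr dVL xV).
by case: (x \in L).
Qed.

Lemma ear_circuit C : circuit M C -> C \subset A -> C \subset L \/ V \subset C.
Proof.
move=> cC sC; have [sV|/subsetPn [v vV vC]] := boolP (V \subset C); first by right.
left; rewrite -(ear_core vV); apply: circuit_core => //.
by apply/subsetP => x xC; rewrite !inE; have := subsetP sC x xC; rewrite inE => ->; rewrite andbT; apply: contraNneq vC => <-.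
Qed.

(** Dually this contracts the point of [x]: the classes of the resulting set are the lines through
    that point. *)
Lemma line_core x : x \in A -> line M (core M (A :\ x)).
Proof.
move=> xA; split; first exact: core_cyc.
by rewrite nul_core; have := nul_cyc cA xA; rewrite ear_nul; nlia.
Qed.

Lemma ear_cls_sub x : x \in L -> cl A x \subset cl L x.
Proof.
move=> xL; apply/subsetP => y yx; have cC := line_circuit lL xL.
have yL : y \in L.
  have yA := subsetP (cls_sub M A x) y yx.
  move: (yA); rewrite inE => /orP [//|yV].
  by have := yx; rewrite (cls_sym cA (LA xL) yA) ear_cls // => xV; rewrite (disjointFr dVL xV) in xL.
have sC : L :\: cl L x \subset A by rewrite (subset_trans (subsetDl _ _)) ?subsetUl.
by have := cls_circuit cA cC sC (LA xL) yx; rewrite !inE xL yL cls_refl //= andbT => /negbFE.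
Qed.

(* In the dual of [M | A], which has rank 3, the points x, y and u are collinear. *)
Let tri x y u := 0 < nul M (A :\: [set x; y; u]).

Let triP x y u : x \in A -> y \in core M (A :\ x) -> u \in core M (A :\ x) ->
  (u \in cl (core M (A :\ x)) y) = tri x y u.
Proof.
move=> xA yc uc; have lx := line_core xA; apply/idP/idP => [|/nul_circuit [C cC sC]].
  rewrite in_cls => /andP [_ /nulD1_ncore E]; rewrite /tri.
  have : nul M (core M (A :\ x) :\ y) <= nul M (A :\: [set x; y; u]).
    by rewrite -E; apply: nulS; have := coreS M (A :\ x); sets.
  by apply: leq_trans; rewrite (line_meet lx).
have sC' : C \subset core M (A :\ x) by apply: circuit_core cC _; sets.
have yC : y \notin C by apply/negP => /(subsetP sC); rewrite !inE eqxx ?orbT.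
have uC : u \notin C by apply/negP => /(subsetP sC); rewrite !inE eqxx ?orbT.
have E := line_circuitE lx cC sC' yc yC.
by move: uC; rewrite E !inE uc andbT negbK.
Qed.

Let in_core_far x y : x \in L -> y \in L -> y \notin cl L x -> y \in core M (A :\ x).
Proof.
move=> xL yL ny; apply: contraT => nc.
have : y \in cl A x by rewrite in_cls LA // nc.
by move/(subsetP (ear_cls_sub xL)); rewrite (negbTE ny).
Qed.

Let in_core_ear x v : x \in L -> v \in V -> v \in core M (A :\ x).
Proof.
move=> xL vV; apply: contraT => nc.
have : v \in cl A x by rewrite in_cls VA // nc.
by move/(subsetP (ear_cls_sub xL))/(subsetP (cls_sub _ _ _)); rewrite (disjointFr dVL vV).
Qed.

(* Two collinear triples with two elements in common lie on one line. *)
Let triC x y u w : x \in L -> y \in L -> y \notin cl L x -> tri x y u -> tri x y w ->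
  0 < nul M (A :\: [set x; y; u; w]).
Proof.
move=> xL yL ny h1 h2; have := nul_super M (A :\: [set x; y; u]) (A :\: [set x; y; w]).
have -> : (A :\: [set x; y; u]) :&: (A :\: [set x; y; w]) = A :\: [set x; y; u; w] by sets.
have n1 : nul M (A :\: [set x; y]) = 1.
  have := nulD1_core (in_core_far xL yL ny); have := nul_cyc cA (LA xL); rewrite ear_nul.
  have -> : A :\ x :\ y = A :\: [set x; y] by sets.
  by nlia.
have : nul M ((A :\: [set x; y; u]) :|: (A :\: [set x; y; w])) <= 1.
  by rewrite -n1; apply: nulS; sets.
move: h1 h2; rewrite /tri; nlia.
Qed.

(** In the dual plane: [x] and [y] are on different lines through the point [V]. *)
Let far x y := y \notin cl L x.

Let farS x y : x \in L -> y \in L -> far x y -> far y x.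
Proof. by move=> xL yL; rewrite /far (cls_sym cL). Qed.

Let farE a x y : a \in L -> x \in cl L a -> far a y -> far x y.
Proof. by move=> aL xa; rewrite /far (cls_eq cL aL xa). Qed.

Let far_nul x y : x \in L -> y \in L -> far x y -> nul M (A :\: [set x; y]) = 1.
Proof.
move=> xL yL ny; have := nulD1_core (in_core_far xL yL ny).
have := nul_cyc cA (LA xL); rewrite ear_nul.
have -> : A :\ x :\ y = A :\: [set x; y] by sets.
by nlia.
Qed.

Let tri_ear q v a : q \in L -> a \in L -> v \in V -> far q a -> tri q v a = false.
Proof.
move=> qinL aL vV nq; apply/negbTE; rewrite /tri -leqNgt leqn0; apply/eqP.
have : a \in core M (L :\ q) by move: nq; rewrite /far in_cls aL /= negbK.
move/nulD1_core; rewrite (line_meet lL) // => /eqP; rewrite eqSS eq_sym => /eqP <-.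
rewrite -(nul_core M (A :\: _)).
apply/eqP; rewrite eqn_leq; apply/andP; split.
  apply: nulS; apply/subsetP => x xc.
  have := subsetP (coreS _ _) _ xc; rewrite !inE !negb_or -!andbA => /and4P [xq xv xa _].
  rewrite xa xq -(ear_core vV); apply: (subsetP (core_mono M _)) xc; sets.
rewrite nul_core; apply: nulS; have := dVL; have := vV; rewrite /A; sets.
Qed.

Section NoSwap.
Hypothesis nq : forall q, q \in L -> ~ quad M (core M (A :\ q)).

(** The line from [q] to the ear differs from the lines to [a], [b] and [c]. Were these three
    distinct as well, four lines through [q] would make a quad. *)
Let nqT q a b c : [/\ q \in L, a \in L, b \in L & c \in L] ->
  [/\ far q a, far q b & far q c] -> [|| tri q a b, tri q a c | tri q b c].
Proof.
move=> [qinL aL bL c'] [fa fb fc]; apply: contraT; rewrite !negb_or => /and3P [t1 t2 t3].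
have [_ _ /set0Pn [v vV] _ _] := eLV.
have inA := LA qinL; have vc := in_core_ear qinL vV.
have ac := in_core_far qinL aL fa; have bc := in_core_far qinL bL fb.
have cc := in_core_far qinL c' fc.
case: (nq qinL); apply: (@quad_intro _ _ _ [:: v; a; b; c]) => //; first exact: line_core.
  by move=> u; rewrite !inE => /or4P [] /eqP ->.
by rewrite /= !triP // (tri_ear qinL aL vV fa) (tri_ear qinL bL vV fb) (tri_ear qinL c' vV fc) t1 t2 t3.
Qed.

Let tri_perm x y u x' y' u' : [set x; y; u] = [set x'; y'; u'] -> tri x y u = tri x' y' u'.
Proof. by rewrite /tri => ->. Qed.

(** [nqT] at [c] makes [c] collinear with two of [q], [a], [b], and these two already span the line
    of all three. *)
Let tri4 q a b c : [/\ q \in L, a \in L, b \in L & c \in L] ->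
  [/\ far q a, far q b & far q c] -> [/\ far a b, far a c & far b c] ->
  tri q a b -> 0 < nul M (A :\: [set q; a; b; c]).
Proof.
move=> [qinL aL bL c'] [fa fb fc] [ab ac bc] t.
have /or3P [t1|t1|t1] := @nqT c q a b (And4 c' qinL aL bL) (And3 (farS qinL c' fc) (farS aL c' ac) (farS bL c' bc)).
- by apply: triC => //; rewrite (@tri_perm q a c c q a) //; sets.
- have -> : [set q; a; b; c] = [set q; b; a; c] by sets.
  apply: triC => //; first by rewrite (@tri_perm q b a q a b) //; sets.
  by rewrite (@tri_perm q b c c q b) //; sets.
- have -> : [set q; a; b; c] = [set a; b; q; c] by sets.
  apply: triC => //; first by rewrite (@tri_perm a b q q a b) //; sets.
  by rewrite (@tri_perm a b c c a b) //; sets.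
Qed.

Let transversal q a b c : [/\ q \in L, a \in L, b \in L & c \in L] ->
  [/\ far q a, far q b & far q c] -> [/\ far a b, far a c & far b c] ->
  0 < nul M (A :\: [set q; a; b; c]).
Proof.
move=> inL fq fo; have [qinL aL bL c'] := inL; have [fa fb fc] := fq; have [ab ac bc] := fo.
have /or3P [t|t|t] := nqT inL fq; first exact: tri4.
  have -> : [set q; a; b; c] = [set q; a; c; b] by sets.
  by apply: tri4 => //; split=> //; apply: farS.
have -> : [set q; a; b; c] = [set q; b; c; a] by sets.
by apply: tri4 => //; split=> //; apply: farS.
Qed.

(** Points chosen on the four lines through [V], one on each, are always collinear. Replacing one of
    them by another point of its line keeps the other three and hence their common line. So all
    points of [L] are on one dual line, and the complement [V] of that line is a circuit. *)
Lemma no_swap_circuit : circuit M V.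
Proof.
have [q qinL] : exists q, q \in L.
  have [_ +] := qL; have [->|[q qinL] _] := set_0Vmem L; last by exists q.
  by rewrite imset0 cards0.
have [a [b [c [[aL bL c'] [fa fb fc] [ab ac bc]]]]] := quad_pick qL qinL.
have [C cC sC] := nul_circuit (transversal (And4 qinL aL bL c') (And3 fa fb fc) (And3 ab ac bc)).
have off x y u w : [/\ x \in L, y \in L, u \in L & w \in L] ->
    [/\ far x y, far x u & far x w] -> [/\ far y u, far y w & far u w] ->
    C \subset A :\: [set y; u; w] -> x \notin C.
  move=> inL fx fo sC'; have := transversal inL fx fo; apply: contraTN => xC.
  have [xL yL uL wL] := inL; have [yu _ _] := fo.
  have xc : x \in core M (A :\: [set y; u; w]) by apply: (subsetP (circuit_core cC sC')).
  have := nulD1_core xc; have -> : (A :\: [set y; u; w]) :\ x = A :\: [set x; y; u; w] by sets.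
  have : nul M (A :\: [set y; u; w]) <= nul M (A :\: [set y; u]) by apply: nulS; sets.
  rewrite (far_nul yL uL yu); nlia.
have CL x : x \in C -> x \notin L.
  move=> xC; apply/negP => xL; move: (xL).
  rewrite (quad_cover hM qL qinL (And3 aL bL c') (And3 fa fb fc) (And3 ab ac bc)).
  rewrite !inE -!orbA; apply/negP; rewrite !negb_or; apply/and4P.
  have fx u y : u \in L -> x \in cl L u -> far u y -> far x y by move=> uL xc; apply: farE.
  have sub y u w : A :\: [set q; a; b; c] \subset A :\: [set y; u; w] -> C \subset A :\: [set y; u; w].
    exact: subset_trans.
  have aq := farS qinL aL fa; have bq := farS qinL bL fb; have cq := farS qinL c' fc.
  have ba := farS aL bL ab; have ca := farS aL c' ac; have cb := farS bL c' bc.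
  split; apply: contraTN xC => xc.
  - apply: (off x a b c (And4 xL aL bL c') _ (And3 ab ac bc)); last by apply: sub; sets.
    by split; apply: (fx q).
  - apply: (off x q b c (And4 xL qinL bL c') _ (And3 fb fc bc)); last by apply: sub; sets.
    by split; apply: (fx a).
  - apply: (off x q a c (And4 xL qinL aL c') _ (And3 fa fc ac)); last by apply: sub; sets.
    by split; apply: (fx b).
  - apply: (off x q a b (And4 xL qinL aL bL) _ (And3 fa fb ab)); last by apply: sub; sets.
    by split; apply: (fx c).
have sA : C \subset A by apply: subset_trans sC (subsetDl _ _).
have [x xC] := circuit_n0 cC.
have [s|s] := ear_circuit cC sA; first by have := CL x xC; rewrite (subsetP s).
suff <- : C = V by [].
apply/eqP; rewrite eqEsubset s andbT; apply/subsetP => y yC.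
by have := subsetP sA y yC; rewrite inE (negbTE (CL y yC)).
Qed.

End NoSwap.

End Ear.
End Plane.

(** * Exchanging part of a class for an ear *)

Section Swap.
Variables (T : finType) (M : matroid T) (h : rel T).
Hypothesis hM : ordered M h.
Implicit Types (L X Y C D B S Q V Z : {set T}) (x y z a b c e f q v : T).
Local Notation cl := (cls M).

Lemma line_miss L C x y : line M L -> circuit M C -> C \subset L -> x \in L -> y \in L ->
  y \notin cl L x -> x \notin C -> y \in C.
Proof.
move=> lL cC sC xL yL nyx nx; rewrite (line_circuitE lL cC sC xL nx).
by rewrite inE nyx yL.
Qed.

Lemma quad_n0 L : quad M L -> exists q, q \in L.
Proof.
by move=> [_ +]; have [->|[q qinL] _] := set_0Vmem L; [rewrite imset0 cards0 | exists q].
Qed.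

(** The circuit outside the class of [q] lies in both quads, which induce the same classes on it by
    [quad_grid]. The rest of the new quad is its fourth class, namely [V] with what [Q] leaves of
    the class of [q]; equal class sizes then give the size of [Q]. *)
Lemma ear_swap L V q : ear M L V -> q \in L -> quad M (core M ((L :|: V) :\ q)) ->
  let Lq := core M ((L :|: V) :\ q) in let Q := cl (L :|: V) q in
  [/\ Q \subset cl L q, Lq = (L :|: V) :\: Q, #|Q| = #|V|,
      forall a, a \in L -> a \notin cl L q -> cl Lq a = cl L a &
      forall v, v \in V -> cl Lq v = V :|: (cl L q :\: Q)].
Proof.
move=> e qinL qLq Lq Q; have [qL dVL V0 cA _] := e.
have [lL _] := qL; have [cL _] := lL; have [lq _] := qLq; have [cq _] := lq.
have sQS : Q \subset cl L q := ear_cls_sub e qinL.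
have ELq : Lq = (L :|: V) :\: Q by rewrite /Lq cls_core.
set S := cl L q; have sSL : S \subset L := cls_sub M L q.
have cB : circuit M (L :\: S) := line_circuit lL qinL.
have sBq : L :\: S \subset Lq by rewrite ELq; sets.
have sVq : V \subset Lq by rewrite ELq; sets.
have clv v : v \in V -> cl Lq v = V :|: (S :\: Q).
  move=> vV; have vB : v \notin L :\: S by rewrite inE (disjointFr dVL vV) andbF.
  have vq := subsetP sVq v vV.
  have E := line_circuitE lq cB sBq vq vB; have sc := cls_sub M Lq v.
  rewrite -/Lq in E.
  have -> : cl Lq v = Lq :\: (L :\: S) by rewrite E; sets.
  by rewrite ELq; sets.
have cla a : a \in L -> a \notin S -> cl Lq a = cl L a.
  move=> aL aS; have aB : a \in L :\: S by rewrite inE aS.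
  have aq := subsetP sBq a aB; have /set0Pn [v vV] := V0.
  have vq := subsetP sVq v vV.
  have d1 : [disjoint cl Lq v & cl Lq a].
    apply: cls_disj => //; rewrite clv // inE negb_or.
    by rewrite (disjointFl dVL aL) inE (negbTE aS) andbF.
  have d2 : [disjoint S & cl L a] by apply: cls_disj.
  have s1 := cls_sub M Lq a; have s2 := cls_sub M L a.
  apply/setP => x; case xB: (x \in L :\: S).
    by apply: (quad_grid hM qLq qL cB) => //; apply: subsetDl.
  move: xB; rewrite inE => /negbT; rewrite negb_and negbK => xB.
  have -> : x \in cl L a = false.
    apply/negbTE; case/orP: xB => [xS|]; first by rewrite (disjointFr d2 xS).
    by apply: contra => /(subsetP s2).
  apply/negbTE/negP => xa; have xq := subsetP s1 x xa.
  have := disjointFl d1 xa; move: xq; rewrite clv // ELq !inE.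
  by case: (x \in V); rewrite //= ?orbT ?orbF => /andP [-> xL]; case/orP: xB => [->|]; rewrite ?xL.
split=> //.
have [a [_ [_ [[aL _ _] [aS _ _] _]]]] := quad_pick qL qinL.
have /set0Pn [v vV] := V0.
have aB : a \in L :\: S by rewrite inE aS.
have := quad_size hM qLq (subsetP sVq v vV) (subsetP sBq a aB).
rewrite -/Lq clv // cla // -(quad_size hM qL qinL aL) -/S.
have dVS : [disjoint V & S :\: Q] by sets.
have := leq_card_setU V (S :\: Q); rewrite dVS => -[_ /eqP ->].
have := cardsID Q S; rewrite (setIidPr sQS).
nlia.
Qed.

(** With the four classes of [L], the ear gives five points of the dual plane, no three of them
    collinear; the restriction is then a series extension of U_{2,5}. *)
Definition new_class L V : Prop := forall x, x \in L ->
  quad M (core M ((L :|: V) :\ x)) /\ cl (L :|: V) x = cl L x.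

(** Consider the lines through an element [a] outside the class of [q]: those to [V] and to [Q] are
    two of them. If no such pencil is a quad, there is only one further line, and the circuit
    complementary to it is [Q :|: V]. If one of them is a quad, comparison with [Lq] forces [Q] to
    be the full class of [q], and the property spreads from [a] to all other elements. *)
Lemma ear_dichotomy L V q : ear M L V -> q \in L -> quad M (core M ((L :|: V) :\ q)) ->
  circuit M (cl (L :|: V) q :|: V) \/ new_class L V.
Proof.
move=> e qinL qLq; have [qL dVL V0 cA _] := e.
have [sQS ELq cQV clLq clV] := ear_swap e qinL qLq.
set A := L :|: V in qLq sQS ELq cQV clLq clV *; set Lq := core M (A :\ q) in qLq ELq clLq clV.
set Q := cl A q in sQS ELq cQV clV *; set S := cl L q in sQS clLq clV.
have [lL _] := qL; have [cL _] := lL; have [lq _] := qLq; have [cq _] := lq.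
have /set0Pn [v vV] := V0.
have sSL : S \subset L := cls_sub M L q.
have LA x : x \in L -> x \in A by rewrite inE => ->.
have VA x : x \in V -> x \in A by rewrite inE orbC => ->.
have qQ : q \in Q by apply: cls_refl; apply: LA.
have clS x : x \in S -> cl L x = S by move=> xS; apply: cls_eq.
have inLq x : x \in L -> x \notin S -> x \in Lq.
  by move=> xL xS; rewrite ELq !inE xL andbT; apply: contra xS; apply: (subsetP sQS).
have vLq : v \in Lq by rewrite ELq !inE vV orbT andbT; apply/negP => /(subsetP sQS)/(subsetP sSL); rewrite (disjointFr dVL vV).
have La a : a \in L -> a \notin S ->
    [/\ core M (A :\ a) = A :\: cl L a, cl A a = cl L a,
        cl (A :\: cl L a) v = V & cl (A :\: cl L a) q = Q].
  move=> aL aS; have aq := inLq a aL aS.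
  have c1 : circuit M (L :\: cl L a) := line_circuit lL aL.
  have c2 : circuit M (Lq :\: cl L a) by rewrite -(clLq a aL aS); apply: line_circuit.
  have d : [disjoint S & cl L a] by apply: cls_disj.
  have aa : a \in cl L a by apply: cls_refl.
  have sa := cls_sub M L a.
  have EU : L :\: cl L a :|: Lq :\: cl L a = A :\: cl L a.
    by rewrite ELq; move: sQS; rewrite /A; move: d; sets.
  have cU : cyc M (A :\: cl L a) by rewrite -EU; apply: cycU; apply: circuit_cyc.
  have vU : v \in A :\: cl L a.
    by rewrite inE VA // andbT; apply/negP => /(subsetP sa); rewrite (disjointFr dVL vV).
  have E : core M (A :\ a) = A :\: cl L a.
    apply/esym/(@cyc_eq _ M); first exact: core_cyc.
      by apply: cyc_core => //; move: aa; sets.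
    rewrite (proj2 (line_core e (LA a aL))) (nul_cyc cU vU) ltnS.
    rewrite -(circuit_nul1 c1); apply: nulS.
    by move: vV dVL; rewrite /A; sets.
  have lU : line M (A :\: cl L a) by rewrite -E; apply: (line_core e (LA a aL)).
  split=> //.
  - have := cls_core M A a; rewrite E => E'.
    have := cls_sub M A a; move: sa E'; rewrite /A; clear; sets.
  - have E1 : L :\: cl L a = (A :\: cl L a) :\: cl (A :\: cl L a) v.
      apply: line_circuitE => //; first by rewrite /A; sets.
      by rewrite inE (disjointFr dVL vV) andbF.
    have s := cls_sub M (A :\: cl L a) v.
    have : cl (A :\: cl L a) v = (A :\: cl L a) :\: (L :\: cl L a) by rewrite E1; sets.
    move=> ->; move: dVL sa; rewrite /A; sets.
  have qU : q \in A :\: cl L a.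
    by rewrite inE LA // andbT; apply: contra aS => qa; rewrite /S (cls_sym cL).
  have E1 : Lq :\: cl L a = (A :\: cl L a) :\: cl (A :\: cl L a) q.
    apply: line_circuitE => //; first by rewrite ELq; sets.
    by rewrite inE ELq inE qQ andbF.
  have s := cls_sub M (A :\: cl L a) q.
  have : cl (A :\: cl L a) q = (A :\: cl L a) :\: (Lq :\: cl L a) by rewrite E1; sets.
  move=> ->; move: d sQS; rewrite ELq /A; sets.
have lU a : a \in L -> a \notin S -> line M (A :\: cl L a).
  by move=> aL aS; have [<- _ _ _] := La a aL aS; apply: (line_core e (LA a aL)).
have inLa a x : a \in L -> x \in L -> x \notin cl L a -> x \in A :\: cl L a.
  by move=> aL xL nx; rewrite inE nx LA.
have qLa a : a \in L -> a \notin S -> q \in A :\: cl L a.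
  by move=> aL aS; apply: inLa => //; apply: contra aS => qa; rewrite /S (cls_sym cL).
have vLa a : a \in L -> v \in A :\: cl L a.
  by move=> aL; rewrite inE VA // andbT; apply/negP => /(subsetP (cls_sub M L a)); rewrite (disjointFr dVL vV).
have circ a : a \in L -> a \notin S -> circuit M (Lq :\: cl L a).
  by move=> aL aS; rewrite -(clLq a aL aS); apply: line_circuit => //; apply: inLq.
have sub1 a : Lq :\: cl L a \subset A :\: cl L a by rewrite ELq; sets.
have grid a x y : a \in L -> a \notin S -> quad M (A :\: cl L a) ->
    x \in Lq :\: cl L a -> y \in Lq :\: cl L a -> (y \in cl Lq x) = (y \in cl (A :\: cl L a) x).
  move=> aL aS qa xD yD.
  by apply: (quad_grid hM qLq qa (circ a aL aS)) => //; apply: subsetDl.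
(* An element of [S :\: Q] is in the class of [v] in [Lq], but the class of [v] in the quad at [a]
   is [V] alone. A circuit common to both quads makes these classes agree. *)
have SQ a : a \in L -> a \notin S -> quad M (A :\: cl L a) -> S = Q.
  move=> aL aS qa; apply/eqP; rewrite eqEsubset sQS andbT; apply/subsetP => y yS.
  apply: contraT => yQ; have yL := subsetP sSL y yS.
  have ya : y \notin cl L a.
    by rewrite (cls_sym cL) // clS.
  have [_ _ clv _] := La a aL aS.
  have vD : v \in Lq :\: cl L a.
    by have := vLa a aL; rewrite !inE vLq andbT => /andP [].
  have yD : y \in Lq :\: cl L a by rewrite inE ya ELq inE yQ LA.
  have := grid a v y aL aS qa vD yD; rewrite clv clV // inE inE yQ yS orbT => /esym yV.
  by rewrite (disjointFr dVL yV) in yL.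
have [/existsP [a /andP [aL /andP [aS qa]]]|none] :=
    boolP [exists a, (a \in L) && ((a \notin S) && (3 < #|cl (A :\: cl L a) @: (A :\: cl L a)|))].
  have qa' : quad M (A :\: cl L a) by split=> //; apply: lU.
  right => x xL; have EQ := SQ a aL aS qa'.
  have [xS|xS] := boolP (x \in S).
    have xQ : x \in cl A q by rewrite -/Q -EQ.
    rewrite (cls_core M A x) (cls_eq cA (LA q qinL) xQ) -/Q -ELq.
    by split=> //; rewrite clS // EQ.
  have [-> -> clv clq] := La x xL xS; split=> //.
  have [xa|xa] := boolP (x \in cl L a); first by rewrite (cls_eq cL aL xa).
  have [|y|c [c' nc]] := @other_class _ _ L [:: q; a; x] lL; first exact: leq_trans (proj2 qL).
    by rewrite !inE => /or3P [] /eqP ->.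
  have cq' : c \notin S by apply: nc; rewrite !inE eqxx ?orbT.
  have ca : c \notin cl L a by apply: nc; rewrite !inE eqxx ?orbT.
  have cx : c \notin cl L x by apply: nc; rewrite !inE eqxx ?orbT.
  have ax : a \notin cl L x by rewrite (cls_sym cL).
  have nV y : y \in L -> y \notin V by move=> yL; rewrite (disjointFl dVL yL).
  have aLx := inLa x a xL aL ax; have cLx := inLa x c xL c' cx.
  have [Ea _ _ _] := La a aL aS.
  apply: (@quad_intro _ _ _ [:: v; q; a; c]) => //; first exact: lU.
    by apply/allP; rewrite /= vLa // qLa // aLx cLx.
  rewrite /= clv clq !nV // -EQ aS cq' /= !andbT; apply/negP => cla.
  (* If [a] and [c] were in one class at [x], the circuit [D] outside that class would miss [c].
     Seen in the quad at [a], it would have to contain [x], yet it lies in [A :\: cl L x]. *)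
  have cD := line_circuit (lU x xL xS) aLx.
  set D := _ :\: cl _ a in cD.
  have cnD : c \notin D by rewrite inE cla.
  have anD : a \notin D by rewrite inE cls_refl.
  have sD : D \subset A :\: cl L a.
    rewrite -Ea; apply: circuit_core => //; apply/subsetP => y yD; rewrite in_setD1.
    have := yD; rewrite /D 2!in_setD => /and3P [_ _ ->]; rewrite andbT.
    by apply: contraTneq yD => ->.
  have xLa := inLa a x aL xL xa; have cLa := inLa a c aL c' ca.
  have xD : x \in D.
    apply: (line_miss (lU a aL aS) cD sD cLa xLa) => //.
    rewrite -(grid a c x aL aS qa'); try by rewrite inE inLq // ?ca ?xa.
    by rewrite clLq // (cls_sym cL).
  have : x \in A :\: cl L x by move: xD; rewrite inE => /andP [].
  by rewrite inE cls_refl.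
left; have [a [b [_ [[aL bL _] [aS bS _] [ab _ _]]]]] := quad_pick qL qinL.
have bLa := inLa a b aL bL ab.
have cD := line_circuit (lU a aL aS) bLa.
have [_ _ clv clq] := La a aL aS.
suff <- : (A :\: cl L a) :\: cl (A :\: cl L a) b = Q :|: V by [].
have [cU _] := lU a aL aS.
have dv : [disjoint V & cl (A :\: cl L a) b].
  by rewrite -clv; apply: cls_disj => //; [exact: vLa | rewrite clv (disjointFl dVL bL)].
have dq : [disjoint Q & cl (A :\: cl L a) b].
  rewrite -clq; apply: cls_disj => //; first exact: qLa.
  by rewrite clq; apply: contra bS; apply: (subsetP sQS).
apply/eqP; rewrite eqEsubset; apply/andP; split; last first.
  have sv := cls_sub M (A :\: cl L a) v; have sq := cls_sub M (A :\: cl L a) q.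
  rewrite clv in sv; rewrite clq in sq.
  by rewrite subUset (subsetD Q (A :\: cl L a)) (subsetD V (A :\: cl L a)) sq sv dv dq.
apply/subsetP => w; rewrite inE => /andP [wb wLa]; apply: contraT; rewrite inE negb_or => /andP [wQ wV].
case/existsP: none; exists a; rewrite aL aS /=.
have [] // : quad M (A :\: cl L a).
apply: (@quad_intro _ _ _ [:: v; q; b; w]) => //; first exact: lU.
  by apply/allP; rewrite /= vLa // qLa // bLa wLa.
rewrite /= clv clq wQ wV wb (disjointFl dVL bL) (disjointFl dVL qinL) /= !andbT.
by apply: contra bS; apply: (subsetP sQS).
Qed.

End Swap.

(** * Digons *)

Section Digon.
Variables (T : finType) (M : matroid T) (h : rel T).
Hypothesis hM : ordered M h.
Implicit Types (L X Y C D B S Q V Z R : {set T}) (x y z a b c d e f q v : T).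
Local Notation cl := (cls M).

(** A circuit inside a line misses only one class, and a quad has at least four. *)
Lemma quad_two_classes L C q r : quad M L -> circuit M C -> C \subset L ->
  q \in L -> r \in L -> C \subset cl L q :|: cl L r -> False.
Proof.
move=> qL cC sC qinL rL sq; have [lL _] := qL.
have [|y|a [aL na]] := @other_class _ _ L [:: q; r] lL; first exact: leq_trans (proj2 qL).
  by rewrite !inE => /orP [] /eqP ->.
have [|y|b [bL nb]] := @other_class _ _ L [:: q; r; a] lL; first exact: leq_trans (proj2 qL).
  by rewrite !inE => /or3P [] /eqP ->.
have ab : b \notin cl L a by apply: nb; rewrite !inE eqxx ?orbT.
have out y : y \in C -> y \in cl L q \/ y \in cl L r.
  by move/(subsetP sq); rewrite inE => /orP.
have aC : a \notin C.
  by apply/negP => /out []; apply/negP; apply: na; rewrite !inE eqxx ?orbT.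
have := line_miss lL cC sC aL bL ab aC.
by move=> /out []; apply/negP; apply: nb; rewrite !inE eqxx ?orbT.
Qed.

(* [Q] and [Z] are interchangeable paths: as [Q :|: Z] is a circuit, [Q] can be swapped for [Z] in
   the quad [L]. *)
Definition digon L Q Z : Prop :=
  [/\ quad M L, Q != set0, exists2 q, q \in L & Q \subset cl L q,
      [disjoint Z & L] & circuit M (Q :|: Z) /\ nul M (L :|: Z) <= 3].

Lemma ear_circuit_diff L C : quad M L -> circuit M C -> ~~ (C \subset L) ->
  ~~ [disjoint C & L] -> nul M (L :|: C) <= 3 ->
  ear M L (C :\: L) /\ ~ circuit M (C :\: L).
Proof.
move=> qL cC nC mC n3; have E : L :|: C :\: L = L :|: C by sets.
split; first split=> //.
- by sets.
- by rewrite setD_eq0.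
- by rewrite E cycU // ?(proj1 (proj1 qL)) // circuit_cyc.
- by rewrite E.
move=> cD; have ED := circuit_eq cD cC (subsetDl _ _).
by move: mC; rewrite -ED => /negP; apply; sets.
Qed.

Lemma digon_ear L Q Z : digon L Q Z -> ear M L Z /\ ~ circuit M Z.
Proof.
move=> [qL Q0 [q qinL sQ] dZ [cC n3]].
have sQL := subset_trans sQ (cls_sub M L q).
have EZ : (Q :|: Z) :\: L = Z by move: sQL dZ; sets.
have EL : L :|: (Q :|: Z) = L :|: Z by move: sQL; sets.
have := ear_circuit_diff qL cC; rewrite EZ EL; apply=> //.
  apply/negP => s; apply: (quad_two_classes qL cC s qinL qinL); rewrite setUid.
  by move: s sQ dZ; sets.
have /set0Pn [x xQ] := Q0; apply/pred0Pn; exists x => /=.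
by rewrite inE xQ (subsetP sQL).
Qed.

Lemma ear_types L V : ear M L V -> ~ circuit M V ->
  (exists q, [/\ q \in L, quad M (core M ((L :|: V) :\ q)) & digon L (cl (L :|: V) q) V])
  \/ new_class M L V.
Proof.
move=> e nc; have [qL dV V0 cA n3] := e.
have [/existsP [q /andP [qinL qq]]|none] :=
  boolP [exists q, (q \in L) && (3 < #|cl (core M ((L :|: V) :\ q)) @: core M ((L :|: V) :\ q)|)]; last first.
  case: nc; apply: (no_swap_circuit hM e) => q qinL qq.
  by case/existsP: none; exists q; rewrite qinL; case: qq.
have qA : q \in L :|: V by rewrite inE qinL.
have qLq : quad M (core M ((L :|: V) :\ q)) by split=> //; apply: line_core.
have [cQ|] := ear_dichotomy hM e qinL qLq; last by right.
left; exists q; split=> //; split=> //; last first.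
  by exists q => //; apply: ear_cls_sub.
by apply/set0Pn; exists q; apply: cls_refl.
Qed.

(** Otherwise eliminating an element of [V] leaves a circuit in [L] that meets at most two
    classes. *)
Lemma ear_two_circuits L V C D q r : ear M L V -> circuit M C -> circuit M D ->
  V \subset C -> V \subset D -> q \in L -> r \in L ->
  C \subset cl L q :|: V -> D \subset cl L r :|: V -> C \subset D.
Proof.
move=> e cC cD VC VD qinL rL sC sD; have [qL dV V0 cA n3] := e.
have /set0Pn [v vV] := V0.
apply/subsetP => f fC; apply: contraT => fD.
have [D' [cD' _ vD' sD']] := circuit_elim cC cD (subsetP VC v vV) (subsetP VD v vV) fC fD.
have s1 := cls_sub M L q; have s2 := cls_sub M L r.
have sA : D' \subset L :|: V by move: sD' sC sD s1 s2; sets.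
have [s|s] := ear_circuit e cD' sA; last by rewrite (subsetP s) in vD'.
by case: (quad_two_classes qL cD' s qinL rL); move: sD' sC sD s dV; sets.
Qed.

(** A digon only requires [Q] to be part of a class of [L]; here it becomes a series class of
    [L :|: Z]. If [ear_types] yields a digon on the ear [Z], it is the given one by
    [ear_two_circuits]. If [Z] were a new class, the circuit [Q :|: Z] would miss two classes of a
    quad. *)
Lemma digon_swap L Q Z q : digon L Q Z -> q \in Q ->
  quad M (core M ((L :|: Z) :\ q)) /\ cl (L :|: Z) q = Q.
Proof.
move=> dg qQ; have [e nc] := digon_ear dg; have [qL Q0 [r rL sQ] dZ [cC n3]] := dg.
have [lL _] := qL; have [cL _] := lL; have [_ _ Z0 cA _] := e.
have sQL := subset_trans sQ (cls_sub M L r).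
have LA x : x \in L -> x \in L :|: Z by rewrite inE => ->.
have qinL := subsetP sQL q qQ.
have sQA : Q \subset L :|: Z by apply: subset_trans sQL (subsetUl _ _).
have /set0Pn [v vZ] := Z0.
have sQZ : Q :|: Z \subset cl L r :|: Z by apply: setSU.
have [[q1 [q1L qq1 dg1]]|nw] := ear_types e nc.
  have [_ Q10 [r1 r1L sQ1] _ [cC1 _]] := dg1.
  have sQZ1 : cl (L :|: Z) q1 :|: Z \subset cl L r1 :|: Z by apply: setSU.
  have s1 := ear_two_circuits e cC cC1 (subsetUr _ _) (subsetUr _ _) rL r1L sQZ sQZ1.
  have s2 := ear_two_circuits e cC1 cC (subsetUr _ _) (subsetUr _ _) r1L rL sQZ1 sQZ.
  have sQ1L := subset_trans sQ1 (cls_sub M L r1).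
  have EQ : cl (L :|: Z) q1 = Q by move: s1 s2 dZ sQL sQ1L; sets.
  have qq1' : q \in cl (L :|: Z) q1 by rewrite EQ.
  have EC : cl (L :|: Z) q = Q by rewrite (cls_eq cA (LA q1 q1L) qq1').
  by split=> //; rewrite cls_core EC -EQ -cls_core.
have [a [b [c [[aL bL c'] [fa fb fc] [ab ac bc]]]]] := quad_pick qL rL.
have [qa Ea] := nw a aL; have [qb Eb] := nw b bL.
have [sa Ela _ cla clv] := ear_swap hM e aL qa.
have cnot y : y \in L -> y \notin cl L r -> y \notin Q :|: Z.
  by move=> yL yr; rewrite inE negb_or (disjointFl dZ yL) andbT; apply: contra yr; apply: (subsetP sQ).
have inD y : y \in L -> y \notin cl L a -> y \in core M ((L :|: Z) :\ a).
  by move=> yL ya; rewrite Ela Ea inE ya LA.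
have sD : Q :|: Z \subset core M ((L :|: Z) :\ a).
  apply: circuit_core => //; apply/subsetP => y yC; rewrite !inE.
  have -> : y != a by apply: contraTneq yC => ->; apply: cnot.
  by move: yC; rewrite inE => /orP [/(subsetP sQL) ->|->]; rewrite ?orbT.
have bD := inD b bL ab; have cD := inD c c' ac.
case/negP: (cnot c c' fc); apply: (line_miss (proj1 qa) cC sD bD cD); last exact: cnot.
by rewrite cla.
Qed.

Definition swap L Q Z := (L :|: Z) :\: Q.

Lemma digon_quad L Q Z q : digon L Q Z -> q \in L -> Q \subset cl L q ->
  [/\ quad M (swap L Q Z), #|Q| = #|Z|,
      forall a, a \in L -> a \notin cl L q -> cl (swap L Q Z) a = cl L a &
      forall v, v \in Z -> cl (swap L Q Z) v = Z :|: (cl L q :\: Q)].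
Proof.
move=> dg qinL sQ; have [e nc] := digon_ear dg; have [qL Q0 _ dZ [cC n3]] := dg.
have /set0Pn [x xQ] := Q0; have [qq EQ] := digon_swap dg xQ.
have xq := subsetP sQ x xQ; have xL := subsetP (cls_sub M L q) x xq.
have := ear_swap hM e xL qq; rewrite EQ (cls_eq (proj1 (proj1 qL)) qinL xq) => -[_ E cQ h1 h2].
by rewrite E in qq h1 h2.
Qed.

Lemma digon_sym L Q Z : digon L Q Z -> digon (swap L Q Z) Z Q.
Proof.
move=> dg; have [e nc] := digon_ear dg; have [qL Q0 [q qinL sQ] dZ [cC n3]] := dg.
have [_ _ Z0 _ _] := e.
have [qS cQ clL clZ] := digon_quad dg qinL sQ; have sQL := subset_trans sQ (cls_sub M L q).
split=> //.
- have /set0Pn [z zZ] := Z0; exists z; last by rewrite clZ // subsetUl.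
  by rewrite /swap !inE zZ orbT andbT; apply/negP => /(subsetP sQL); rewrite (disjointFr dZ zZ).
- by rewrite /swap; sets.
rewrite setUC; split=> //; suff <- : L :|: Z = swap L Q Z :|: Q by [].
by rewrite /swap; move: sQL; sets.
Qed.

Lemma digon_circuit L Q Z C : digon L Q Z -> circuit M C -> C \subset L :|: Z ->
  [\/ C \subset L, C \subset swap L Q Z | C = Q :|: Z].
Proof.
move=> dg cC sC; have [e nc] := digon_ear dg; have [_ Q0 _ _ [cQ _]] := dg.
have [s|s] := ear_circuit e cC sC; first exact: Or31.
have [sQ|/subsetPn [q qQ qC]] := boolP (Q \subset C).
  by apply: Or33; apply/esym; apply: (circuit_eq cQ cC); rewrite subUset sQ s.
apply: Or32; have [_ EQ] := digon_swap dg qQ; rewrite /swap -EQ -cls_core.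
by apply: circuit_core => //; move: qC; sets.
Qed.

Lemma digon_nadj L Q Z x y : digon L Q Z -> x \in Q -> y \in Q -> h x y = false.
Proof.
move=> [qL Q0 [q qinL sQ] _ _] xQ yQ; have sL := cls_sub M L q.
have [cL _] := proj1 qL; have xq := subsetP sQ x xQ.
apply: (quad_nadj hM qL); first exact: (subsetP sL).
by rewrite (cls_eq cL qinL xq) (subsetP sQ).
Qed.

(* The cycle through [Q :|: Z] alternates between [Q] and [Z], so if [X] splits
   [Q] then the cycle passes from [X] to its complement in two steps. *)
Lemma digon_path L Q Z X x x' : digon L Q Z -> x \in Q -> x \in X -> x' \in Q -> x' \notin X ->
  exists u y w, [/\ u \in Q :&: X, y \in Z, w \in Q :\: X, h u y & h y w].
Proof.
move=> dg xQ xX x'Q x'X; have [_ _ _ _ [cC _]] := dg.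
have [hsym _] := hM.
have [/existsP [u /existsP [y /existsP [w /and5P [h1 h2 h3 h4 h5]]]]|none] :=
  boolP [exists u, exists y, exists w, [&& u \in Q :&: X, y \in Z, w \in Q :\: X, h u y & h y w]].
  by exists u, y, w.
have sub : Q :|: Z \subset (Q :&: X) :|: [set y in Z | [exists u, (u \in Q :&: X) && h u y]].
  apply: (circuit_connected hM (x := x) cC); rewrite ?inE ?xQ ?xX // => y z + yC zC hyz.
  rewrite in_setU => /orP [yQ|].
    move: zC; rewrite inE => /orP [zQ|zZ].
      by move: yQ; rewrite inE => /andP [yQ _]; rewrite (digon_nadj dg yQ zQ) in hyz.
    by rewrite !inE zZ /= orbC; apply/orP; left; apply/existsP; exists y; rewrite yQ.
  rewrite inE => /andP [yZ /existsP [u /andP [uQ huy]]].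
  move: zC; rewrite inE => /orP [zQ|zZ]; last first.
    by rewrite (digon_nadj (digon_sym dg) yZ zZ) in hyz.
  rewrite in_setU; apply/orP; left; rewrite inE zQ /=; apply: contraT => zX.
  case/negP: none; apply/existsP; exists u; apply/existsP; exists y; apply/existsP; exists z.
  by rewrite uQ yZ inE zX zQ huy hyz.
have [_ _ _ dZ _] := dg.
have := subsetP sub x'; rewrite !inE x'Q (negbTE x'X) /= => /(_ isT) /andP [x'Z _].
have [_ _ [q _ sQ] _ _] := dg.
have x'L := subsetP (cls_sub M L q) x' (subsetP sQ x' x'Q).
by rewrite (disjointFr dZ x'Z) in x'L.
Qed.

End Digon.

(** * Circuits that contain only part of a path *)

Section Unsplit.
Variables (T : finType) (M : matroid T) (h : rel T).
Hypothesis hM : ordered M h.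
Implicit Types (L X Y C D B S Q V Z R : {set T}) (x y z a b c d e f q v : T).
Local Notation cl := (cls M).

Definition splits C Q := [&& circuit M C, ~~ [disjoint C & Q] & ~~ (Q \subset C)].

Lemma splitsP C Q : reflect
  (circuit M C /\ exists x x', [/\ x \in C, x \in Q, x' \in Q & x' \notin C]) (splits C Q).
Proof.
apply: (iffP and3P) => [[cC /pred0Pn [x /andP [xC xQ]] /subsetPn [x' x'Q x'C]]|].
  by split=> //; exists x, x'.
case=> cC [x [x' [xC xQ x'Q x'C]]]; split=> //; first by apply/pred0Pn; exists x; rewrite /= xC.
by apply/subsetPn; exists x'.
Qed.

(** Deleting [d] and then [x] costs at most two units of nullity. The core that is left has at least
    the nullity of [R] but lacks [x], so it cannot lie inside [R]. *)
Lemma avoiding_circuit R C d x : cyc M R -> circuit M C ->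
  nul M R + 2 <= nul M (R :|: C) -> d \in C -> d \notin R -> x \in R ->
  exists D, [/\ circuit M D, D \subset (R :|: C) :\ d, x \notin D & ~~ (D \subset R)].
Proof.
move=> cR cC n2 dC dR xR; set X := core M ((R :|: C) :\ d).
have sRX : R \subset X by apply: cyc_core => //; sets.
have cRC : cyc M (R :|: C) by apply: cycU => //; apply: circuit_cyc.
have dRC : d \in R :|: C by rewrite inE dC orbT.
have nX : nul M R + 1 <= nul M X by rewrite nul_core; have := nul_cyc cRC dRC; nlia.
have cX : cyc M X by apply: core_cyc.
have nXx : nul M R <= nul M (core M (X :\ x)).
  by rewrite nul_core; have := nul_cyc cX (subsetP sRX x xR); nlia.
have [s|/subsetPn [y yX yR]] := boolP (core M (X :\ x) \subset R).
  have E := cyc_eq cR s nXx; have := xR; rewrite -E => /(subsetP (coreS _ _)).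
  by rewrite !inE eqxx.
have [D [cD yD sD]] := cyc_circuit yX.
exists D; split=> //; last by apply/subsetPn; exists y.
  by apply: subset_trans sD (subset_trans (subsetDl _ _) (coreS _ _)).
by apply/negP => /(subsetP sD); rewrite !inE eqxx.
Qed.

(** Otherwise there is a circuit [D] avoiding [x] that is smaller than [C] outside [R]; by
    minimality it does not split [Q], so it is disjoint from [Q]. Eliminating an element outside [R]
    between [C] and [D] keeps [x] in and [x'] out, which gives a smaller splitting circuit. *)
Lemma splits_ear R C Q : cyc M R -> Q \subset R -> splits C Q ->
  (forall C', splits C' Q -> ~~ (C' :\: R \proper C :\: R)) ->
  nul M (R :|: C) <= (nul M R).+1.
Proof.
move=> cR sQ sC min; rewrite leqNgt; apply/negP => n2.
have /splitsP [cC [x [x' [xC xQ x'Q x'C]]]] := sC.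
have [d dC dR] : exists2 d, d \in C & d \notin R.
  apply/subsetPn; apply/negP => s; move: n2; rewrite (setUidPl s); lia.
have xR := subsetP sQ x xQ.
have [|D [cD sD xD nD]] := avoiding_circuit cR cC _ dC dR xR; first by nlia.
have pD : D :\: R \proper C :\: R.
  rewrite properE; apply/andP; split; first by move: sD; sets.
  by apply/subsetPn; exists d; [rewrite inE dR | apply/negP; rewrite inE => /andP [_ /(subsetP sD)]; rewrite !inE eqxx].
have dDQ : [disjoint D & Q].
  have nsD : ~~ splits D Q by apply: contraL pD; apply: min.
  apply: contraNT nsD => dq; apply/and3P; split=> //; apply/subsetPn; exists x => //.
have /subsetPn [e eD eR] := nD.
have eC : e \in C by have := subsetP sD e eD; rewrite !inE (negbTE eR) => /andP [].
have [C3 [cC3 xC3 eC3 sC3]] := circuit_elim cC cD eC eD xC xD.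
have s3 : splits C3 Q.
  apply/splitsP; split=> //; exists x, x'; split=> //.
  by apply/negP => /(subsetP sC3); rewrite inE (negbTE x'C) (disjointFl dDQ x'Q).
have := min C3 s3; rewrite properE => /negP; apply; apply/andP; split.
  by move: sC3 sD; sets.
by apply/subsetPn; exists e; rewrite inE eR //= (negbTE eC3).
Qed.

(** Descent on the part outside [L]: when the nullity rises by two or more, some circuit [D] avoids
    [e] but leaves [L], and elimination against [D] keeps [e] and shrinks that part. The result
    still meets [L], since otherwise it would be a proper subset of [C]. *)
Lemma ear_through L C0 e : cyc M L -> circuit M C0 -> e \in C0 -> e \notin L ->
  ~~ [disjoint C0 & L] -> exists C, [/\ circuit M C, e \in C, ~~ [disjoint C & L],
    C :\: L \subset C0 :\: L & nul M (L :|: C) <= (nul M L).+1].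
Proof.
move=> cL; have [n] := ubnP #|C0 :\: L|; elim: n C0 => // n IH C lt cC eC eL mC.
have [le|n2] := leqP (nul M (L :|: C)) (nul M L).+1; first by exists C.
have [x xC xL] : exists2 x, x \in C & x \in L by have /pred0Pn [x /andP []] := mC; exists x.
have [|D [cD sD _ nD]] := avoiding_circuit cL cC _ eC eL xL; first by nlia.
have /subsetPn [d dD dL] := nD.
have eD : e \notin D by apply/negP => /(subsetP sD); rewrite !inE eqxx.
have dC : d \in C by have := subsetP sD d dD; rewrite !inE (negbTE dL) => /andP [].
have mD : ~~ [disjoint D & L].
  apply/negP => dDL; have sDC : D \subset C by move: sD dDL; sets.
  by rewrite (circuit_eq cD cC sDC) eC in eD.
have [C' [cC' eC' dC' sC']] := circuit_elim cC cD dC dD eC eD.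
have s' : C' :\: L \subset C :\: L by move: sC' sD; sets.
have pC' : C' :\: L \proper C :\: L.
  by rewrite properE s'; apply/subsetPn; exists d; rewrite inE dL //= (negbTE dC').
have mC' : ~~ [disjoint C' & L].
  apply/negP => dCL; have sC'C : C' \subset C by move: s' dCL; sets.
  by rewrite (circuit_eq cC' cC sC'C) dC in dC'.
have [|C1 [c1 e1 m1 s1 n1]] := IH C' _ cC' eC' eL mC'.
  by apply: leq_trans (proper_card pC') _.
by exists C1; split=> //; apply: subset_trans s1 s'.
Qed.

Lemma split_wlog (f : {set T} -> nat) Q : 
  (exists C, splits C Q) -> exists C, splits C Q /\ forall C', splits C' Q -> f C <= f C'.
Proof.
case=> C0 s0; case: (@arg_minnP _ C0 (fun C => splits C Q) f s0) => C sC min.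
by exists C; split=> // C' /min.
Qed.

Section MinDigon.
Variables (L Q Z : {set T}).
Hypothesis dg : digon M L Q Z.
Hypothesis min : forall L' Q' Z', digon M L' Q' Z' -> #|Q| <= #|Q'|.

(** A least splitting circuit gives an ear [V] and a second digon on [Q2] and [V], where [Q2] itself
    splits [Q]. The alternating cycle on [Q :|: Z] passes from [x1] in [Q2] through some [y] in [Z]
    to [x2] outside [Q2]. After [Q] is swapped for [Z], the circuit [Q2 :|: V] forms a third digon,
    and its swap puts the neighbours [x1] and [y] into one class. *)
Lemma min_digon_unsplit C : ~~ splits C Q.
Proof.
apply/negP => sC0; have [hsym _] := hM.
(* A lexicographic measure: the part outside [L :|: Z] counts more than the part outside [L], which
   has at most [#|T|] elements. A single minimiser then satisfies [splits_ear] over [L] and over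
   [L :|: Z]. *)
pose f C := #|C :\: (L :|: Z)| * #|T|.+1 + #|C :\: L|.
have fle C1 C2 : C1 :\: (L :|: Z) \subset C2 :\: (L :|: Z) -> C1 :\: L \proper C2 :\: L -> f C1 < f C2.
  move=> /subset_leq_card h1 /proper_card h2; rewrite /f.
  by apply: leq_trans (_ : _ < #|C1 :\: (L :|: Z)| * #|T|.+1 + #|C2 :\: L|) _; rewrite ?ltn_add2l // leq_add2r leq_mul2r h1 orbT.
have flt C1 C2 : C1 :\: (L :|: Z) \proper C2 :\: (L :|: Z) -> f C1 < f C2.
  move=> /proper_card h1; rewrite /f.
  have h2 : #|C1 :\: L| <= #|T| := max_card _.
  have := leq_mul h1 (leqnn #|T|.+1); rewrite mulSn; nlia.
have [C' [{C sC0} sC' fmin]] := split_wlog f (ex_intro _ C sC0).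
move: C' sC' fmin => C sC fmin.
have [e nc] := digon_ear dg; have [qL Q0 [q qinL sQ] dZ [cQ n3]] := dg.
have [lL _] := qL; have [cL nL] := lL; have [_ _ Z0 cA _] := e.
have sQL := subset_trans sQ (cls_sub M L q).
have /splitsP [cC [x [x' [xC xQ x'Q x'C]]]] := sC.
have nLC : nul M (L :|: C) <= 3.
  rewrite -nL; apply: (splits_ear cL sQL sC) => C' s'; apply/negP => p.
  have := fmin C' s'; rewrite leqNgt fle //.
  by have := proper_sub p; sets.
have nLZC : nul M ((L :|: Z) :|: C) <= 4.
  have nA : nul M (L :|: Z) = 3 := ear_nul e.
  rewrite -nA; apply: (splits_ear cA _ sC); first by move: sQL; sets.
  by move=> C' s'; apply/negP => p; have := fmin C' s'; rewrite leqNgt flt.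
have nCL : ~~ (C \subset L).
  apply/negP => s; move: x'C; rewrite (cls_circuit cL cC s (x := x)) ?xC //.
    exact: (subsetP sQL).
  by rewrite (cls_eq cL qinL (subsetP sQ x xQ)) (subsetP sQ).
have mC : ~~ [disjoint C & L] by apply/pred0Pn; exists x; rewrite /= xC (subsetP sQL).
have [eV ncV] := ear_circuit_diff qL cC nCL mC nLC.
have [V EV] : exists V, V = C :\: L by eexists.
rewrite -EV in eV ncV.
have sCA : C \subset L :|: V by rewrite EV; sets.
have xL := subsetP sQL x xQ; have x'L := subsetP sQL x' x'Q.
have clx : cl L x = cl L q by apply: cls_eq => //; apply: (subsetP sQ).
have [[q2 [q2L _ dg2]]|nw] := ear_types hM eV ncV; last first.
  have [_ Ex] := nw x xL; have [_ _ _ cAV _] := eV.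
  have := cls_circuit cAV cC sCA (x := x) (y := x').
  rewrite Ex clx (subsetP sQ x' x'Q) xC (negbTE x'C) inE xL => /(_ isT isT).
  by [].
set Q2 := cl _ q2 in dg2.
have [_ _ [r rL sQ2] dV [cQ2 nV]] := dg2.
have sQ2L := subset_trans sQ2 (cls_sub M L r).
have [qL2 cQV clL2 clV2] := digon_quad hM dg2 rL sQ2.
(* [Q2] splits [Q], hence lies in the same class. *)
have [u [u' [uQ uQ2 u'Q u'Q2]]] : exists u u', [/\ u \in Q, u \in Q2, u' \in Q & u' \notin Q2].
  have [s|s|EC] := digon_circuit hM dg2 cC sCA; first by rewrite s in nCL.
    have xQ2 : x \notin Q2 by apply/negP => hx; have := subsetP s x xC; rewrite /swap inE hx.
    have [x'Q2|x'Q2] := boolP (x' \in Q2); first by exists x', x.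
    have xs : x \in swap L Q2 V by apply: (subsetP s).
    have x's : x' \in swap L Q2 V by rewrite /swap !inE x'Q2 x'L.
    have [[cS _] _] := qL2.
    suff hc : x' \in cl (swap L Q2 V) x.
      by have := cls_circuit cS cC s xs hc; rewrite xC (negbTE x'C).
    have [xr|xr] := boolP (x \in cl L r); last first.
      by rewrite clL2 // clx (subsetP sQ).
    have [_ _ /set0Pn [v vV] _ _] := eV.
    have hv w : w \in Q -> w \notin Q2 -> w \in cl (swap L Q2 V) v.
      move=> wQ wQ2; rewrite clV2 // !inE wQ2 -(cls_eq cL rL xr) clx (subsetP sQ w wQ).
      by rewrite orbT.
    have vs : v \in swap L Q2 V.
      by rewrite /swap !inE vV orbT andbT; apply/negP => /(subsetP sQ2L); rewrite (disjointFr dV vV).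
    by rewrite (cls_eq cS vs (hv x xQ xQ2)); apply: hv.
  exists x, x'; split=> //.
    by have := xC; rewrite EC inE orbC (disjointFl dV xL).
  by apply: contra x'C => hx; rewrite EC inE hx.
have Er : cl L r = cl L q.
  have ur := subsetP sQ2 u uQ2; have uq := subsetP sQ u uQ.
  by rewrite -(cls_eq cL rL ur) -(cls_eq cL qinL uq).
rewrite Er in sQ2 clL2 clV2.
(* Here minimality of [Q] enters: [Q2] lacks [u'], so inside [Q] it would give a smaller digon. The
   element [p] keeps [X] below nonempty. *)
have /subsetPn [p pQ2 pQ] : ~~ (Q2 \subset Q).
  apply/negP => s; have : #|Q2| < #|Q|.
    by apply: proper_card; rewrite properE s; apply/subsetPn; exists u'.
  by rewrite ltnNge (min dg2).
have [x1 [y [x2 [x1Q yZ x2Q h1 h2]]]] := digon_path hM dg uQ uQ2 u'Q u'Q2.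
move: x1Q x2Q; rewrite !inE => /andP [x1Q x1Q2] /andP [x2Q2 x2Q].
have S2x2 v : v \in V -> x2 \in cl (swap L Q2 V) v.
  by move=> vV; rewrite clV2 // !inE x2Q2 (subsetP sQ x2 x2Q) orbT.
have inS2 v : v \in V -> v \in swap L Q2 V.
  by move=> vV; rewrite /swap !inE vV orbT andbT; apply/negP => /(subsetP sQ2L); rewrite (disjointFr dV vV).
(* In the quad with [Q2] swapped for [V], the element [x2] shares its class with all of [V], and
   classes have no inner adjacency. *)
have yV : y \notin V.
  by apply/negP => yV; have := quad_nadj hM qL2 (inS2 y yV) (S2x2 y yV); rewrite h2.
have [qL1 _ clL1 clZ1] := digon_quad hM dg qinL sQ.
have inS1 z : z \in Z -> z \in swap L Q Z.
  by move=> zZ; rewrite /swap !inE zZ orbT andbT; apply/negP => /(subsetP sQL); rewrite (disjointFr dZ zZ).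
(* The circuit [Q2 :|: V] is regrouped: [X] is its part inside [swap L Q Z], contained in one class
   there, and [Y] is the part to be swapped in. *)
pose Y := (V :\: Z) :|: (Q :&: Q2); pose X := (V :&: Z) :|: (Q2 :\: Q).
have x1L := subsetP sQL x1 x1Q; have x2L := subsetP sQL x2 x2Q.
have sX : X \subset cl (swap L Q Z) y by rewrite clZ1 // /X; move: sQ2; sets.
have dg3 : digon M (swap L Q Z) X Y.
  split=> //.
  - by apply/set0Pn; exists p; rewrite !inE pQ pQ2 orbT.
  - by exists y => //; apply: inS1.
  - by rewrite /swap /Y; move: dV; sets.
  - split; first by have -> : X :|: Y = Q2 :|: V by rewrite /X /Y; sets.
    (* The cyclic set [(L :|: Z) :|: C] has nullity at most 4; the set in question lies in it and
       misses [x2], which brings the bound down to 3. *)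
    have cB : cyc M ((L :|: Z) :|: C) by apply: cycU => //; apply: circuit_cyc.
    have x2B : x2 \in (L :|: Z) :|: C by rewrite !inE x2L.
    have := nul_cyc cB x2B; have : nul M (swap L Q Z :|: Y) <= nul M (((L :|: Z) :|: C) :\ x2).
      apply: nulS; rewrite subsetD1; apply/andP; split; first by rewrite /swap /Y EV; move: sQL; sets.
      by rewrite /swap /Y !(in_setU, in_setD, in_setI) x2Q (negbTE x2Q2) (disjointFl dV x2L) !andbF.
    nlia.
have [qL3 _ _ clY3] := digon_quad hM dg3 (inS1 y yZ) sX.
have x1Y : x1 \in Y by rewrite !inE x1Q x1Q2 orbT.
have x1S3 : x1 \in swap (swap L Q Z) X Y.
  by rewrite /swap in_setD in_setU x1Y orbT andbT /X !inE x1Q (disjointFl dV x1L).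
have : h x1 y = false.
  apply: (quad_nadj hM qL3 x1S3); rewrite clY3 // in_setU in_setD; apply/orP; right.
  apply/andP; split; last by apply: cls_refl; apply: inS1.
  rewrite /X !inE (negbTE yV) /= negb_and; apply/orP; right.
  by apply/negP => /(subsetP sQ2L); rewrite (disjointFr dZ yZ).
by rewrite h1.
Qed.

End MinDigon.

(** The ear given by a least splitting circuit is no digon, hence a new class. Then the class of [q]
    is still a series class of the larger set, which contains the circuit. *)
Lemma class_unsplit L q C : (forall L' Q Z, ~ digon M L' Q Z) -> quad M L -> q \in L ->
  ~~ splits C (cl L q).
Proof.
move=> nd qL qinL; apply/negP => sC0; have [lL _] := qL; have [cL nL] := lL.
have [C' [{C sC0} sC' fmin]] := split_wlog (fun C => #|C :\: L|) (ex_intro _ C sC0).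
move: C' sC' fmin => C sC fmin; have sQL := cls_sub M L q.
have /splitsP [cC [x [x' [xC xQ x'Q x'C]]]] := sC.
have nLC : nul M (L :|: C) <= 3.
  rewrite -nL; apply: (splits_ear cL sQL sC) => C' s'; apply/negP => p.
  by have := fmin C' s'; rewrite leqNgt proper_card.
have xL := subsetP sQL x xQ.
have clx : cl L x = cl L q by apply: cls_eq.
have nCL : ~~ (C \subset L).
  apply/negP => s; move: x'C; rewrite (cls_circuit cL cC s (x := x)) ?xC //.
  by rewrite clx.
have mC : ~~ [disjoint C & L] by apply/pred0Pn; exists x; rewrite /= xC.
have [eV ncV] := ear_circuit_diff qL cC nCL mC nLC.
have [[q2 [_ _ dg]]|nw] := ear_types hM eV ncV; first by case: (nd _ _ _ dg).
have [_ Ex] := nw x xL; have [_ _ _ cAV _] := eV.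
have sCA : C \subset L :|: (C :\: L) by sets.
have := cls_circuit cAV cC sCA (x := x) (y := x').
by rewrite Ex clx x'Q xC (negbTE x'C) inE xL => /(_ isT isT).
Qed.
End Unsplit.

(** * Binary matroids *)

Import GRing.Theory.

Section Binary.
Variables (T : finType) (M : matroid T).
Implicit Types (A B C D I J L R X Y : {set T}) (x y e f : T).
Local Notation cl := (cls M).

Lemma basis_fund B e : basis M B -> e \in ground M -> e \notin B ->
  exists C, [/\ circuit M C, e \in C & C \subset e |: B].
Proof.
move=> /maxsetP [iB mB] eE eB; have sB := indep_ground iB.
have n1 : 0 < nul M (e |: B).
  rewrite lt0n; apply/negP => n0; move: eB.
  rewrite -(mB (e |: B)) ?setU11 ?subsetUr // indep_nul n0 andbT.
  by rewrite subUset sub1set eE.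
have [C cC sC] := nul_circuit n1; exists C; split=> //.
apply: contraT => eC; have s : C \subset B by move: sC eC; sets.
by have := indepS s iB; rewrite indep_nul (circuit_nul1 cC) andbF.
Qed.

Lemma basis_ext X : indep M X -> exists2 B, basis M B & X \subset B.
Proof.
by move=> iX; have [B bB s] := maxset_exists iX; exists B.
Qed.

Lemma cyc_between R A k : cyc M R -> R \subset A -> nul M R <= k <= nul M A ->
  exists X, [/\ cyc M X, R \subset X, X \subset A & nul M X = k].
Proof.
move=> cR; have [n] := ubnP #|A|; elim: n A => // n IH A lt sRA /andP [le1 le2].
have [eqk|ltk] := eqVneq (nul M A) k.
  exists (core M A); rewrite core_cyc nul_core coreS; split=> //; exact: cyc_core.
have [y yA yR] : exists2 y, y \in A & y \notin R.
  by apply/subsetPn; apply: contra ltk => s; have := nulS M s; nlia.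
have sRy : R \subset A :\ y by rewrite subsetD1 sRA.
have [| //| |X [cX RX XA nX]] := IH (A :\ y).
- by move: lt; rewrite (cardsD1 y A) yA; nlia.
- by rewrite le1; have := nulD1 M A y; nlia.
by exists X; split=> //; apply: subset_trans XA (subsetDl _ _).
Qed.

Hypothesis no_quad : forall L, ~ quad M L.

(* A circuit [C] with two elements outside [B] lies in a line within its span with [B] that has
   exactly three classes; its other two circuits have fewer elements outside [B], and [C] is their
   symmetric difference. *)
Lemma circuit_sum0 (V : zmodType) (v : T -> V) B : (forall w : V, w + w = 0)%R ->
  basis M B -> (forall C, circuit M C -> #|C :\: B| = 1 -> \sum_(x in C) v x = 0)%R ->
  forall C, circuit M C -> (\sum_(x in C) v x = 0)%R.
Proof.
move=> v2 bB fund C; have [n] := ubnP #|C :\: B|; elim: n C => // n IH C lt cC.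
have iB := basis_indep bB; have sBE := indep_ground iB.
have nB : nul M B = 0 by have := iB; rewrite indep_nul => /andP [_ /eqP].
have CB0 D : circuit M D -> 0 < #|D :\: B|.
  move=> cD; rewrite card_gt0 setD_eq0; apply/negP => s.
  by have := nulS M s; rewrite nB (circuit_nul1 cD).
have [le1|gt1] := leqP #|C :\: B| 1.
  by apply: fund => //; apply/eqP; rewrite eqn_leq le1 CB0.
have /card_gt1P [e [e' [eC e'C ne]]] := gt1.
move: (eC) (e'C); rewrite !inE => /andP [eB eC'] /andP [e'B e'C'].
have sCE := cyc_ground (circuit_cyc cC).
have [D [cD eD sD]] := basis_fund bB (subsetP sCE e eC') eB.
have e'D : e' \notin D by apply/negP => /(subsetP sD); rewrite !inE eq_sym (negbTE ne) (negbTE e'B).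
have nCB : 1 < nul M (C :|: D).
  have cCD : cyc M (C :|: D) by apply: cycU; apply: circuit_cyc.
  rewrite (nul_cyc cCD (x := e')) ?inE ?e'C' // ltnS -(circuit_nul1 cD).
  by apply: nulS; apply/subsetP => x xD; rewrite !inE xD orbT andbT; apply: contraNneq e'D => <-.
have [|L [cL sCL sLD nL]] := cyc_between (k := 2) (circuit_cyc cC) (subsetUl C D).
  by rewrite (circuit_nul1 cC).
have lL : line M L by [].
have [x xL xC] := line_proper lL cC sCL.
have EC := line_circuitE lL cC sCL xL xC.
have sxB : cl L x \subset B.
  have h := cls_sub M L x; apply/subsetP => y yx; have yL := subsetP h y yx.
  have yC : y \notin C by rewrite EC inE yx.
  have := subsetP sLD y yL; rewrite inE (negbTE yC) /= => /(subsetP sD); rewrite !inE => /orP [/eqP ye|//].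
  by rewrite ye eC' in yC.
have inLC y : y \in C -> y \in L := subsetP sCL y.
have [c2 c2C c21] : exists2 c, c \in C & c \notin cl L e.
  apply/subsetPn; apply/negP => s.
  have := CB0 _ (line_circuit lL (inLC e eC')); rewrite lt0n cards_eq0 setD_eq0 => /negP; apply.
  by move: s sxB; rewrite {1}EC; sets.
have c2x : c2 \notin cl L x by move: c2C; rewrite EC inE => /andP [].
have ex : e \notin cl L x by move: eC'; rewrite EC inE => /andP [].
have eL := inLC e eC'; have c2L := inLC c2 c2C.
have EL : L = cl L x :|: cl L e :|: cl L c2.
  apply/eqP; rewrite eqEsubset; apply/andP; split; last by rewrite !subUset !cls_sub.
  apply/subsetP => y yL; rewrite !in_setU; apply: contraT; rewrite !negb_or => /andP [/andP [yx ye] yc].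
  case: (no_quad (L := L)); apply: (@quad_intro _ _ _ [:: x; e; c2; y]) => //.
    by apply/allP; rewrite /= xL eL c2L yL.
  by rewrite /= ex c2x yx c21 ye yc.
have d1 : [disjoint cl L x & cl L e] by apply: cls_disj.
have d2 : [disjoint cl L x & cl L c2] by apply: cls_disj.
have d3 : [disjoint cl L e & cl L c2] by apply: cls_disj.
have sumU X Y : [disjoint X & Y] -> (\sum_(z in X :|: Y) v z = \sum_(z in X) v z + \sum_(z in Y) v z)%R.
  by move=> d; rewrite (big_setID X) /= setUK setDUl setDv set0U (setDidPl _) // disjoint_sym.
have E1 : C = cl L e :|: cl L c2 by rewrite EC {1}EL; move: d1 d2; sets.
have E2 : L :\: cl L e = cl L x :|: cl L c2 by rewrite {1}EL; move: d1 d3; sets.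
have E3 : L :\: cl L c2 = cl L x :|: cl L e by rewrite {1}EL; move: d2 d3; sets.
have k2 : circuit M (cl L x :|: cl L c2) by rewrite -E2; apply: line_circuit.
have k3 : circuit M (cl L x :|: cl L e) by rewrite -E3; apply: line_circuit.
have F2 : (cl L x :|: cl L c2) :\: B = cl L c2 :\: B by move: sxB; sets.
have F3 : (cl L x :|: cl L e) :\: B = cl L e :\: B by move: sxB; sets.
have p2 := CB0 _ k2; have p3 := CB0 _ k3; rewrite F2 in p2; rewrite F3 in p3.
have cEC : #|C :\: B| = #|cl L e :\: B| + #|cl L c2 :\: B|.
  rewrite -cardsUI {1}E1 setDUl.
  have -> : (cl L e :\: B) :&: (cl L c2 :\: B) = set0 by move: d3; sets.
  by rewrite cards0 addn0.
have s2 : (\sum_(z in cl L x) v z + \sum_(z in cl L c2) v z = 0)%R.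
  by rewrite -sumU //; apply: IH k2; rewrite F2; nlia.
have s3 : (\sum_(z in cl L x) v z + \sum_(z in cl L e) v z = 0)%R.
  by rewrite -sumU //; apply: IH k3; rewrite F3; nlia.
rewrite E1 sumU //; move: s2 s3.
set a := (\sum_(z in cl L x) v z)%R; set b := (\sum_(z in cl L c2) v z)%R; set c := (\sum_(z in cl L e) v z)%R.
by move=> /eqP; rewrite addrC addr_eq0 => /eqP -> /eqP; rewrite addrC addr_eq0 => /eqP ->; rewrite -opprD v2 oppr0.
Qed.

(** The vectors are the columns of the standard matrix with respect to a basis: unit vectors on [B],
    and for other elements the sum over the fundamental circuit. By [circuit_sum0] every circuit
    sums to zero, so dependent sets get dependent vectors. *)
Lemma no_quad_binary : binary M.
Proof.
have [B bB] := basis_exists M; have iB := basis_indep bB.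
have nB : nul M B = 0 by move: iB; rewrite indep_nul => /andP [_ /eqP].
pose u x : 'rV['F_2]_#|T| := delta_mx ord0 (enum_rank x).
(* For [x] in the ground set outside [B], the set [x |: B] has nullity one and its core is the
   fundamental circuit of [x]. *)
pose v x := (if x \in B then u x else \sum_(y in core M (x |: B) :\ x) u y)%R.
have char2 (w : 'rV['F_2]_#|T|) : (w + w = 0)%R.
  apply/matrixP => i j; rewrite !mxE; case: (w i j) => [[|[|]]] // ?; apply: val_inj => //.
have core1 C e : circuit M C -> C :\: B = [set e] -> C = core M (e |: B).
  move=> cC E; apply: (@cyc_eq _ M); first exact: core_cyc.
    by apply: circuit_core => //; move: E; sets.
  rewrite nul_core (circuit_nul1 cC); have := nulD1 M (e |: B) e.
  have : nul M ((e |: B) :\ e) <= nul M B by apply: nulS; sets.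
  by rewrite nB; nlia.
have fund C : circuit M C -> #|C :\: B| = 1 -> (\sum_(x in C) v x = 0)%R.
  move=> cC /eqP /cards1P [e E].
  have eC : e \in C :\: B by rewrite E set11.
  move: eC; rewrite inE => /andP [eB eC].
  rewrite (big_setD1 e eC) /= {1}/v (negbTE eB) -(core1 C e cC E).
  suff -> : (\sum_(i in C :\ e) v i = \sum_(i in C :\ e) u i)%R by rewrite char2.
  apply: eq_bigr => y yC; rewrite /v.
  move: yC; rewrite in_setD1 => /andP [ye yC].
  suff -> : y \in B by [].
  by apply: contraNT ye => yB; rewrite -in_set1 -E inE yB.
have sum0 := circuit_sum0 char2 bB fund.
exists #|T|, v => X sX.
have freeS (Y Z : {set T}) : Y \subset Z -> free [seq v x | x <- enum Z] -> free [seq v x | x <- enum Y].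
  move=> sYZ fZ; have p : perm_eq (enum Z) (enum Y ++ enum (Z :\: Y)).
    apply: uniq_perm; rewrite ?enum_uniq //.
      rewrite cat_uniq !enum_uniq andbT /=; apply/hasPn => y; rewrite !mem_enum inE.
      by case/andP.
    by move=> y; rewrite mem_cat !mem_enum inE; have := subsetP sYZ y; case: (y \in Y) => //= ->.
  have := fZ; rewrite (perm_free (perm_map v p)) map_cat; exact: catl_free.
have circ_nf C : circuit M C -> ~~ free [seq v x | x <- enum C].
  move=> cC; apply/negP => fC; have H := elimT (@freeP _ _ _ (in_tuple [seq v x | x <- enum C])) fC.
  have [x xC] := circuit_n0 cC.
  have lt0 : 0 < size [seq v x | x <- enum C].
    by rewrite size_map -cardE card_gt0; apply/set0Pn; exists x.
  have := H (fun=> 1%R) _ (Ordinal lt0); rewrite (_ : \sum_(i < _) _ = \sum_(w <- [seq v x | x <- enum C]) w)%R.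
    by rewrite big_map big_enum sum0 // => /(_ erefl)/eqP; rewrite oner_eq0.
  by rewrite (big_nth 0%R) big_mkord; apply: eq_bigr => i _; rewrite scale1r.
apply/idP/idP => [iX|fX]; last first.
  rewrite indep_nul sX /=; apply: contraT; rewrite -lt0n => /nul_circuit [C cC sC].
  by have := circ_nf C cC; rewrite (freeS C X).
have [B' bB' sB'] := basis_ext iX; apply: freeS sB' _.
have fB : free [seq v x | x <- enum B].
  have -> : [seq v x | x <- enum B] = [seq u x | x <- enum B].
    by apply/eq_in_map => x; rewrite mem_enum /v => ->.
  apply: (introT (@freeP _ _ _ (in_tuple [seq u x | x <- enum B]))) => k Hk i; move: (Hk).
  have [x0 _] : exists x, x \in enum B.
    by case: i => m; rewrite size_map; case: (enum B) => // x s _; exists x; rewrite mem_head.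
  have ltB (j : 'I_(size [seq u x | x <- enum B])) : j < size (enum B) by rewrite -(size_map u).
  move=> /matrixP /(_ ord0 (enum_rank (nth x0 (enum B) i))).
  rewrite summxE mxE (bigD1 i) //= big1 ?addr0 => [|j ji].
    by rewrite (nth_map x0) // !mxE !eqxx mulr1.
  rewrite (nth_map x0) // !mxE eqxx /= (inj_eq enum_rank_inj) nth_uniq ?enum_uniq //.
  by have := ji; rewrite -val_eqE /= eq_sym => /negbTE ->; rewrite mulr0.
(* Dimension count: [B'] has as many elements as [B], so it suffices that the independent vectors of
   [B] lie in the span of those of [B']. *)
rewrite /free eqn_leq dim_span size_map -cardE (basis_card bB' bB) /=.
move: fB; rewrite /free => /eqP; rewrite size_map -cardE => <-.
apply: dimvS; apply/span_subvP => w /mapP [x]; rewrite mem_enum => xB ->.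
have xE := subsetP (indep_ground iB) x xB.
have mem y : y \in B' -> v y \in <<[seq v x | x <- enum B']>>%VS.
  by move=> yB; apply/memv_span/map_f; rewrite mem_enum.
have [xB'|xB'] := boolP (x \in B'); first exact: mem.
have [C [cC xC sC]] := basis_fund bB' xE xB'.
have := sum0 C cC; rewrite (big_setD1 x xC) /= => /eqP; rewrite addr_eq0 => /eqP ->.
rewrite memvN; apply: memv_suml => y; rewrite !inE => /andP [yx yC]; apply: mem.
by have := subsetP sC y yC; rewrite !inE (negbTE yx).
Qed.

End Binary.

(** * Duality, deletion and contraction *)

Section Dual.
Variable T : finType.
Implicit Types (M N : matroid T) (B C D I J X Y Z : {set T}) (x y e f : T).

Lemma basis_rk M B : basis M B = indep M B && (#|B| == rk M (ground M)).
Proof.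
apply/idP/andP => [bB|[iB /eqP cB]].
  have iB := basis_indep bB; split=> //.
  have [J [iJ sBJ _ <-]] := rk_ext iB (indep_ground iB).
  by have /maxsetP [_ mB] := bB; rewrite (mB J iJ sBJ).
apply/maxsetP; split=> // J iJ sJ; apply/esym/eqP; rewrite eqEcard sJ cB.
exact: rk_ub (indep_ground iJ).
Qed.

Lemma coindep_rk M X :
  coindep M X = (X \subset ground M) && (rk M (ground M :\: X) == rk M (ground M)).
Proof.
rewrite /coindep; congr andb; apply/existsP/eqP => [[B /andP [bB d]]|E].
  move: bB; rewrite basis_rk => /andP [iB /eqP cB]; apply/eqP; rewrite eqn_leq.
  apply/andP; split; last by rewrite -cB; apply: rk_ub => //; have := indep_ground iB; move: d; sets.
  have [J [iJ _ sJ <-]] := rk_ext (indep0 M) (sub0set (ground M :\: X)).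
  by apply: rk_ub => //; apply: subset_trans sJ (subsetDl _ _).
have [J [iJ _ sJ cJ]] := rk_ext (indep0 M) (sub0set (ground M :\: X)).
exists J; rewrite basis_rk iJ cJ E eqxx /=; move: sJ; sets.
Qed.

Lemma rk_nul M X : X \subset ground M -> rk M X + nul M X = #|X|.
Proof. by move=> s; rewrite nulE // subnKC // -{2}(setIidPl s); apply: rk_le. Qed.

Lemma coindep_nul M X :
  coindep M X = (X \subset ground M) && (nul M (ground M) == nul M (ground M :\: X) + #|X|).
Proof.
rewrite coindep_rk; case s: (X \subset ground M) => //=.
have := rk_nul (subxx (ground M)); have := rk_nul (subsetDl (ground M) X).
have := cardsID X (ground M); rewrite (setIidPr s); move=> *; apply/eqP/eqP; lia.
Qed.

Lemma nulDI M I J : (forall x, x \in I -> x \in core M (ground M :\: (I :\ x))) ->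
  J \subset I -> nul M (ground M) = nul M (ground M :\: J) + #|J|.
Proof.
move=> h; have [n] := ubnP #|J|; elim: n J => // n IH J lt sJ.
have [->|[x xJ]] := set_0Vmem J; first by rewrite setD0 cards0 addn0.
have xI := subsetP sJ x xJ.
have cJ : #|J| = #|J :\ x|.+1 by rewrite (cardsD1 x J) xJ.
rewrite (IH (J :\ x)); [|by move: lt; rewrite cJ|by apply: subset_trans sJ; apply: subsetDl].
have xc : x \in core M (ground M :\: (J :\ x)).
  by apply: subsetP (h x xI); apply: core_mono; move: sJ; sets.
rewrite (nulD1_core xc) cJ.
have -> : (ground M :\: (J :\ x)) :\ x = ground M :\: J by sets.
lia.
Qed.

(** The inequality that needs a witness: a minimal subset of [Y] whose deletion brings the nullity
    down as far as the deletion of [Y] is coindependent, and its size is the drop. *)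
Lemma rk_dual M Y : Y \subset ground M ->
  rk (mdual M) Y + nul M (ground M :\: Y) = nul M (ground M).
Proof.
move=> sY; set E := ground M.
have le : nul M (E :\: Y) <= nul M E by apply: nulS; apply: subsetDl.
have [J [iJ _ sJ cJ]] := rk_ext (indep0 (mdual M)) (sub0set Y).
have h1 : rk (mdual M) Y + nul M (E :\: Y) <= nul M E.
  rewrite -cJ; move: iJ; rewrite /= coindep_nul => /andP [_ /eqP ->].
  by rewrite addnC leq_add2r; apply: nulS; move: sJ; sets.
apply/eqP; rewrite eqn_leq h1 /=.
pose Q I := nul M (E :\: I) <= nul M (E :\: Y).
have [I /minsetP [QI mI] sI] := @minset_exists _ Q Y (leqnn _).
have cI x : x \in I -> x \in core M (E :\: (I :\ x)).
  move=> xI; rewrite in_core; have xE := subsetP sY x (subsetP sI x xI).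
  rewrite !inE eqxx xE /=; have -> : (E :\: (I :\ x)) :\ x = E :\: I by sets.
  rewrite ltnNge; apply/negP => le2.
  have := mI (I :\ x) (leq_trans le2 QI) (subsetDl _ _).
  by move=> E'; move: xI; rewrite -E' !inE eqxx.
have := nulDI cI (subxx I).
have iI : coindep M I by rewrite coindep_nul (subset_trans sI sY) -(nulDI cI (subxx I)) eqxx.
have := @rk_ub _ (mdual M) Y I iI sI; move: QI; rewrite /Q -/E; nlia.
Qed.

Lemma rk_deletion M X Y : Y \subset ground M :\: X -> rk (deletion M X) Y = rk M Y.
Proof.
move=> s; apply/eqP; rewrite eqn_leq; apply/andP; split.
  have [J [/andP [iJ _] _ sJ <-]] := rk_ext (indep0 (deletion M X)) (sub0set Y).
  exact: rk_ub.
have [J [iJ _ sJ <-]] := rk_ext (indep0 M) (sub0set Y).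
apply: rk_ub => //; apply/andP; split=> //; exact: subset_trans sJ s.
Qed.

Lemma nul_deletion M X Y : nul (deletion M X) Y = nul M (Y :\: X).
Proof.
rewrite -nulI -(nulI M) !nulE ?subsetIr //=.
have -> : Y :&: (ground M :\: X) = (Y :\: X) :&: ground M by sets.
by rewrite rk_deletion //; sets.
Qed.

Lemma contraction_ground M X : ground (contraction M X) = ground M :\: X.
Proof. by []. Qed.

(** Contraction is defined as deletion in the dual; two applications of [rk_dual] translate the dual
    ranks back into nullities of [M]. *)
Lemma contraction_indep M X I : X \subset ground M ->
  indep (contraction M X) I = (I \subset ground M :\: X) && (nul M (X :|: I) == nul M X).
Proof.
move=> sX; rewrite /= coindep_rk /=; case s: (I \subset _) => //=.
have s1 : ground M :\: X \subset ground M := subsetDl _ _.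
have s2 : ground M :\: X :\: I \subset ground M by apply: subset_trans (subsetDl _ _) s1.
rewrite !rk_deletion ?subsetDl //=.
have := rk_dual s1; have := rk_dual s2.
have -> : ground M :\: (ground M :\: X) = X by move: sX; sets.
have sI : is_true (I \subset ground M :\: X) by [].
have -> : ground M :\: (ground M :\: X :\: I) = X :|: I by move: sX sI; clear; sets.
by move=> *; apply/eqP/eqP; lia.
Qed.

Lemma coloopE M e : coloop M e = (e \in ground M) && (e \notin core M (ground M)).
Proof.
have cE : coindep M [set e] = (e \in core M (ground M)).
  rewrite coindep_nul sub1set in_core cards1; case: (e \in ground M) => //=.
  have := nulD1 M (ground M) e; have := nulS M (subsetDl (ground M) [set e]).
  by move=> *; apply/eqP/idP; lia.
rewrite /coloop /loop -cE; apply/minsetP/andP => [[]|[eE nc]].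
  by rewrite /= sub1set => /andP [].
rewrite /= sub1set eE nc; split=> // D /andP [sD nD] sDe.
move: sDe; rewrite subset1 => /orP [/eqP //|/eqP D0].
by rewrite D0 coindep0 in nD.
Qed.

Lemma in_seriesE M e f : in_series M e f =
  [&& e != f, e \in core M (ground M), f \in core M (ground M)
     & f \notin core M (ground M :\ e)].
Proof.
rewrite /in_series /parallel; have [<-//|ne] := eqVneq e f; rewrite /=.
have c1 x : coindep M [set x] = (x \in core M (ground M)).
  have := coloopE M x; rewrite coindep_nul sub1set in_core cards1; case: (x \in ground M) => //= _.
  have := nulD1 M (ground M) x; have := nulS M (subsetDl (ground M) [set x]).
  by move=> *; apply/eqP/idP; lia.
have c2 : e \in core M (ground M) -> f \in core M (ground M) ->
    coindep M [set e; f] = (f \in core M (ground M :\ e)).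
  move=> ec fc; have n1 := nulD1_core ec.
  have eE := subsetP (coreS _ _) e ec; have fE := subsetP (coreS _ _) f fc.
  rewrite coindep_nul cards2 ne subUset !sub1set eE fE in_core !inE (eq_sym f e) ne fE /=.
  have -> : ground M :\: [set e; f] = ground M :\ e :\ f by sets.
  have := nulD1 M (ground M :\ e) f; have := nulS M (subsetDl (ground M :\ e) [set f]).
  by move=> *; apply/eqP/idP; lia.
apply/minsetP/and3P => [[/= /andP [sE nc] mD]|[ec fc nc]].
  have c0 x : x \in [set e; f] -> x \in core M (ground M).
    move=> xef; rewrite -c1; apply: contraT => nx.
    have xE : x \in ground M by apply: (subsetP sE).
    have := mD [set x]; rewrite /= sub1set xE nx sub1set xef => /(_ isT isT) E.
    by have := cards2 e f; rewrite -E cards1 ne.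
  have ec : e \in core M (ground M) by apply: c0; rewrite !inE eqxx.
  have fc : f \in core M (ground M) by apply: c0; rewrite !inE eqxx orbT.
  by split=> //; rewrite -c2.
have eE := subsetP (coreS _ _) e ec; have fE := subsetP (coreS _ _) f fc.
rewrite /= subUset !sub1set eE fE c2 // nc; split=> // D /andP [sD nD] sDef.
apply/eqP; rewrite eqEsubset sDef; apply/subsetP => x xef; apply: contraT => xD.
case/negP: nD; move: xef; rewrite !inE => /orP [] /eqP xE; rewrite xE in xD.
  apply: (@coindepS _ _ _ [set f]); last by rewrite c1.
  apply/subsetP => y yD; have := subsetP sDef y yD; rewrite !inE => /orP [/eqP ye|//].
  by rewrite ye (negbTE xD) in yD.
apply: (@coindepS _ _ _ [set e]); last by rewrite c1.
apply/subsetP => y yD; have := subsetP sDef y yD; rewrite !inE => /orP [//|/eqP ye].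
by rewrite ye (negbTE xD) in yD.
Qed.

Lemma in_core_ground M e : reflect (exists2 C, circuit M C & e \in C) (e \in core M (ground M)).
Proof.
apply: (iffP idP) => [/cyc_circuit [C [cC eC _]]|[C cC eC]]; first by exists C.
by apply: (subsetP (circuit_core cC (cyc_ground (circuit_cyc cC)))).
Qed.

Lemma coloopP M e : e \in ground M -> reflect (exists2 C, circuit M C & e \in C) (~~ coloop M e).
Proof. by move=> eE; rewrite coloopE eE negbK; apply: in_core_ground. Qed.

(** The dual definition directly yields that circuits through [f] contain [e]. For the converse, a
    circuit through [e] but not [f], eliminated against one through [f], would leave a circuit
    through [f] without [e]. *)
Lemma in_seriesP M e f : reflect
  [/\ e != f, exists2 C, circuit M C & e \in C
     & forall C, circuit M C -> (e \in C) = (f \in C)] (in_series M e f).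
Proof.
have sub C : circuit M C -> C \subset ground M by move/circuit_cyc/cyc_ground.
rewrite in_seriesE; apply: (iffP and4P) => [[ne ec fc nc]|[ne [C cC eC] h]].
  have imp C : circuit M C -> f \in C -> e \in C.
    move=> cC fC; apply: contraT => eC; case/negP: nc.
    by apply: (subsetP (circuit_core cC _)) => //; rewrite subsetD1 sub.
  split=> //; first exact/in_core_ground.
  move=> C cC; apply/idP/idP; last exact: imp.
  move=> eC; apply: contraT => fC; case/in_core_ground: fc => D cD fD.
  have [C' [cC' fC' eC' _]] := circuit_elim cD cC (imp D cD fD) eC fD fC.
  by rewrite (imp _ cC' fC') in eC'.
split=> //; [by apply/in_core_ground; exists C | by apply/in_core_ground; exists C; rewrite -?h |].
apply/negP => /cyc_circuit [D [cD fD sD]]; rewrite -h // in fD.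
by have := subsetP sD e fD; rewrite !inE eqxx.
Qed.

Lemma deletion_circuit M X C : circuit (deletion M X) C = circuit M C && [disjoint C & X].
Proof.
have cycD Y : Y \subset ground M :\: X -> cyc (deletion M X) Y = cyc M Y.
  move=> s; have e Z : Z \subset Y -> nul (deletion M X) Z = nul M Z.
    by move=> sZ; rewrite nul_deletion; congr nul; move: sZ s; sets.
  by apply/cycP/cycP => h x xY; have := h x xY; rewrite !e ?subsetDl.
have nD Y : Y \subset ground M :\: X -> nul (deletion M X) Y = nul M Y.
  by move=> s; rewrite nul_deletion; congr nul; move: s; sets.
apply/circuitP/andP => [[cC nC]|[cC d]].
  have s : C \subset ground M :\: X := cyc_ground cC.
  by split; [apply/circuitP; rewrite -cycD // -nD | move: s; sets].
have s : C \subset ground M :\: X by have := cyc_ground (circuit_cyc cC); move: d; sets.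
by have /circuitP [] := cC; rewrite cycD // nD.
Qed.

End Dual.

(** * Matroids without digons *)

Section Ears.
Variables (T : finType) (M : matroid T) (h : rel T).
Hypothesis hM : ordered M h.
Hypothesis conn : mconnected M.
Implicit Types (L X Y C D B S Q V Z R : {set T}) (x y z a b c d e f q v : T).
Local Notation cl := (cls M).

Lemma quad_ear L e : quad M L -> e \in ground M -> e \notin L ->
  exists V, [/\ ear M L V, ~ circuit M V & e \in V].
Proof.
move=> qL eE eL; have [q qinL] := quad_n0 qL; have [cL nL] := proj1 qL.
have qE := subsetP (cyc_ground cL) q qinL.
have [E|[C0 [c0 e0 q0]]] := conn eE qE; first by rewrite E qinL in eL.
have m0 : ~~ [disjoint C0 & L] by apply/pred0Pn; exists q; rewrite /= q0.
have [C [cC eC mC _ nC]] := ear_through cL c0 e0 eL m0.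
have nCL : ~~ (C \subset L) by apply/subsetPn; exists e.
have [eV ncV] : ear M L (C :\: L) /\ ~ circuit M (C :\: L).
  by apply: ear_circuit_diff => //; rewrite nL in nC.
by exists (C :\: L); rewrite inE eL eC.
Qed.

End Ears.

Section NoDigon.
Variables (T : finType) (M : matroid T) (h : rel T).
Hypothesis hM : ordered M h.
Hypothesis conn : mconnected M.
Hypothesis nd : forall L Q Z, ~ digon M L Q Z.
Variable L0 : {set T}.
Hypothesis q0 : quad M L0.
Implicit Types (L X Y C D B S Q V Z R : {set T}) (x y z a b c d e f q v : T).
Local Notation cl := (cls M).
Local Notation E := (ground M).
Local Notation P := (cls M (ground M)).

Lemma ground_cyc : cyc M E.
Proof.
apply/eqP/setP => e; apply/idP/idP => [|eE]; first exact: (subsetP (coreS _ _)).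
have [q qL] := quad_n0 q0; have [cL _] := proj1 q0.
have sub C : circuit M C -> e \in C -> e \in core M E.
  by move=> cC eC; apply: (subsetP (circuit_core cC (cyc_ground (circuit_cyc cC)))).
have qE := subsetP (cyc_ground cL) q qL.
case: (conn eE qE) => [->|[C [cC eC _]]]; last exact: sub eC.
by apply: (subsetP (cyc_core cL (cyc_ground cL))).
Qed.

(** Without digons no circuit of [M] splits a class of a quad, so such a class does not depend on
    the quad. *)
Lemma quad_cls L x : quad M L -> x \in L -> P x = cl L x.
Proof.
move=> qL xL; have [cL _] := proj1 qL; have sL := cyc_ground cL.
have xE := subsetP sL x xL.
apply/setP => y; apply/idP/idP => yx.
  have sub C : circuit M C -> C \subset L -> (y \in C) = (x \in C).
    move=> cC sC; apply: (cls_circuit ground_cyc cC) => //; exact: subset_trans sC sL.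
  have yL : y \in L.
    have xc : x \in core M L by rewrite (eqP cL).
    have [C [cC xC sC]] := cyc_circuit xc.
    by apply: (subsetP sC); rewrite sub.
  have := sub _ (line_circuit (proj1 qL) xL) (subsetDl _ _).
  by rewrite !inE xL yL cls_refl // andbT => /negbFE.
have yL := subsetP (cls_sub M L x) y yx.
rewrite in_cls (subsetP sL y yL) /=; apply/negP => /cyc_circuit [C [cC yC sC]].
have /negP := class_unsplit hM C nd qL xL; apply; apply/splitsP; split=> //.
exists y, x; split=> //; first exact: cls_refl.
by apply/negP => /(subsetP sC); rewrite !inE eqxx.
Qed.

(** Without digons every ear that is not a circuit is a new class, and it can take the place of any
    chosen class of [L]. *)
Lemma quad_extend L e x : quad M L -> e \in E -> e \notin L -> x \in L ->
  exists L', [/\ quad M L', e \in L' & L :\: P x \subset L'].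
Proof.
move=> qL eE eL xL; have [V [eV ncV inV]] := quad_ear conn qL eE eL.
have [[q2 [_ _ dg]]|nw] := ear_types hM eV ncV; first by case: (nd dg).
have [qq Ex] := nw x xL; exists (core M ((L :|: V) :\ x)); split=> //.
  rewrite cls_core Ex inE inE inV orbT andbT; apply: contra eL; exact: (subsetP (cls_sub _ _ _)).
by rewrite cls_core Ex (quad_cls qL xL) setSD // subsetUl.
Qed.

(** At most two elements have to be kept, so a quad has a class containing neither of them, and this
    class is given up for the ear through [e]. *)
Lemma quad_through (s : seq T) e : size s < 3 -> {subset s <= E} -> e \in E ->
  (forall L, quad M L -> exists L', quad M L' /\ {subset s <= L'}) ->
  exists L, [/\ quad M L, e \in L & {subset s <= L}].
Proof.
move=> s3 sE eE IH; have [L [qL sL]] := IH _ q0.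
have [eL|eL] := boolP (e \in L); first by exists L.
have [|//|x [xL nx]] := @other_class _ _ L s (proj1 qL).
  by apply: leq_trans (proj2 qL); apply: leq_trans s3 _.
have [L' [q' e' s']] := quad_extend qL eE eL xL; exists L'; split=> // y ys.
apply: (subsetP s'); rewrite inE sL // andbT (quad_cls qL xL).
by rewrite -(cls_sym (proj1 (proj1 qL)) (sL y ys) xL) nx.
Qed.

Lemma quad3 a b c : a \in E -> b \in E -> c \in E ->
  exists L, [/\ quad M L, a \in L, b \in L & c \in L].
Proof.
move=> aE bE cE.
have s1 L : quad M L -> exists L', quad M L' /\ {subset [:: a] <= L'}.
  move=> qL; have [||L' [q' a' _]] := @quad_through [::] a isT _ aE; rewrite //.
    by move=> L1 q1; exists L1.
  by exists L'; split=> // y; rewrite inE => /eqP ->.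
have s2 L : quad M L -> exists L', quad M L' /\ {subset [:: a; b] <= L'}.
  move=> qL; have [|L' [q' b' s']] := @quad_through [:: a] b isT _ bE s1.
  - by move=> y; rewrite inE => /eqP ->.
  - exists L'; split=> // y; rewrite !inE => /orP [] /eqP -> //.
    by apply: s'; rewrite inE.
have [|L' [q' c' s']] := @quad_through [:: a; b] c isT _ cE s2.
- by move=> y; rewrite !inE => /orP [] /eqP ->.
- by exists L'; split=> //; apply: s'; rewrite !inE eqxx ?orbT.
Qed.

Lemma class_size a b : a \in E -> b \in E -> #|P a| = #|P b|.
Proof.
move=> aE bE; have [L [qL aL bL _]] := quad3 aE bE bE.
by rewrite !(quad_cls qL) //; apply: (quad_size hM qL).
Qed.

Lemma triple_circuit a b c : a \in E -> b \in E -> c \in E ->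
  b \notin P a -> c \notin P a -> c \notin P b -> circuit M (P a :|: P b :|: P c).
Proof.
move=> aE bE cE; have [L [qL aL bL cL]] := quad3 aE bE cE.
have clL := proj1 (proj1 qL).
rewrite !(quad_cls qL) // => ba ca cb.
have [|y|d [dL nd']] := @other_class _ _ L [:: a; b; c] (proj1 qL).
- exact: leq_trans (proj2 qL).
- by rewrite !inE => /or3P [] /eqP ->.
have da : d \notin cl L a by apply: nd'; rewrite !inE eqxx ?orbT.
have db : d \notin cl L b by apply: nd'; rewrite !inE eqxx ?orbT.
have dc : d \notin cl L c by apply: nd'; rewrite !inE eqxx ?orbT.
have EL := quad_cover hM qL aL (And3 bL cL dL) (And3 ba ca da) (And3 cb db dc).
suff -> : cl L a :|: cl L b :|: cl L c = L :\: cl L d by apply: line_circuit; case: qL.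
rewrite {4}EL; have := cls_disj clL aL dL da; have := cls_disj clL bL dL db.
have := cls_disj clL cL dL dc; sets.
Qed.

(** A circuit is a union of classes. Any two of its classes lie in a common quad, so it needs a
    third, and three classes already form a circuit. *)
Lemma circuit_triple C : circuit M C -> exists a b c,
  [/\ [/\ a \in E, b \in E & c \in E], [/\ b \notin P a, c \notin P a & c \notin P b]
    & C = P a :|: P b :|: P c].
Proof.
move=> cC; have sE := cyc_ground (circuit_cyc cC).
have un x y : x \in E -> y \in P x -> (y \in C) = (x \in C).
  by move=> xE yx; apply: (cls_circuit ground_cyc cC).
have two a b : a \in C -> b \in C -> exists2 c, c \in C & c \notin P a :|: P b.
  move=> aC bC; apply/subsetPn; apply/negP => s.
  have aE := subsetP sE a aC; have bE := subsetP sE b bC.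
  have [L [qL aL bL _]] := quad3 aE bE bE.
  rewrite !(quad_cls qL) // in s.
  apply: (quad_two_classes qL cC _ aL bL s).
  by apply: subset_trans s _; rewrite subUset !cls_sub.
have [a aC] := circuit_n0 cC; have [b bC nb] := two a a aC aC.
have [c cC' nc] := two a b aC bC.
rewrite setUid in nb; move: nc; rewrite inE negb_or => /andP [nca ncb].
have aE := subsetP sE a aC; have bE := subsetP sE b bC; have cE := subsetP sE c cC'.
exists a, b, c; split=> //; apply/esym; apply: (circuit_eq (triple_circuit aE bE cE nb nca ncb) cC).
by rewrite !subUset -!andbA; apply/and3P; split; apply/subsetP => y yP;
  rewrite (un _ _ _ yP).
Qed.

Lemma cls_memE x y : x \in E -> y \in E -> (y \in P x) = (P y == P x).
Proof.
move=> xE yE; apply/idP/eqP => [|<-]; [exact: (cls_eq ground_cyc) | exact: cls_refl].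
Qed.

(** As circuits are exactly the unions of three classes, contracting all but one element [r i] of
    each class leaves [uniform 2 n]. The classes have a common size k; k = 1 is separate because a
    balanced series extension has k > 1. *)
Lemma no_digon_obtainable : exists n, 4 <= n /\ obtainable n M.
Proof.
pose F := P @: E; pose n := #|F|.
have clE : cyc M E := ground_cyc.
have sL0 : L0 \subset E := cyc_ground (proj1 (proj1 q0)).
have n4 : 4 <= n.
  apply: leq_trans (proj2 q0) _; apply: subset_leq_card; apply/subsetP => X /imsetP [x xL ->].
  by rewrite -(quad_cls q0 xL); apply: imset_f; apply: (subsetP sL0).
exists n; split=> //.
pose S (i : 'I_n) : {set T} := enum_val i.
have SE i : exists x, (x \in E) && (S i == P x).
  by have /imsetP [x xE e] := enum_valP i; exists x; rewrite xE /S e eqxx.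
pose r i : T := xchoose (SE i).
have rE i : r i \in E by case/andP: (xchooseP (SE i)).
have rS i : S i = P (r i) by case/andP: (xchooseP (SE i)) => _ /eqP.
have S_inj : injective S by apply: enum_val_inj.
have idx x : x \in E -> exists i, P x = S i.
  move=> xE; have xF : P x \in F by apply: imset_f.
  by exists (enum_rank_in xF (P x)); rewrite /S enum_rankK_in.
have rr i j : (r j \in P (r i)) = (j == i).
  by rewrite cls_memE // -!rS (inj_eq S_inj).
have r_inj : injective r by move=> i j e; apply/eqP; rewrite -rr e cls_refl.
have dS i j : i != j -> [disjoint S i & S j].
  by move=> ij; rewrite !rS; apply: cls_disj => //; rewrite rr eq_sym.
have [x0 x0L] := quad_n0 q0; have x0E := subsetP sL0 x0 x0L.
pose k := #|P x0|.
have kS i : #|S i| = k by rewrite rS; apply: class_size.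
have ES : E = \bigcup_i S i.
  apply/setP => x; apply/idP/bigcupP => [xE|[i _]].
    by have [i e] := idx x xE; exists i => //; rewrite -e cls_refl.
  by rewrite rS => /(subsetP (cls_sub _ _ _)).
pose X := E :\: r @: [set: 'I_n].
have circ3 (Y : {set 'I_n}) C : circuit M C -> C \subset X :|: r @: Y -> 2 < #|Y|.
  move=> cC sC; have [a [b [c [[aE bE cE] [ba ca cb] EC]]]] := circuit_triple cC.
  have [i ei] := idx a aE; have [j ej] := idx b bE; have [l el] := idx c cE.
  have inY m : S m \subset C -> m \in Y.
    move=> s; have rC : r m \in C by apply: (subsetP s); rewrite rS cls_refl.
    have := subsetP sC _ rC; rewrite !inE imset_f ?inE //= => /imsetP [m' m'Y e].
    by rewrite (r_inj _ _ e).
  have iY : i \in Y by apply: inY; rewrite -ei EC -setUA subsetUl.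
  have jY : j \in Y by apply: inY; rewrite -ej EC -setUA setUCA subsetUl.
  have lY : l \in Y by apply: inY; rewrite -el EC subsetUr.
  have ij : i != j by apply: contraNneq ba => e; rewrite cls_memE // ei ej e.
  have il : i != l by apply: contraNneq ca => e; rewrite cls_memE // ei el e.
  have jl : j != l by apply: contraNneq cb => e; rewrite cls_memE // ej el e.
  have <- : #|[set i; j; l]| = 3 by rewrite -setUA cardsU1 cards2 !inE negb_or ij il jl.
  by apply: subset_leq_card; rewrite !subUset !sub1set iY jY lY.
have nulX (Y : {set 'I_n}) : (nul M (X :|: r @: Y) == 0) = (#|Y| <= 2).
  rewrite leqNgt; apply/eqP/negP => [n0 gt2|le2].
    have /card_gt2P [i [j [l [[iY jY lY] [ij jl li]]]]] := gt2.
    have cC : circuit M (S i :|: S j :|: S l).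
      by rewrite !rS; apply: triple_circuit => //; rewrite rr // eq_sym.
    have := circuit_nul1 cC; have : S i :|: S j :|: S l \subset X :|: r @: Y.
      have sub m : m \in Y -> S m \subset X :|: r @: Y.
        move=> mY; apply/subsetP => x xS; rewrite !inE.
        have xE : x \in E by move: xS; rewrite rS => /(subsetP (cls_sub _ _ _)).
        rewrite xE andbT; case: (boolP (x \in r @: setT)) => //= /imsetP [m' _ e].
        by move: xS; rewrite e rS rr => /eqP ->; rewrite imset_f.
      by rewrite !subUset !sub.
    by move/(nulS M); rewrite n0 => h1 h2; rewrite h2 in h1.
  by apply: nul_circuit_sub => C cC; apply/negP => /(circ3 _ _ cC) /le2.
have iso : matroid_iso r (uniform 2 n) (contraction M X).
  have EX : E :\: X = r @: [set: 'I_n].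
    rewrite /X setDDr setDv set0U; apply/setIidPr; apply/subsetP => x /imsetP [i _ ->]; exact: rE.
  split; first by move=> i j _ _; apply: r_inj.
    by rewrite contraction_ground EX.
  move=> Y _; rewrite contraction_indep ?subsetDl // EX imsetS ?subsetT //=.
  have nX : nul M X = 0.
    by have := nulX set0; rewrite imset0 setU0 cards0 => /eqP.
  by rewrite nX nulX.
have [k1|k1] := ltnP 1 k.
  apply: obtainable_series (obtainable_uniform n) _; split.
    move=> i; apply/coloopP; first by rewrite inE.
    have [a [b [ia ib ab]]] : exists a b : 'I_n, [/\ i != a, i != b & a != b].
      pose o m (lt : m < 4) : 'I_n := Ordinal (leq_trans lt n4).
      have [e0|e0] := eqVneq i (o 0 isT); first by exists (o 1 isT), (o 2 isT); rewrite e0.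
      have [e1|e1] := eqVneq i (o 1 isT); first by exists (o 0 isT), (o 2 isT); rewrite e1.
      by exists (o 0 isT), (o 1 isT).
    have c3 : #|[set i; a; b]| = 3.
      by rewrite -setUA cardsU1 cards2 !inE negb_or ia ib ab.
    exists [set i; a; b]; last by rewrite !inE eqxx.
    apply/minsetP; rewrite /= subsetT /= /uniform_indep c3; split=> // D.
    rewrite subsetT /= /uniform_indep -ltnNge => D3 sD; apply/eqP; rewrite eqEcard sD c3; exact: D3.
  exists k, S; split=> //.
  - by rewrite ES; apply: eq_bigl => i; rewrite inE.
  - by move=> i j _ _; apply: dS.
  - move=> i _; split=> // x y xS yS xy; apply/in_seriesP; rewrite rS in xS yS.
    have xE := subsetP (cls_sub _ _ _) x xS; have yE := subsetP (cls_sub _ _ _) y yS.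
    split=> // [|C cC].
      by apply/in_core_ground; rewrite (eqP clE).
    have sC := cyc_ground (circuit_cyc cC).
    by rewrite (cls_circuit clE cC sC (rE i) xS) (cls_circuit clE cC sC (rE i) yS).
  - exists r; first by move=> i _; rewrite rS cls_refl.
    exact: iso.
have k1' : k = 1.
  by apply/eqP; rewrite eqn_leq k1 /= card_gt0; apply/set0Pn; exists x0; apply: cls_refl.
apply: obtainable_iso (obtainable_uniform n) _; exists r.
have X0 : X = set0.
  apply/eqP; rewrite setD_eq0; apply/subsetP => x xE; have [i e] := idx x xE.
  have /eqP /cards1P [y Ey] : #|P x| = 1 by rewrite e kS.
  have := cls_refl M xE; have : r i \in P x by rewrite e rS cls_refl.
  by rewrite Ey !inE => /eqP <- /eqP ->; rewrite imset_f.
have [i1 i2 i3] := iso; split=> //.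
  by rewrite i2 contraction_ground X0 setD0.
move=> Y sY; rewrite i3 // contraction_indep ?subsetDl // X0 set0U nul0 setD0.
by rewrite -indep_nul.
Qed.

End NoDigon.

(** * Isomorphisms and theta matroids *)

Section Iso.
Variables (T1 T2 : finType) (f : T1 -> T2) (M1 : matroid T1) (M2 : matroid T2).
Hypothesis iso : matroid_iso f M1 M2.
Implicit Types (X C I : {set T1}) (Y D : {set T2}).

Lemma iso_inj : {in ground M1 &, injective f}.
Proof. by case: iso. Qed.

Lemma iso_imset_sub X C : X \subset ground M1 -> C \subset ground M1 ->
  (f @: X \subset f @: C) = (X \subset C).
Proof.
move=> sX sC; apply/idP/idP => [s|]; last exact: imsetS.
apply/subsetP => x xX; have : f x \in f @: C by apply: (subsetP s); apply: imset_f.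
case/imsetP => y yC E; rewrite (iso_inj _ _ E) //.
  exact: (subsetP sX).
exact: (subsetP sC).
Qed.

Lemma iso_preim Y : Y \subset ground M2 -> exists2 X : {set T1}, X \subset ground M1 & Y = f @: X.
Proof.
have [_ <- _] := iso => sY; exists (ground M1 :&: f @^-1: Y); first exact: subsetIl.
apply/setP => y; apply/idP/imsetP => [yY|[x]]; last by rewrite !inE => /andP [_ xY] ->.
have /imsetP [x xE E] := subsetP sY y yY; exists x => //.
by rewrite !inE xE -E.
Qed.

Lemma iso_circuit_imset C : circuit M1 C -> circuit M2 (f @: C).
Proof.
have [_ E i] := iso; case/minsetP => /andP [sC nC] mC; apply/minsetP; split.
  by rewrite -E imsetS // -i.
move=> D /andP [sD nD] sDC; have [X sX ED] := iso_preim sD.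
rewrite ED in nD sDC *; rewrite iso_imset_sub // in sDC.
by rewrite (mC X) // sX i.
Qed.

Lemma iso_circuit D : circuit M2 D <-> exists2 C, circuit M1 C & D = f @: C.
Proof.
split=> [|[C cC ->]]; last exact: iso_circuit_imset.
have [_ E i] := iso; case/minsetP => /andP [sD nD] mD; have [X sX ED] := iso_preim sD.
exists X => //; apply/minsetP; split; first by rewrite sX i // -ED.
move=> C /andP [sC nC] sCX.
have := mD (f @: C); rewrite -E imsetS // -i // nC => /(_ isT).
rewrite ED iso_imset_sub // => /(_ sCX) EC; apply/eqP.
by rewrite eqEsubset sCX -(iso_imset_sub sX sC) EC subxx.
Qed.

End Iso.

Lemma iso_sym (T1 T2 : finType) (f : T1 -> T2) (g : T2 -> T1) M1 M2 :
  matroid_iso f M1 M2 -> {in ground M1, cancel f g} -> matroid_iso g M2 M1.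
Proof.
move=> iso fK; have [inj E i] := iso.
have gi (X : {set T1}) : X \subset ground M1 -> g @: (f @: X) = X.
  move=> sX; rewrite -imset_comp -[RHS]imset_id; apply: eq_in_imset => x xX /=.
  by rewrite fK // (subsetP sX).
split.
- rewrite -E => _ _ /imsetP [x xE ->] /imsetP [y yE ->].
  by rewrite !fK // => ->.
- by rewrite -E gi.
- move=> Y sY; have [X sX ->] := iso_preim iso sY.
  by rewrite gi // i.
Qed.

Section Relabel.
Variables (T1 T2 : finType) (f : T1 -> T2) (M : matroid T1).
Hypothesis f_inj : {in ground M &, injective f}.

Definition relabel_indep (J : {set T2}) : bool :=
  [exists I : {set T1}, indep M I && (J == f @: I)].

Lemma relabel_indepP (J : {set T2}) : reflect (exists2 I, indep M I & J = f @: I) (relabel_indep J).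
Proof.
by apply: (iffP existsP) => [[I /andP [iI /eqP]]|[I iI ->]]; exists I; rewrite ?iI ?eqxx.
Qed.

Lemma relabel_ground (J : {set T2}) : relabel_indep J -> J \subset f @: ground M.
Proof. by case/relabel_indepP => I iI ->; apply: imsetS; apply: indep_ground. Qed.

Lemma relabel0 : relabel_indep set0.
Proof. by apply/relabel_indepP; exists set0; rewrite ?imset0 ?indep0. Qed.

Lemma relabelS (I J : {set T2}) : I \subset J -> relabel_indep J -> relabel_indep I.
Proof.
move=> s /relabel_indepP [J' iJ EJ]; apply/relabel_indepP.
exists (J' :&: f @^-1: I); first by apply: indepS iJ; apply: subsetIl.
apply/setP => y; apply/idP/imsetP => [yI|[x]]; last by rewrite !inE => /andP [_ xY] ->.
have := subsetP s y yI; rewrite EJ => /imsetP [x xJ E]; exists x => //.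
by rewrite !inE xJ -E.
Qed.

Lemma relabel_aug (I J : {set T2}) : relabel_indep I -> relabel_indep J -> #|I| < #|J| ->
  exists2 e, e \in J :\: I & relabel_indep (e |: I).
Proof.
move=> /relabel_indepP [I' iI ->] /relabel_indepP [J' iJ ->].
have sI := indep_ground iI; have sJ := indep_ground iJ.
have inj (X : {set T1}) : X \subset ground M -> {in X &, injective f}.
  by move=> sX x y xX yX; apply: f_inj; apply: (subsetP sX).
rewrite !card_in_imset; [|exact: inj|exact: inj].
case/(indep_aug iI iJ) => e; rewrite inE => /andP [eI eJ] ie.
exists (f e).
  rewrite inE (imset_f f eJ) andbT; apply: contra eI => /imsetP [x xI E].
  have -> // : e = x by apply: f_inj E; [exact: (subsetP sJ) | exact: (subsetP sI)].
by apply/relabel_indepP; exists (e |: I') => //; rewrite imsetU1.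
Qed.

Definition relabel : matroid T2 := Matroid relabel_ground relabel0 relabelS relabel_aug.

Lemma relabel_iso : matroid_iso f M relabel.
Proof.
split=> // X sX; apply/idP/relabel_indepP => [iX|[I iI E]]; first by exists X.
suff -> : X = I by [].
have sI := indep_ground iI.
have sub (Y Z : {set T1}) : Y \subset ground M -> Z \subset ground M -> f @: Y = f @: Z -> Y \subset Z.
  move=> sY sZ EYZ; apply/subsetP => y yY.
  have := imset_f f yY; rewrite EYZ => /imsetP [z zZ e].
  have -> // : y = z by apply: f_inj e; [exact: (subsetP sY) | exact: (subsetP sZ)].
by apply/eqP; rewrite eqEsubset; apply/andP; split; apply: sub.
Qed.

End Relabel.

(** * Matroids whose circuits are the unions of two blocks *)

Section Theta.
Variables (T : finType) (F : {set {set T}}).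
Hypothesis trivF : trivIset F.
Hypothesis F0 : set0 \notin F.
Implicit Types (I J X Y C : {set T}).

Definition full I := [set X in F | X \subset I].

(** For three blocks these are the forests of a theta graph with the blocks as branches: a cycle
    fills two branches. *)
Definition theta_indep I := (I \subset cover F) && (#|full I| <= 1).

Lemma fullS I J : I \subset J -> full I \subset full J.
Proof.
move=> s; apply/subsetP => X; rewrite !inE => /andP [-> sX] /=; exact: subset_trans sX s.
Qed.

Lemma theta_ground I : theta_indep I -> I \subset cover F.
Proof. by case/andP. Qed.

Lemma theta0 : theta_indep set0.
Proof.
rewrite /theta_indep sub0set; suff -> : full set0 = set0 by rewrite cards0.
apply/setP => X; rewrite !inE subset0; apply/andP => -[XF /eqP X0].
by move: F0; rewrite -X0 XF.
Qed.

Lemma thetaS I J : I \subset J -> theta_indep J -> theta_indep I.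
Proof.
move=> s /andP [sJ fJ]; rewrite /theta_indep (subset_trans s sJ).
exact: leq_trans (subset_leq_card (fullS s)) fJ.
Qed.

(* If no element of [J :\: I] can be added to [I], each of them completes its own class; all of
   these classes and the one already full in [I] but one must then lose an element in [J]. *)
Lemma theta_aug I J : theta_indep I -> theta_indep J -> #|I| < #|J| ->
  exists2 e, e \in J :\: I & theta_indep (e |: I).
Proof.
move=> iI iJ lt; have [/andP [sI fI] /andP [sJ fJ]] := (iI, iJ).
have [/existsP [e /andP [eJ ie]]|none] := boolP [exists e, (e \in J :\: I) && theta_indep (e |: I)].
  by exists e.
have new e : e \in J :\: I -> [/\ pblock F e \in F, e \in pblock F e,
    pblock F e :\ e \subset I & 0 < #|full I|].
  rewrite inE => /andP [eI eJ]; have ec := subsetP sJ e eJ.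
  have be : pblock F e \in F by apply: pblock_mem.
  have ee : e \in pblock F e by rewrite mem_pblock.
  have nfull : 1 < #|full (e |: I)|.
    rewrite ltnNge; apply/negP => le1; case/existsP: none; exists e.
    by rewrite inE eI eJ /theta_indep subUset sub1set ec sI le1.
  have sub : full (e |: I) \subset pblock F e |: full I.
    apply/subsetP => X; rewrite !inE => /andP [XF sX].
    have [eX|eX] := boolP (e \in X); first by rewrite (def_pblock trivF XF eX) eqxx.
    rewrite XF /=; apply/orP; right; apply/subsetP => y yX.
    have := subsetP sX y yX; rewrite !inE => /orP [/eqP ye|//].
    by rewrite -ye yX in eX.
  have h := leq_trans nfull (subset_leq_card sub).
  have c := cardsU1 (pblock F e) (full I).
  split=> //; last by move: h (leq_b1 (pblock F e \notin full I)); rewrite c; clear; move: (nat_of_bool _) #|_|; lia.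
  have [pI|nI] := boolP (pblock F e \in full (e |: I)); last first.
    have : full (e |: I) \subset full I.
      apply/subsetP => X Xf; have := subsetP sub X Xf; rewrite in_setU1 => /orP [/eqP Xe|//].
      by rewrite -Xe Xf in nI.
    by move/subset_leq_card; move: nfull fI; nlia.
  by move: pI; rewrite inE => /andP [_]; clear; sets.
have [e0 e0J] : exists e, e \in J :\: I.
  apply/set0Pn; rewrite setD_eq0; apply/negP => /subset_leq_card; nlia.
have [_ _ _ /card_gt0P [Y Yf]] := new e0 e0J.
pose K := Y |: [set pblock F e | e in J :\: I].
have YF : Y \in F by move: Yf; rewrite inE => /andP [].
have sY : Y \subset I by move: Yf; rewrite inE => /andP [].
have pinj : {in J :\: I &, injective (pblock F)}.
  move=> a b aJ bJ E; have [_ _ sa _] := new a aJ; have [_ bb _ _] := new b bJ.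
  apply/eqP; apply: contraT => ab; move: (bJ); rewrite inE => /andP [bI _].
  by rewrite (subsetP sa) // in bI; rewrite !inE eq_sym ab E.
have YK : Y \notin [set pblock F e | e in J :\: I].
  apply/imsetP => -[e eJ EY]; have [_ ee _ _] := new e eJ.
  by move: eJ; rewrite inE (subsetP sY) // EY.
have cK : #|K| = #|J :\: I|.+1 by rewrite cardsU1 YK card_in_imset.
have KF X : X \in K -> X \in F.
  by rewrite in_setU1 => /orP [/eqP -> //|/imsetP [e /new [] ? _ _ _ ->]].
have sub : K :\: full J \subset pblock F @: (I :\: J).
  apply/subsetP => X; rewrite in_setD => /andP [nX XK]; have XF := KF X XK.
  have /subsetPn [y yX yJ] : ~~ (X \subset J) by move: nX; rewrite inE XF.
  apply/imsetP; exists y; last by rewrite (def_pblock trivF XF yX).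
  rewrite inE yJ /=; move: XK; rewrite in_setU1 => /orP [/eqP XY|/imsetP [e eJ EX]].
    by apply: (subsetP sY); rewrite -XY.
  have [_ _ se _] := new e eJ; apply: (subsetP se); rewrite !inE -EX yX andbT.
  by apply: contraNneq yJ => ->; move: eJ; rewrite inE => /andP [].
have h1 := leq_trans (subset_leq_card sub) (leq_imset_card _ _).
have h2 := cardsID (full J) K; have h3 : #|K :&: full J| <= #|full J| by apply: subset_leq_card; apply: subsetIr.
have h4 := cardsID J I; have h5 := cardsID I J; rewrite setIC in h5.
nlia.
Qed.

Definition theta_matroid : matroid T := Matroid theta_ground theta0 thetaS theta_aug.

Lemma full_mem X I : (X \in full I) = (X \in F) && (X \subset I).
Proof. by rewrite inE. Qed.

Lemma theta_circuit C : circuit theta_matroid C <->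
  exists X Y, [/\ X \in F, Y \in F, X != Y & C = X :|: Y].
Proof.
have cov X : X \in F -> X \subset cover F by move=> XF; apply: bigcup_sup.
have dep X Y : X \in F -> Y \in F -> X != Y -> ~~ theta_indep (X :|: Y).
  move=> XF YF ne; rewrite /theta_indep subUset !cov //= -ltnNge.
  have <- : #|[set X; Y]| = 2 by rewrite cards2 ne.
  apply: subset_leq_card; apply/subsetP => Z.
  by rewrite !inE => /orP [] /eqP ->; rewrite ?XF ?YF ?subsetUl ?subsetUr.
have two I : I \subset cover F -> ~~ theta_indep I ->
    exists X Y, [/\ X \in F, Y \in F, X != Y & X :|: Y \subset I].
  move=> sI; rewrite /theta_indep sI /= -ltnNge => /card_gt1P [X [Y [Xf Yf ne]]].
  move: Xf Yf; rewrite !full_mem => /andP [XF sX] /andP [YF sY].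
  by exists X, Y; rewrite subUset sX sY.
split=> [/minsetP [/andP [sC nC] mC]|[X [Y [XF YF ne ->]]]].
  have [X [Y [XF YF ne s]]] := two C sC nC; exists X, Y; split=> //.
  by apply/esym/mC => //; rewrite /= subUset !cov //=; apply: dep.
apply/minsetP; split; first by rewrite /= subUset !cov //=; apply: dep.
move=> D /andP [sD nD] sDXY; have [X' [Y' [X'F Y'F ne' s]]] := two D sD nD.
have sub Z : Z \in F -> Z \subset X :|: Y -> (Z == X) || (Z == Y).
  move=> ZF sZ; apply: contraT; rewrite negb_or => /andP [ZX ZY].
  have d W : W \in F -> Z != W -> [disjoint Z & W] by move=> WF; apply: (trivIsetP trivF).
  have Z0 : Z = set0 by apply/eqP; rewrite -subset0; have := d X XF ZX; have := d Y YF ZY; move: sZ; sets.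
  by move: F0; rewrite -Z0 ZF.
have h1 := sub X' X'F (subset_trans (subsetUl _ _) (subset_trans s sDXY)).
have h2 := sub Y' Y'F (subset_trans (subsetUr _ _) (subset_trans s sDXY)).
apply/eqP; rewrite eqEsubset sDXY; apply: subset_trans s.
case/orP: h1 => /eqP e1; case/orP: h2 => /eqP e2; rewrite e1 e2 // in ne' *.
- by rewrite eqxx in ne'.
- by rewrite setUC.
- by rewrite eqxx in ne'.
Qed.

Hypothesis F2 : 2 < #|F|.

(** Stated for any [N] with these circuits, since it serves both [theta_matroid] and the cycle
    matroid of a given theta graph. Two blocks are told apart by a circuit made of one of them and a
    third. *)
Lemma theta_series_class (N : matroid T) S : ground N = cover F ->
  (forall C, circuit N C <-> exists X Y, [/\ X \in F, Y \in F, X != Y & C = X :|: Y]) ->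
  series_class N S <-> S \in F.
Proof.
move=> gN cN; have cov X : X \in F -> X \subset cover F by move=> XF; apply: bigcup_sup.
have d X Y : X \in F -> Y \in F -> X != Y -> [disjoint X & Y] by apply: (trivIsetP trivF).
have n0 X : X \in F -> exists x, x \in X.
  by move=> XF; apply/set0Pn; apply: contraNneq F0 => <-.
have other X Y : exists2 Z, Z \in F & (Z != X) && (Z != Y).
  have /subsetPn [Z ZF] : ~~ (F \subset [set X; Y]).
    apply/negP => /subset_leq_card le; move: F2; rewrite ltnNge => /negP; apply.
    by apply: leq_trans le _; rewrite cards2; case: (_ != _).
  by rewrite !inE negb_or => ne; exists Z.
have ser x y X : X \in F -> x \in X -> y \in X -> x != y -> in_series N x y.
  move=> XF xX yX xy; apply/in_seriesP; split=> //.
    have [Y YF /andP [YX _]] := other X X.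
    exists (X :|: Y); last by rewrite inE xX.
    by apply/cN; exists X, Y; split=> //; rewrite eq_sym.
  move=> C /cN [Y [Z [YF ZF _ ->]]].
  have mem W : W \in F -> (x \in W) = (y \in W).
    move=> WF; have [->|ne] := eqVneq W X; first by rewrite xX yX.
    by rewrite !(disjointFl (d W X WF XF ne)).
  by rewrite !inE !mem.
have nser x y X : X \in F -> x \in X -> y \notin X -> ~~ in_series N x y.
  move=> XF xX yX; apply/in_seriesP => -[xy [C cC xC] h].
  move/h: (cC); rewrite xC => /esym yC.
  have yc := subsetP (cyc_ground (circuit_cyc cC)) y yC; rewrite gN in yc.
  have YF : pblock F y \in F by apply: pblock_mem.
  have yY : y \in pblock F y by rewrite mem_pblock.
  have [Z ZF /andP [ZX ZY]] := other X (pblock F y).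
  have := h (X :|: Z); rewrite !in_setU xX (negbTE yX) /=.
  rewrite (disjointFl (d Z _ ZF YF ZY) yY) => E.
  suff /E : circuit N (X :|: Z) by [].
  by apply/cN; exists X, Z; split=> //; rewrite eq_sym.
have ncl x : x \in cover F -> ~~ loop (mdual N) x.
  move=> xc; change (~~ coloop N x); have xN : x \in ground N by rewrite gN.
  apply/(coloopP xN); have XF : pblock F x \in F by apply: pblock_mem.
  have [Y YF /andP [YX _]] := other (pblock F x) (pblock F x).
  exists (pblock F x :|: Y); last by rewrite inE mem_pblock xc.
  by apply/cN; exists (pblock F x), Y; split=> //; rewrite eq_sym.
pose ok (X : {set T}) := [&& X \subset ground N, [forall e in X, ~~ loop (mdual N) e]
  & [forall e in X, forall f in X, (e != f) ==> parallel (mdual N) e f]].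
have okF X : X \in F -> ok X.
  move=> XF; apply/and3P; split; first by rewrite gN; apply: cov.
    by apply/forall_inP => e eX; apply: ncl; apply: (subsetP (cov X XF)).
  by apply/forall_inP => e eX; apply/forall_inP => f fX; apply/implyP; apply: ser eX fX.
have sub X Y x : X \in F -> ok Y -> x \in X -> x \in Y -> Y \subset X.
  move=> XF /and3P [_ _ /forall_inP h] xX xY; apply/subsetP => y yY; apply: contraT => nyX.
  have ne : x != y by apply: contraNneq nyX => <-.
  have := h x xY => /forall_inP /(_ y yY); rewrite ne /= => hs.
  by have := nser x y X XF xX nyX; rewrite /in_series hs.
split=> [/maxsetP [okS mS]|SF].
  have [S0|[x xS]] := set_0Vmem S.
    have [Y YF _] := other S S; have [y yY] := n0 Y YF.
    by have := mS Y (okF Y YF); rewrite S0 sub0set => /(_ isT) E; rewrite E inE in yY.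
  have xc : x \in cover F by rewrite -gN; case/and3P: (okS) => s _ _; apply: (subsetP s).
  have XF : pblock F x \in F by apply: pblock_mem.
  have xX : x \in pblock F x by rewrite mem_pblock.
  by rewrite -(mS _ (okF _ XF) (sub _ _ x XF okS xX xS)).
apply/maxsetP; split; first exact: okF.
move=> Y okY sSY; have [x xS] := n0 S SF.
by apply/eqP; rewrite eqEsubset sSY andbT; apply: (sub S Y x) => //; apply: (subsetP sSY).
Qed.

End Theta.

(** * Theta graphs *)

Section Walks.
Variables (V T : finType) (G : graph V T).
Implicit Types (x y z u v : V) (e f : T) (w c : seq (T * V)).

Lemma walk_cat x w w' : walk G x (w ++ w') = walk G x w && walk G (last x (unzip2 w)) w'.
Proof. by elim: w x => //= -[e y] w IH x; rewrite IH !andbA. Qed.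

Fixpoint rev_walk x w : seq (T * V) :=
  if w is (e, y) :: w' then rcons (rev_walk y w') (e, x) else [::].

Lemma rev_walk1 x w : unzip1 (rev_walk x w) = rev (unzip1 w).
Proof. by elim: w x => //= -[e y] w IH x; rewrite /unzip1 map_rcons -/unzip1 IH rev_cons. Qed.

Lemma rev_walk2 x w : unzip2 (rev_walk x w) = rev (belast x (unzip2 w)).
Proof. by elim: w x => //= -[e y] w IH x; rewrite /unzip2 map_rcons -/unzip2 IH rev_cons. Qed.

Lemma rev_walk_last x w : last (last x (unzip2 w)) (unzip2 (rev_walk x w)) = x.
Proof. by case: w => //= -[e y] w; rewrite /unzip2 map_rcons last_rcons. Qed.

Lemma rev_walkP x w : walk G x w -> walk G (last x (unzip2 w)) (rev_walk x w).
Proof.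
elim: w x => //= -[e y] w IH x /= /and3P [eE /eqP ee wk].
rewrite -cats1 walk_cat IH //= rev_walk_last eE ee andbT.
by apply/eqP; rewrite setUC.
Qed.

Lemma walk_nth e0 x w i : walk G x w -> i < size w ->
  nth e0 (unzip1 w) i \in edges G /\
  ends G (nth e0 (unzip1 w) i) = [set nth x (x :: unzip2 w) i; nth x (unzip2 w) i].
Proof.
elim: w x i => //= -[e y] w IH x [|i] /= /and3P [eE /eqP ee wk] //=.
rewrite ltnS => lt; have [h1 h2] := IH y i wk lt; split=> //; rewrite h2.
have lt2 : i < size (unzip2 w) by rewrite size_map.
by congr [set _; _]; [case: i {lt h1 h2} lt2 => //= i lt2; apply: set_nth_default; apply: ltnW | apply: set_nth_default].
Qed.

Lemma walk_edges x w : walk G x w -> {subset unzip1 w <= edges G}.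
Proof.
elim: w x => //= -[e y] w IH x /= /and3P [eE _ wk] f; rewrite inE => /orP [/eqP -> //|].
exact: IH wk f.
Qed.

Section Closed.
Hypothesis noloop : forall e, e \in edges G -> #|ends G e| = 2.
Variables (x : V) (c : seq (T * V)).
Hypothesis cp : closed_path G x c.

Let wk : walk G x c. Proof. by case/and5P: cp. Qed.
Let lx : last x (unzip2 c) = x. Proof. by case/and5P: cp => _ _ /eqP. Qed.
Let u1 : uniq (unzip1 c). Proof. by case/and5P: cp. Qed.
Let u2 : uniq (unzip2 c). Proof. by case/and5P: cp. Qed.
Let c0 : 0 < size c. Proof. by case/and5P: cp; case: c. Qed.

(** The vertices in order of visit, with [q 0] and [q (size c)] both equal to [x], so that edge
    number i joins [q i] and [q i.+1]. *)
Let q i := nth x (x :: unzip2 c) i.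

Let q0k : q 0 = q (size c).
Proof.
rewrite /q /=; have := last_nth x x (unzip2 c); rewrite lx size_map.
by case: (size c) c0.
Qed.

Let qinj i j : 0 < i -> i <= size c -> 0 < j -> j <= size c -> q i = q j -> i = j.
Proof.
case: i j => [|i] [|j] //= _ li _ lj; rewrite /q /= => /eqP.
by rewrite nth_uniq ?size_map // => /eqP ->.
Qed.

Let qends e0 i : i < size c -> ends G (nth e0 (unzip1 c) i) = [set q i; q i.+1].
Proof. by move=> lt; have [_ ->] := walk_nth e0 wk lt. Qed.

Let size2 : 1 < size c.
Proof.
have [e0 _] : exists e, e \in unzip1 c.
  by move: c0; case: (c) => // -[e y] w _; exists e; rewrite inE eqxx.
rewrite ltn_neqAle c0 andbT; apply/eqP => E.
have [eE _] := walk_nth e0 wk c0; have := noloop eE.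
by rewrite (qends e0 c0) q0k -E setUid cards1.
Qed.

Lemma closed_path_next e y : e \in unzip1 c -> y \in ends G e ->
  exists f, [/\ f \in unzip1 c, f != e & y \in ends G f].
Proof.
move=> ec; have := nth_index e ec; set i := index e _ => ei.
have lt : i < size c by rewrite -(size_map fst) index_mem.
rewrite -{1}ei qends // => yq.
suff [j [ltj ji yj]] : exists j, [/\ j < size c, j != i & y \in [set q j; q j.+1]].
  exists (nth e (unzip1 c) j); rewrite mem_nth ?size_map // qends //; split=> //.
  by rewrite -[X in _ != X]ei nth_uniq ?size_map.
move: yq; rewrite !inE => /orP [] /eqP ->.
  case: (i) lt => [|j] lt.
    exists (size c).-1; rewrite !inE q0k prednK // eqxx orbT; split=> //; nlia.
  exists j; rewrite !inE eqxx orbT; split=> //; nlia.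
have [lt1|ge1] := ltnP i.+1 (size c).
  exists i.+1; rewrite !inE eqxx; split=> //; nlia.
have -> : i.+1 = size c by nlia.
by exists 0; rewrite -q0k !inE eqxx; split=> //; move: size2; nlia.
Qed.

(** A vertex visited at position s with 0 < s <= size c only meets the edges s - 1 and s, where edge
    0 follows the last one. *)
Lemma closed_path_deg2 y e f g : e \in unzip1 c -> f \in unzip1 c -> g \in unzip1 c ->
  y \in ends G e -> y \in ends G f -> y \in ends G g -> e != f -> e != g -> f != g -> False.
Proof.
move=> ec fc gc ye yf yg ef eg fg.
have pos a : a \in unzip1 c -> y \in ends G a ->
    exists2 i, i < size c & a = nth e (unzip1 c) i /\ (y = q i \/ y = q i.+1).
  move=> ac; have lt : index a (unzip1 c) < size c by rewrite -(size_map fst) index_mem.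
  rewrite -{1}(nth_index e ac) qends // !inE => h; exists (index a (unzip1 c)) => //.
  by rewrite nth_index //; split=> //; case/orP: h => /eqP; [left|right].
have [i li [Ei yi]] := pos e ec ye; have [j lj [Ej yj]] := pos f fc yf; have [l ll [El yl]] := pos g gc yg.
have ij : i != j by apply: contraNneq ef => E; rewrite Ei E -Ej.
have il : i != l by apply: contraNneq eg => E; rewrite Ei E -El.
have jl : j != l by apply: contraNneq fg => E; rewrite Ej E -El.
have [s [s0 sk ys]] : exists s, [/\ 0 < s, s <= size c & y = q s].
  case: yi => yi; last by exists i.+1.
  case: (i) li yi => [|i'] li yi; last by exists i'.+1; split=> //; apply: ltnW.
  by exists (size c); rewrite -q0k.
have key a : a < size c -> (y = q a \/ y = q a.+1) -> [\/ a.+1 = s, a = s | a = 0 /\ s = size c].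
  move=> la [] ya; last by apply: Or31; apply: qinj => //; rewrite -ya.
  case: (posnP a) => [a0|a0].
    by apply: Or33; split=> //; apply: qinj => //; rewrite -q0k -ys ya a0.
  by apply: Or32; apply: qinj => //; [apply: ltnW | rewrite -ya].
have k1 := key i li yi; have k2 := key j lj yj; have k3 := key l ll yl.
clear - ij il jl s0 sk li lj ll k1 k2 k3.
case: k1 k2 k3 => [?|?|[? ?]] [?|?|[? ?]] [?|?|[? ?]]; nlia.
Qed.

End Closed.
End Walks.

Section ThetaGraph.
Variables (V T : finType) (G : graph V T) (u v : V) (W : 'I_3 -> seq (T * V)).
Implicit Types (i j l : 'I_3) (e f : T) (y : V).
Hypothesis path_W : forall j, graph_path G u v (W j).
Hypothesis uv : u != v.
Hypothesis uniqE : forall j, uniq (unzip1 (W j)).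
Hypothesis disjE : forall i j e, i != j -> e \in unzip1 (W i) -> e \notin unzip1 (W j).
Hypothesis disjV : forall i j y, i != j -> y \in internal u (W i) -> y \notin internal u (W j).
Hypothesis edgesE : forall e, e \in edges G -> exists j, e \in unzip1 (W j).

Let wk j : walk G u (W j). Proof. by case/and3P: (path_W j). Qed.
Let lastv j : last u (unzip2 (W j)) = v. Proof. by case/and3P: (path_W j) => _ /eqP. Qed.
Let uu j : uniq (u :: unzip2 (W j)). Proof. by case/and3P: (path_W j). Qed.
Let W0 j : 0 < size (W j).
Proof. by have := lastv j; case: (W j) => //= E; move: uv; rewrite E eqxx. Qed.

Let z j a := nth u (u :: unzip2 (W j)) a.
Let z0 j : z j 0 = u. Proof. by []. Qed.
Let zv j : z j (size (W j)) = v.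
Proof. by rewrite /z -(lastv j) (last_nth u) size_map. Qed.
Let zinj j a b : a <= size (W j) -> b <= size (W j) -> z j a = z j b -> a = b.
Proof.
by move=> la lb /eqP; rewrite /z nth_uniq ?uu //= ?size_map // => /eqP.
Qed.
Let zends e0 j a : a < size (W j) -> ends G (nth e0 (unzip1 (W j)) a) = [set z j a; z j a.+1].
Proof. by move=> lt; have [_ ->] := walk_nth e0 (wk j) lt. Qed.

Let z_internal j a : 0 < a -> a < size (W j) -> z j a \in internal u (W j).
Proof.
move=> a0 lt; rewrite /internal.
have E : belast u (unzip2 (W j)) = u :: behead (belast u (unzip2 (W j))).
  by move: (W0 j); case: (W j) => //= -[e y] w _; case: w => //= -[].
have -> : z j a = nth u (belast u (unzip2 (W j))) a.
  rewrite /z [in LHS]lastI nth_rcons size_belast size_map lt //.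
rewrite E; case: a a0 lt => // a _ lt /=; apply: mem_nth.
by have := size_belast u (unzip2 (W j)); rewrite E /= size_map => e; rewrite -ltnS e.
Qed.

Let zeq j l a b : 0 < a -> a < size (W j) -> b <= size (W l) -> z j a = z l b -> j = l /\ a = b.
Proof.
move=> a0 la lb E.
have b0 : 0 < b.
  rewrite lt0n; apply/eqP => b0; move: E; rewrite b0 z0 -(z0 j) => /zinj; rewrite ltnW // => /(_ isT isT).
  by move=> h; rewrite h in a0.
have lb' : b < size (W l).
  rewrite ltn_neqAle lb andbT; apply/eqP => bk; move: E; rewrite bk zv -(zv j) => /zinj.
  by rewrite ltnW // leqnn => /(_ isT isT) h; rewrite h ltnn in la.
have [e|ne] := eqVneq j l.
  by rewrite -e in E lb' *; split=> //; apply: zinj E; apply: ltnW.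
have := disjV ne (z_internal a0 la); rewrite E.
by rewrite (z_internal b0 lb').
Qed.

Lemma theta_noloop e : e \in edges G -> #|ends G e| = 2.
Proof.
move=> eE; have [j ej] := edgesE eE.
have lt : index e (unzip1 (W j)) < size (W j) by rewrite -(size_map fst) index_mem.
rewrite -(nth_index e ej) zends // cards2; suff -> : z j (index e (unzip1 (W j))) != z j (index e (unzip1 (W j))).+1 by [].
apply/eqP => /zinj; rewrite ltnW // => /(_ isT lt); lia.
Qed.

Definition branch j : {set T} := [set e in unzip1 (W j)].

(** The closed path contains each branch entirely or not at all. All branches start at [u], and the
    path has exactly two edges there, so it consists of two branches. *)
Lemma theta_closed_path x c : closed_path G x c ->
  exists i j, i != j /\ [set e in unzip1 c] = branch i :|: branch j.
Proof.
move=> cp; have next := closed_path_next theta_noloop cp.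
have deg2 := closed_path_deg2 cp.
have [wc c0] : walk G x c /\ c != [::] by case/and5P: cp.
have [e0 e0c] : exists e, e \in unzip1 c.
  by move: c0; case: (c) => // -[e y] w _; exists e; rewrite inE eqxx.
have inE' e : e \in unzip1 c -> e \in edges G by apply: walk_edges wc e.
pose E j a := nth e0 (unzip1 (W j)) a.
have Eidx e j : e \in unzip1 (W j) -> exists2 a, a < size (W j) & e = E j a.
  move=> ej; exists (index e (unzip1 (W j))); last by rewrite /E nth_index.
  by rewrite -(size_map fst) index_mem.
have EW j a : a < size (W j) -> E j a \in unzip1 (W j) by move=> lt; apply: mem_nth; rewrite size_map.
have Einj j a b : a < size (W j) -> b < size (W j) -> E j a = E j b -> a = b.
  by move=> la lb /eqP; rewrite /E nth_uniq ?size_map ?uniqE // => /eqP.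
(* Only two edges meet at an internal vertex of a branch, so [c] contains both or neither. *)
have step j a : a.+1 < size (W j) -> (E j a \in unzip1 c) = (E j a.+1 \in unzip1 c).
  move=> lt; have lt' := ltnW lt.
  have share f : f \in edges G -> z j a.+1 \in ends G f -> f = E j a \/ f = E j a.+1.
    move=> fE; have [l fl] := edgesE fE; have [b lb ->] := Eidx f l fl.
    rewrite zends // !inE => /orP [] /eqP h.
      by have [e1 e2] := zeq (ltn0Sn a) lt (ltnW lb) h; right; rewrite -e1 -e2.
    by have [e1 [e2]] := zeq (ltn0Sn a) lt lb h; left; rewrite -e1 -e2.
  apply/idP/idP => h.
    have [|f [fc fe yf]] := next _ (z j a.+1) h; first by rewrite zends // !inE eqxx orbT.
    by have [E1|<- //] := share f (inE' f fc) yf; rewrite E1 eqxx in fe.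
  have [|f [fc fe yf]] := next _ (z j a.+1) h; first by rewrite zends // !inE eqxx.
  by have [<- //|E1] := share f (inE' f fc) yf; rewrite E1 eqxx in fe.
have all0 j a : a < size (W j) -> (E j a \in unzip1 c) = (E j 0 \in unzip1 c).
  by elim: a => // a IH lt; rewrite -step // IH // ltnW.
have memc e j : e \in unzip1 (W j) -> (e \in unzip1 c) = (E j 0 \in unzip1 c).
  by move=> /Eidx [a la ->]; apply: all0.
have uE j : u \in ends G (E j 0) by rewrite zends // !inE z0 eqxx.
have [i ei] := edgesE (inE' e0 e0c).
have ci : E i 0 \in unzip1 c by rewrite -(memc e0).
have [f [fc fe uf]] := next _ u ci (uE i).
have [j fj] := edgesE (inE' f fc).
have [b lb Ef] := Eidx f j fj.
have b0 : b = 0.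
  move: uf; rewrite Ef zends // !inE -(z0 j) => /orP [] /eqP hz.
    by have := zinj (leq0n _) (ltnW lb) hz.
  by have := zinj (leq0n _) lb hz.
have ij : i != j by apply: contraNneq fe => ->; rewrite Ef b0.
have cj : E j 0 \in unzip1 c by rewrite -b0 -Ef.
exists i, j; split=> //; apply/setP => e; rewrite !inE; apply/idP/orP => [ec|[] h].
- have [l el] := edgesE (inE' e ec).
  have [li|li] := eqVneq l i; first by left; rewrite -li.
  have [lj|lj] := eqVneq l j; first by right; rewrite -lj.
  have cl : E l 0 \in unzip1 c by rewrite -(memc e).
  have nE a b' : a != b' -> E a 0 != E b' 0.
    by move=> ab; apply: contraNneq (disjE ab (EW a 0 (W0 a))) => ->; apply: EW.
  case: (deg2 u (E i 0) (E j 0) (E l 0)) => //; apply: nE => //; by rewrite eq_sym.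
- by rewrite (memc e i).
- by rewrite (memc e j).
Qed.

Lemma theta_branches i j : i != j ->
  exists x c, closed_path G x c /\ branch i :|: branch j = [set e in unzip1 c].
Proof.
move=> ij; exists u, (W i ++ rev_walk u (W j)).
have E1 : unzip1 (W i ++ rev_walk u (W j)) = unzip1 (W i) ++ rev (unzip1 (W j)).
  by rewrite /unzip1 map_cat -/unzip1 rev_walk1.
have E2 : unzip2 (W i ++ rev_walk u (W j)) = unzip2 (W i) ++ rev (belast u (unzip2 (W j))).
  by rewrite /unzip2 map_cat -/unzip2 rev_walk2.
have Eb l : belast u (unzip2 (W l)) = u :: internal u (W l).
  by rewrite /internal; move: (W0 l); case: (W l) => //= -[e y] w _; case: w => //= -[].
split; last by apply/setP => e; rewrite !inE E1 mem_cat mem_rev.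
apply/and5P; split.
- by move: (W0 i); case: (W i).
- by rewrite walk_cat wk lastv -(lastv j) rev_walkP.
- rewrite E2 last_cat lastv Eb rev_cons last_rcons //.
- rewrite E1 cat_uniq uniqE rev_uniq uniqE andbT /=; apply/hasPn => e; rewrite mem_rev => ej.
  by apply/negP => ei; have := disjE ij ei; rewrite ej.
rewrite E2 cat_uniq rev_uniq; have /= /andP [ui ui'] := uu i.
have /andP [ubj _] : uniq (belast u (unzip2 (W j))) && (v \notin belast u (unzip2 (W j))).
  by have := uu j; rewrite lastI lastv rcons_uniq andbC.
rewrite ui' ubj andbT /=; apply/hasPn => y; rewrite mem_rev Eb inE => /orP [/eqP -> //|yj].
apply/negP => yi; have : y \in u :: unzip2 (W i) by rewrite inE yi orbT.
rewrite lastI lastv mem_rcons inE Eb inE => /or3P [/eqP yv|/eqP yu|yi'].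
- have := uu j; rewrite lastI lastv rcons_uniq Eb inE negb_or -yv yj.
  by rewrite andbF.
- by move: ui; rewrite -yu yi.
- by have := disjV ij yi'; rewrite yj.
Qed.

End ThetaGraph.

Section ThetaData.
Variables (V T : finType) (G : graph V T).
Implicit Types (u v : V) (w : seq (T * V)).

Definition theta_data u v w1 w2 w3 : Prop :=
  let vs := [:: u, v & internal u w1 ++ internal u w2 ++ internal u w3] in
  let es := unzip1 w1 ++ unzip1 w2 ++ unzip1 w3 in
  [/\ [&& graph_path G u v w1, graph_path G u v w2 & graph_path G u v w3],
      uniq vs, uniq es, vs =i V & es =i edges G].

Definition paths w1 w2 w3 (j : 'I_3) := nth [::] [:: w1; w2; w3] j.

Lemma ord3P (Q : 'I_3 -> Prop) : Q (inord 0) -> Q (inord 1) -> Q (inord 2) -> forall j, Q j.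
Proof.
move=> Q0 Q1 Q2 [[|[|[|]]]] // lt.
- by have -> : Ordinal lt = inord 0 by apply: val_inj; rewrite /= inordK.
- by have -> : Ordinal lt = inord 1 by apply: val_inj; rewrite /= inordK.
- by have -> : Ordinal lt = inord 2 by apply: val_inj; rewrite /= inordK.
Qed.

Lemma theta_data_cycles u v w1 w2 w3 : theta_data u v w1 w2 w3 ->
  let A := branch (paths w1 w2 w3) in
  [/\ forall j, A j != set0, forall i j, i != j -> [disjoint A i & A j],
      forall e, (e \in edges G) = [exists j, e \in A j]
    & forall C : {set T}, (exists x c, closed_path G x c /\ C = [set e in unzip1 c])
        <-> exists i j, i != j /\ C = A i :|: A j].
Proof.
move=> [/and3P [p1 p2 p3] uvs ues _ eE] A; pose W := paths w1 w2 w3.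
have uv : u != v by move: uvs; rewrite /= inE negb_or => /andP [/andP []].
have pW j : graph_path G u v (W j).
  by elim/ord3P: j; rewrite /W /paths inordK.
have [u1 [u2 u3] [d12 d13 d23]] : [/\ uniq (unzip1 w1), uniq (unzip1 w2) /\ uniq (unzip1 w3)
   & [/\ ~~ has (mem (unzip1 w1)) (unzip1 w2), ~~ has (mem (unzip1 w1)) (unzip1 w3)
       & ~~ has (mem (unzip1 w2)) (unzip1 w3)]].
  by move: ues; rewrite !cat_uniq has_cat negb_or => /and3P [-> /andP [-> ->] /and3P [-> -> ->]].
have [e12 e13 e23] : [/\ ~~ has (mem (internal u w1)) (internal u w2), ~~ has (mem (internal u w1)) (internal u w3)
       & ~~ has (mem (internal u w2)) (internal u w3)].
  by move: uvs; rewrite /= !cat_uniq has_cat negb_or => /and3P [_ _ /and3P [_ /andP [-> ->] /and3P [_ -> _]]].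
have hs (S : eqType) (s1 s2 : seq S) e : ~~ has (mem s1) s2 -> (e \in s1 -> e \notin s2) /\ (e \in s2 -> e \notin s1).
  by move=> /hasPn h; split=> [h1|/h //]; apply/negP => /h /=; rewrite h1.
have uW j : uniq (unzip1 (W j)) by elim/ord3P: j; rewrite /W /paths inordK.
have dE i j e : i != j -> e \in unzip1 (W i) -> e \notin unzip1 (W j).
  elim/ord3P: i; elim/ord3P: j; rewrite /W /paths !inordK //= -val_eqE /= !inordK //= => _.
  - exact: (hs _ _ _ e d12).1.
  - exact: (hs _ _ _ e d13).1.
  - exact: (hs _ _ _ e d12).2.
  - exact: (hs _ _ _ e d23).1.
  - exact: (hs _ _ _ e d13).2.
  - exact: (hs _ _ _ e d23).2.
have dV i j y : i != j -> y \in internal u (W i) -> y \notin internal u (W j).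
  elim/ord3P: i; elim/ord3P: j; rewrite /W /paths !inordK //= -val_eqE /= !inordK //= => _.
  - exact: (hs _ _ _ y e12).1.
  - exact: (hs _ _ _ y e13).1.
  - exact: (hs _ _ _ y e12).2.
  - exact: (hs _ _ _ y e23).1.
  - exact: (hs _ _ _ y e13).2.
  - exact: (hs _ _ _ y e23).2.
have EE e : (e \in edges G) = [exists j, e \in A j].
  rewrite -eE !mem_cat; apply/or3P/existsP => [[h|h|h]|[j]].
  - by exists (inord 0); rewrite inE /W /paths inordK.
  - by exists (inord 1); rewrite inE /W /paths inordK.
  - by exists (inord 2); rewrite inE /W /paths inordK.
  - by elim/ord3P: j; rewrite inE /paths inordK //= => h; [apply: Or31|apply: Or32|apply: Or33].
have EW e : e \in edges G -> exists j, e \in unzip1 (W j).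
  by rewrite EE => /existsP [j]; rewrite inE; exists j.
split=> //.
- move=> j; apply/set0Pn; have /and3P [_ /eqP l _] := pW j.
  move: l; rewrite /A /branch -/W; case: (W j) => [/= E|[e y] w _]; first by rewrite E eqxx in uv.
  by exists e; rewrite !inE eqxx.
- move=> i j ij; apply/pred0P => e /=; rewrite !inE; apply/negP => /andP [h].
  by apply/negP; apply: dE ij h.
move=> C; split=> [[x [c [cp ->]]]|[i [j [ij ->]]]].
  exact: (theta_closed_path pW uv uW dE dV EW cp).
exact: (theta_branches pW uv uW dE dV ij).
Qed.

Lemma walk_of_nth e0 x w :
  (forall i, i < size w -> nth e0 (unzip1 w) i \in edges G /\
     ends G (nth e0 (unzip1 w) i) = [set nth x (x :: unzip2 w) i; nth x (unzip2 w) i]) ->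
  walk G x w.
Proof.
elim: w x => //= -[e y] w IH x h; have [/= h1 h2] := h 0 isT; rewrite h1 h2 eqxx /=.
apply: IH => i lt; have [/= h3 h4] := h i.+1 lt; split=> //; rewrite h4.
have lt2 : i < size (unzip2 w) by rewrite size_map.
by congr [set _; _]; [case: i {lt h3 h4} lt2 => //= i lt2; apply: set_nth_default; apply: ltnW | apply: set_nth_default].
Qed.

End ThetaData.

(** * A theta graph with prescribed edge sets *)

Section Concrete.
Variables (T : finType) (t' : T) (P P' : {set T}).
Hypotheses (tP : t' \notin P) (tP' : t' \notin P') (dPP : [disjoint P & P']).
Variable k : nat.
Hypotheses (cP : #|P| = k.+1) (cP' : #|P'| = k.+1).

(** Both long paths have k + 1 edges and so k inner vertices, which makes 2k + 2 vertices in all: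
    [u] is 0, the path on [P] uses 1 to k, [v] is k + 1, and the path on [P'] uses k + 2 to 2k +
    1. *)
Local Notation V := 'I_(k.*2.+1).+1.
Let u : V := inord 0.
Let v : V := inord k.+1.
Let i2 : seq V := map inord (iota 1 k).
Let i3 : seq V := map inord (iota k.+2 k).
Let es := t' :: enum P ++ enum P'.
(** [src] and [dst] list the two ends of the edges in the order of [es]: the edge [t'], then the
    path on [P], then the path on [P']. *)
Let src := u :: (u :: i2) ++ (u :: i3).
Let dst := v :: rcons i2 v ++ rcons i3 v.
Let gends (e : T) : {set V} := [set nth u src (index e es); nth u dst (index e es)].

Lemma gends_card e : e \in t' |: (P :|: P') -> 0 < #|gends e| <= 2.
Proof. by move=> _; rewrite cards2; case: (_ != _). Qed.

Definition parallel_paths_graph : graph V T := Graph gends_card.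

Let w1 := [:: (t', v)].
Let w2 := zip (enum P) (rcons i2 v).
Let w3 := zip (enum P') (rcons i3 v).

Let s2 : size (enum P) = size (rcons i2 v).
Proof. by rewrite -cardE cP size_rcons size_map size_iota. Qed.
Let s3 : size (enum P') = size (rcons i3 v).
Proof. by rewrite -cardE cP' size_rcons size_map size_iota. Qed.
Let u12 : unzip1 w2 = enum P. Proof. by apply: unzip1_zip; rewrite s2. Qed.
Let u22 : unzip2 w2 = rcons i2 v. Proof. by apply: unzip2_zip; rewrite s2. Qed.
Let u13 : unzip1 w3 = enum P'. Proof. by apply: unzip1_zip; rewrite s3. Qed.
Let u23 : unzip2 w3 = rcons i3 v. Proof. by apply: unzip2_zip; rewrite s3. Qed.

Let ues : uniq es.
Proof.
rewrite /es /= mem_cat !mem_enum negb_or tP tP' cat_uniq !enum_uniq /= andbT.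
by apply/hasPn => e; rewrite !mem_enum => eP'; rewrite /= (disjointFl dPP eP').
Qed.

Let nats := [:: 0, k.+1 & iota 1 k ++ iota k.+2 k].

Let nats_lt a : a \in nats -> a < (k.*2.+1).+1.
Proof. rewrite !(inE, mem_cat) !mem_iota -addnn => /or4P [/eqP ->|/eqP ->| |]; lia. Qed.

Let uniq_nats : uniq (map (fun a => inord a : V) nats).
Proof.
rewrite map_inj_in_uniq => [|a b /nats_lt la /nats_lt lb E]; last first.
  by have := congr1 val E; rewrite /= !inordK.
rewrite /nats /= !inE !mem_cat !mem_iota cat_uniq !iota_uniq /= andbT.
apply/andP; split; first by lia.
by apply/hasPn => a; rewrite !mem_iota /=; lia.
Qed.

Lemma parallel_paths_theta : theta_data parallel_paths_graph u v w1 w2 w3.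
Proof.
have int1 : internal u w1 = [::] by [].
have int2 : internal u w2 = i2 by rewrite /internal u22 belast_rcons.
have int3 : internal u w3 = i3 by rewrite /internal u23 belast_rcons.
have Evs : [:: u, v & internal u w1 ++ internal u w2 ++ internal u w3] = map (fun a => inord a : V) nats.
  by rewrite int1 int2 int3 /= map_cat.
have Ees : unzip1 w1 ++ unzip1 w2 ++ unzip1 w3 = es by rewrite u12 u13.
have sz2 : size (enum P) = k.+1 by rewrite -cardE cP.
have sz3 : size (enum P') = k.+1 by rewrite -cardE cP'.
have si2 : size i2 = k by rewrite size_map size_iota.
have si3 : size i3 = k by rewrite size_map size_iota.
have uvs := uniq_nats; rewrite -Evs in uvs.
split; rewrite ?Evs ?Ees //.
- have [uv2 uv3] : uniq (u :: rcons i2 v) /\ uniq (u :: rcons i3 v).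
    move: uvs; rewrite int1 int2 int3 /= inE !negb_or !mem_cat !negb_or cat_uniq.
    case/and3P => /and3P [uv a b] /andP [c d] /and3P [e f g].
    by rewrite !rcons_uniq !mem_rcons !inE !negb_or uv a b c d e g.
  apply/and3P; split.
  + have uv : u != v by move: uv2; rewrite /= mem_rcons inE negb_or => /andP [/andP []].
    by rewrite /graph_path /= !inE !eqxx /= /gends /= eqxx eqxx uv.
  + rewrite /graph_path u22 last_rcons eqxx uv2 !andbT.
    apply: (@walk_of_nth _ _ _ t'); rewrite u12 u22 => i; rewrite size_zip -s2 minnn sz2 => lt.
    have memP : nth t' (enum P) i \in P by rewrite -mem_enum mem_nth ?sz2.
    have En : nth t' (enum P) i = nth t' es i.+1 by rewrite /es /= nth_cat sz2 lt.
    split; first by rewrite /= !inE memP orbT.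
    rewrite /= /gends En index_uniq //; last by rewrite /es /= size_cat sz2; lia.
    rewrite /src /dst /= -cat_cons !nth_cat size_rcons /= si2 lt.
    have E : nth u (u :: rcons i2 v) i = nth u (u :: i2) i by rewrite -rcons_cons nth_rcons /= si2 lt.
    by rewrite E.
  + rewrite /graph_path u23 last_rcons eqxx uv3 !andbT.
    apply: (@walk_of_nth _ _ _ t'); rewrite u13 u23 => i; rewrite size_zip -s3 minnn sz3 => lt.
    have memP : nth t' (enum P') i \in P' by rewrite -mem_enum mem_nth ?sz3.
    have En : nth t' (enum P') i = nth t' es (k.+1 + i).+1.
      by rewrite /es /= nth_cat sz2 ltnNge leq_addr /= addKn.
    split; first by rewrite /= !inE memP !orbT.
    rewrite /= /gends En index_uniq //; last by rewrite /es /= size_cat sz2 sz3; lia.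
    have Es : nth u src (k.+1 + i).+1 = nth u (u :: i3) i.
      rewrite /src -[LHS]/(nth u ((u :: i2) ++ (u :: i3)) (k.+1 + i)) nth_cat.
      by rewrite [size _]/= si2 ltnNge leq_addr addKn.
    have Ed : nth u dst (k.+1 + i).+1 = nth u (rcons i3 v) i.
      rewrite /dst -[LHS]/(nth u (rcons i2 v ++ rcons i3 v) (k.+1 + i)) nth_cat.
      by rewrite size_rcons si2 ltnNge leq_addr addKn.
    have E : nth u (u :: rcons i3 v) i = nth u (u :: i3) i by rewrite -rcons_cons nth_rcons /= si3 lt.
    by rewrite Es Ed E.
- move=> x; rewrite [RHS]inE; apply/idP; apply/mapP; exists (nat_of_ord x); last by rewrite inord_val.
  have := ltn_ord x; rewrite !(inE, mem_cat) !mem_iota; move: (nat_of_ord x) => a.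
  by rewrite -addnn; lia.
by move=> e; rewrite !inE mem_cat !mem_enum.
Qed.

Lemma parallel_paths_cycles (C : {set T}) :
  (exists x c, closed_path parallel_paths_graph x c /\ C = [set e in unzip1 c]) <->
  exists X Y, [/\ X \in [set [set t']; P; P'], Y \in [set [set t']; P; P'], X != Y & C = X :|: Y].
Proof.
have [n0 dj _ h] := theta_data_cycles parallel_paths_theta.
have [b0 b1 b2] : [/\ branch (paths w1 w2 w3) (inord 0) = [set t'],
    branch (paths w1 w2 w3) (inord 1) = P & branch (paths w1 w2 w3) (inord 2) = P'].
  split; apply/setP => e; rewrite /branch [LHS]inE /paths inordK //= ?u12 ?u13 ?mem_enum //.
  by rewrite !inE.
have inF j : branch (paths w1 w2 w3) j \in [set [set t']; P; P'].
  by elim/ord3P: j; rewrite ?b0 ?b1 ?b2 !inE eqxx ?orbT.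
rewrite h; split=> [[i [j [ij ->]]]|[X [Y [XF YF XY ->]]]].
  exists (branch (paths w1 w2 w3) i), (branch (paths w1 w2 w3) j); split=> //.
  apply: contraNneq (n0 i) => E; have := dj i j ij.
  by rewrite -E -setI_eq0 setIid.
have ex Z : Z \in [set [set t']; P; P'] -> exists i, Z = branch (paths w1 w2 w3) i.
  rewrite !inE -orbA => /or3P [] /eqP ->; [exists (inord 0)|exists (inord 1)|exists (inord 2)];
    by rewrite ?b0 ?b1 ?b2.
have [i Ei] := ex X XF; have [j Ej] := ex Y YF; exists i, j; split; last by rewrite Ei Ej.
by apply: contraNneq XY => E; rewrite Ei Ej E.
Qed.

End Concrete.

(** * Parallel-path addition *)

Section ContractSeries.
Variables (T : finType) (A : matroid T) (P : {set T}) (t : T).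
Implicit Types (C D K I : {set T}).
Hypothesis tP : t \in P.
Hypothesis sP : P \subset ground A.
Hypothesis hP : forall C, circuit A C -> ~~ [disjoint C & P] -> P \subset C.

(** [P :\ t] is independent, because a circuit meeting [P] contains [t]. Dependence in the
    contraction is therefore a circuit of [A] inside the set enlarged by [P :\ t]. *)
Lemma contraction_series_circuit K : circuit (contraction A (P :\ t)) K <->
  circuit A K /\ [disjoint K & P] \/
  exists C, [/\ circuit A C, P \subset C & K = C :\: (P :\ t)].
Proof.
have sX : P :\ t \subset ground A by apply: subset_trans sP; apply: subsetDl.
have nX : nul A (P :\ t) = 0.
  apply: nul_circuit_sub => C cC; apply/negP => s.
  have [x xC] := circuit_n0 cC; have xP := subsetP s x xC.
  have /(subsetP (hP cC _)) : t \in P by [].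
  have m : ~~ [disjoint C & P].
    by apply/pred0Pn; exists x; rewrite /= xC; move: xP; rewrite inE => /andP [].
  by move=> /(_ m)/(subsetP s); rewrite !inE eqxx.
have dep I : I \subset ground A :\: (P :\ t) -> ~~ indep (contraction A (P :\ t)) I <->
    exists2 C, circuit A C & C \subset (P :\ t) :|: I.
  move=> sI; rewrite contraction_indep // sI nX /= -lt0n; split=> [/nul_circuit //|[C cC s]].
  by rewrite -(circuit_nul1 cC); apply: nulS.
have gC C : circuit A C -> C \subset ground A by move/circuit_cyc/cyc_ground.
have disj C : circuit A C -> t \notin C -> [disjoint C & P].
  by move=> cC; apply: contraR => /(hP cC)/subsetP /(_ t tP).
split=> [/minsetP [/andP [/= sK /(dep K sK) [C cC s]] mK]|].
  have [d|m] := boolP [disjoint C & P].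
    left; have sCK : C \subset K by move: s d; sets.
    suff <- : C = K by [].
    apply: mK => //; rewrite (subset_trans sCK sK) /=; apply/(dep _ (subset_trans sCK sK)).
    by exists C => //; apply: subsetUr.
  right; exists C; have PC := hP cC m; split=> //.
  have sCK : C :\: (P :\ t) \subset K by move: s; sets.
  apply/esym/mK => //; rewrite (subset_trans sCK sK) /=; apply/(dep _ (subset_trans sCK sK)).
  by exists C => //; sets.
case=> [[cK d]|[C [cC PC ->]]]; apply/minsetP; split.
- have sK : K \subset ground A :\: (P :\ t) by have := gC K cK; move: d; sets.
  by rewrite sK /=; apply/(dep _ sK); exists K => //; apply: subsetUr.
- move=> D /andP [sD /(dep D sD) [C cC s]] sDK.
  have tC : t \notin C.
    apply/negP => /(subsetP s); rewrite !inE eqxx /= => /(subsetP sDK).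
    by move=> tK; move: tP; rewrite (disjointFr d tK).
  have sCD : C \subset D by have := disj C cC tC; move: s; sets.
  have E := circuit_eq cC cK (subset_trans sCD sDK).
  by apply/eqP; rewrite eqEsubset sDK -{1}E sCD.
- have sK : C :\: (P :\ t) \subset ground A :\: (P :\ t) by apply: setSD; apply: gC.
  by rewrite sK /=; apply/(dep _ sK); exists C => //; sets.
move=> D /andP [sD /(dep D sD) [C' cC' s]] sDK.
have sC' : C' \subset C by move: s sDK PC; sets.
have E := circuit_eq cC' cC sC'; rewrite E in s.
by apply/eqP; rewrite eqEsubset sDK /=; move: s; sets.
Qed.

End ContractSeries.

Section PathSum.
Variables (T : finType) (A M' N : matroid T) (P P' : {set T}) (t t' : T).
Implicit Types (C D X Y : {set T}).
Hypothesis tP : t \in P.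
Hypothesis sP : P \subset ground A.
Hypothesis t'A : t' \notin ground A.
Hypothesis hP : forall C, circuit A C -> ~~ [disjoint C & P] -> P \subset C.
Hypothesis isoM : matroid_iso (fun x => if x == t then t' else x) (contraction A (P :\ t)) M'.

Let g x := if x == t then t' else x.

Let gid X : t \notin X -> g @: X = X.
Proof.
move=> tX; rewrite -[RHS]imset_id; apply: eq_in_imset => x xX; rewrite /g.
by case: eqP => // xt; rewrite -xt xX in tX.
Qed.

Let gt X : t \in X -> g @: X = t' |: (X :\ t).
Proof.
move=> tX; rewrite -{1}(setD1K tX) imsetU1 gid; last by rewrite !inE eqxx.
by rewrite /g eqxx.
Qed.

Let gD D : P \subset D -> g @: (D :\: (P :\ t)) = t' |: (D :\: P).
Proof.
move=> PD; rewrite gt; last by rewrite !inE eqxx /= (subsetP PD).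
by congr (_ |: _); apply/setP => x; rewrite !inE; case: eqP => [->|] //=; rewrite ?tP.
Qed.

Lemma contract_path_circuit C : circuit M' C <-> circuit A C /\ [disjoint C & P] \/
  exists D, [/\ circuit A D, P \subset D & C = t' |: (D :\: P)].
Proof.
rewrite (iso_circuit isoM); split.
  case=> K /(contraction_series_circuit tP sP hP) [[cK d] ->|[D [cD PD ->]] ->].
    by left; rewrite gid // (disjointFl d tP).
  by right; exists D; split=> //; apply: gD.
case=> [[cC d]|[D [cD PD ->]]].
  exists C; last by rewrite [RHS]gid // (disjointFl d tP).
  by apply/(contraction_series_circuit tP sP hP); left.
exists (D :\: (P :\ t)); last by rewrite [RHS]gD.
by apply/(contraction_series_circuit tP sP hP); right; exists D.
Qed.

Hypothesis t'P' : t' \notin P'.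
Hypothesis cN : forall C, circuit N C <-> [\/ C = t' |: P, C = t' |: P' | C = P :|: P'].

(** Serves both directions of the theorem: to recognise a matroid as the 2-sum, and to read off the
    circuits of a given one. *)
Lemma path_sum_circuit C :
  [\/ circuit M' C /\ t' \notin C, circuit N C /\ t' \notin C
    | exists C1 C2, [/\ circuit M' C1, circuit N C2, t' \in C1, t' \in C2
                    & C = (C1 :\ t') :|: (C2 :\ t')]] <->
  [\/ circuit A C, exists D, [/\ circuit A D, P \subset D & C = (D :\: P) :|: P'] | C = P :|: P'].
Proof.
have t'P : t' \notin P by apply: contra t'A; apply: (subsetP sP).
have ntA D : circuit A D -> t' \notin D.
  by move=> cD; apply: contra t'A; apply: (subsetP (cyc_ground (circuit_cyc cD))).
have ntD D : circuit A D -> t' \notin D :\: P by move/ntA; apply: contra; rewrite inE => /andP [].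
have swapP D : P \subset D -> circuit A D -> (t' |: (D :\: P)) :\ t' :|: (t' |: P) :\ t' = D.
  by move=> PD cD; rewrite !setU1K ?ntD // setUC -{1}(setIidPr PD) setID.
have swapP' D : P \subset D -> circuit A D -> (t' |: (D :\: P)) :\ t' :|: (t' |: P') :\ t' = (D :\: P) :|: P'.
  by move=> PD cD; rewrite !setU1K ?ntD.
have cM' := contract_path_circuit; split.
  case=> [[/cM' [[cC d] _|[D [_ _ ->]]]]|[/cN h]|[C1 [C2 [/cM' h1 /cN h2 t1 t2 ->]]]].
  - exact: Or31.
  - by rewrite !inE eqxx.
  - by case: h => ->; rewrite ?inE ?eqxx //= => _; apply: Or33.
  case: h1 t1 => [[cC1 _]|[D [cD PD ->]] _]; first by rewrite (negbTE (ntA _ cC1)).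
  case: h2 t2 => -> t2.
  - by rewrite swapP //; apply: Or31.
  - by rewrite swapP' //; apply: Or32; exists D.
  - by move: t2; rewrite inE (negbTE t'P) (negbTE t'P').
case=> [cC|[D [cD PD ->]]|->].
- have [d|m] := boolP [disjoint C & P].
    by apply: Or31; split; [apply/cM'; left | apply: ntA].
  have PC := hP cC m; apply: Or33; exists (t' |: (C :\: P)), (t' |: P).
  rewrite !inE eqxx swapP //; split=> //; first by apply/cM'; right; exists C.
  by apply/cN; apply: Or31.
- apply: Or33; exists (t' |: (D :\: P)), (t' |: P'); rewrite !inE eqxx swapP' //; split=> //.
    by apply/cM'; right; exists D.
  by apply/cN; apply: Or32.
- apply: Or32; split; first by apply/cN; apply: Or33.
  by rewrite inE negb_or t'P.
Qed.

End PathSum.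

Section ParallelPath.
Variables (T : finType) (A B : matroid T) (P P' : {set T}) (t t' : T).
Implicit Types (C D K I X Y : {set T}).
Hypothesis tP : t \in P.
Hypothesis sP : P \subset ground A.
Hypothesis dP' : [disjoint P' & ground A].
Hypothesis t'A : t' \notin ground A.
Hypothesis t'P' : t' \notin P'.
Hypothesis cardP : #|P'| = #|P|.
Hypothesis hP : forall C, circuit A C -> ~~ [disjoint C & P] -> P \subset C.
Variable C0 : {set T}.
Hypothesis cC0 : circuit A C0.
Hypothesis PC0 : P \proper C0.
Hypothesis gB : ground B = ground A :|: P'.
Hypothesis hB : forall C, circuit B C <->
  [\/ circuit A C, exists D, [/\ circuit A D, P \subset D & C = (D :\: P) :|: P'] | C = P :|: P'].

Let F : {set {set T}} := [set [set t']; P; P'].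

Let t'P : t' \notin P. Proof. by apply: contra t'A; apply: (subsetP sP). Qed.
Let dPP' : [disjoint P & P']. Proof. by move: dP' sP; sets. Qed.
Let P'0 : P' != set0.
Proof. by rewrite -card_gt0 cardP card_gt0; apply/set0Pn; exists t. Qed.
Let P0 : P != set0. Proof. by apply/set0Pn; exists t. Qed.

Let inF X : reflect [\/ X = [set t'], X = P | X = P'] (X \in F).
Proof.
apply: (iffP idP); rewrite !inE -orbA; last by case=> ->; rewrite eqxx ?orbT.
by case/or3P => /eqP h; [apply: Or31 | apply: Or32 | apply: Or33].
Qed.

Let dt'P : [disjoint [set t'] & P]. Proof. by rewrite disjoints1. Qed.
Let dt'P' : [disjoint [set t'] & P']. Proof. by rewrite disjoints1. Qed.

Let trivF : trivIset F.
Proof.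
apply/trivIsetP => X Y /inF + /inF; case=> -> [] -> //; rewrite ?eqxx // => _.
- by rewrite disjoint_sym.
- by rewrite disjoint_sym.
- by rewrite disjoint_sym.
Qed.

Let F0 : set0 \notin F.
Proof.
apply/negP => /inF [] E.
- by have := set11 t'; rewrite -E inE.
- by move: P0; rewrite -E eqxx.
- by move: P'0; rewrite -E eqxx.
Qed.

Let neq X Y : X != set0 -> [disjoint X & Y] -> X != Y.
Proof. by move=> X0; apply: contraTneq => <-; rewrite -setI_eq0 setIid. Qed.

Let t'0 : [set t'] != set0. Proof. by apply/set0Pn; exists t'; rewrite set11. Qed.

Let F2 : 2 < #|F|.
Proof.
have n1 := neq t'0 dt'P; have n2 := neq t'0 dt'P'; have n3 := neq P0 dPP'.
by rewrite /F -setUA cardsU1 cards2 n3 in_set2 (negbTE n1) (negbTE n2).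
Qed.

Let covF : cover F = t' |: (P :|: P').
Proof.
apply/setP => x; apply/bigcupP/idP => [[X /inF [] -> h]|]; rewrite ?inE.
- by move: h; rewrite inE => ->.
- by rewrite h orbT.
- by rewrite h !orbT.
case/or3P => h.
- by exists [set t']; [apply/inF; apply: Or31 | rewrite inE].
- by exists P => //; apply/inF; apply: Or32.
- by exists P' => //; apply/inF; apply: Or33.
Qed.

Let N := theta_matroid trivF F0.

Let cN C : circuit N C <-> [\/ C = t' |: P, C = t' |: P' | C = P :|: P'].
Proof.
rewrite theta_circuit; split=> [[X [Y [/inF hX /inF hY + ->]]]|].
  case: hX hY => -> [] -> => h; rewrite ?eqxx // in h *.
  - exact: Or31.
  - exact: Or32.
  - by apply: Or31; rewrite setUC.
  - exact: Or33.
  - by apply: Or32; rewrite setUC.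
  - by apply: Or33; rewrite setUC.
have F1 : [set t'] \in F by apply/inF; apply: Or31.
have F3 : P \in F by apply/inF; apply: Or32.
have F4 : P' \in F by apply/inF; apply: Or33.
case=> ->; [exists [set t'], P | exists [set t'], P' | exists P, P'].
- by split=> //; apply: neq.
- by split=> //; apply: neq.
- by split=> //; apply: neq.
Qed.

Let g x := if x == t then t' else x.

Let g_inj : {in ground (contraction A (P :\ t)) &, injective g}.
Proof.
rewrite contraction_ground => x y; rewrite !inE /g => /andP [_ xA] /andP [_ yA].
case: (eqVneq x t) => [->|xt]; case: (eqVneq y t) => [->|yt] // E.
  by move: t'A; rewrite E yA.
by move: t'A; rewrite -E xA.
Qed.

Let M' := relabel g_inj.

Let cM' C : circuit M' C <-> circuit A C /\ [disjoint C & P] \/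
  exists D, [/\ circuit A D, P \subset D & C = t' |: (D :\: P)].
Proof. exact: contract_path_circuit tP sP hP (relabel_iso g_inj) C. Qed.

Let gM' : ground M' = t' |: (ground A :\: P).
Proof.
rewrite /M' /=; apply/setP => x; apply/imsetP/idP => [[y]|].
  rewrite !inE negb_and negbK /g => /andP [yt yA] ->.
  case: eqP yt => [_ _|_ /= ->]; first by rewrite eqxx.
  by rewrite yA orbT.
rewrite !inE => /orP [/eqP ->|/andP [xP xA]].
  by exists t; rewrite /g ?eqxx // !inE eqxx /= (subsetP sP).
exists x; first by rewrite !inE (negbTE xP) andbF.
by rewrite /g; case: eqP => // E; rewrite E tP in xP.
Qed.

(** The witnesses are the relabelled contraction, the theta matroid on the blocks [[set t']], [P],
    [P'], and its concrete graph. An element of [C0] outside [P] shows that the basepoint is not a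
    separator of [M']. *)
Lemma parallel_path_intro : parallel_path_addition A B.
Proof.
have cA C : circuit A C -> C \subset ground A by move/circuit_cyc/cyc_ground.
have tC0 : t \in C0 by apply: (subsetP (proper_sub PC0)).
pose ok (X : {set T}) := [&& X \subset ground (mdual A), [forall e in X, ~~ loop (mdual A) e]
  & [forall e in X, forall f in X, (e != f) ==> parallel (mdual A) e f]].
have un C e f : circuit A C -> e \in P -> f \in P -> e \in C -> f \in C.
  move=> cC eP fP eC; apply: (subsetP (hP cC _)) => //.
  by apply/pred0Pn; exists e; rewrite /= eC.
have okP : ok P.
  apply/and3P; split=> //.
    apply/forall_inP => e eP; change (~~ coloop A e); apply/(coloopP (subsetP sP e eP)).
    by exists C0 => //; apply: (subsetP (proper_sub PC0)).
  apply/forall_inP => e eP; apply/forall_inP => f fP; apply/implyP => ef.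
  change (in_series A e f); apply/in_seriesP; split=> //.
    by exists C0 => //; apply: (subsetP (proper_sub PC0)).
  by move=> C cC; apply/idP/idP; apply: un.
have [Q mQ PQ] := maxset_exists okP.
have cP' : #|P'| = #|P|.-1.+1 by rewrite cardP prednK // card_gt0.
have cP1 : #|P| = #|P|.-1.+1 by rewrite prednK // card_gt0.
exists P, Q, P', t, t', M', N, 'I_((#|P|.-1).*2.+1).+1, (parallel_paths_graph t' P P' #|P|.-1).
split.
- by split.
- by split.
- exact: relabel_iso.
- split.
  + do 5 eexists; exact: (parallel_paths_theta t'P t'P' dPP' cP1 cP').
  + split; first exact: covF.
    by move=> C; rewrite parallel_paths_cycles //; exact: theta_circuit.
  + move=> S; rewrite (@theta_series_class _ F trivF F0 F2 N S erefl (theta_circuit trivF F0)).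
    by split=> [/inF|] // h; apply/inF.
have [y yC0 yP] : exists2 y, y \in C0 & y \notin P by apply/subsetPn; move: PC0; rewrite properE => /andP [].
have yA := subsetP (cA _ cC0) y yC0.
split.
- rewrite gM' /= covF; apply/setP => x; rewrite !inE; case: eqP => [->|] //= _.
  case xA: (x \in ground A); rewrite ?andbF //= andbT.
  by rewrite (disjointFl dP' xA) orbF; case: (x \in P).
- case=> _ /(_ t' y); rewrite !inE eqxx gM' !inE yP yA orbT => /(_ isT isT) sep.
  have : (y == t').
    apply: sep; right; exists (t' |: (C0 :\: P)); rewrite !inE eqxx yP yC0 orbT; split=> //.
    by apply/cM'; right; exists C0; rewrite (proper_sub PC0).
  by move/eqP => E; move: t'A; rewrite -E yA.
- case=> _ /(_ t' t); rewrite !inE eqxx /= covF !inE tP orbT => /(_ isT isT) sep.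
  have : (t == t').
    by apply: sep; right; exists (t' |: P); rewrite !inE eqxx tP orbT; split=> //; apply/cN; apply: Or31.
  by move/eqP => E; move: t'P; rewrite -E tP.
- rewrite gB gM' /= covF; apply/setP => x; rewrite !inE; case: eqP => [->|] //=.
    by rewrite (negbTE t'A) (negbTE t'P').
  move=> _; case xP: (x \in P); rewrite /= ?andbT ?orbT //.
  by rewrite (subsetP sP).
by move=> C; rewrite hB; apply: iff_sym; apply: path_sum_circuit (relabel_iso g_inj) t'P' cN C.
Qed.

End ParallelPath.

(** * Rerouting circuits and deleting a path *)

Section Exchange.
Variables (T : finType) (M : matroid T).
Implicit Types (C D Q Z : {set T}).

Lemma unsplit_sub C Q : circuit M C -> ~~ splits M C Q -> ~~ [disjoint C & Q] -> Q \subset C.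
Proof. by rewrite /splits => -> /= /nandP [/negP|/negbNE]. Qed.

(** Eliminating [e] yields a circuit [C] that avoids [Q] and hence contains [Z]. Eliminating [z]
    from [C] against [Q :|: Z] yields a circuit inside [D], which must be [D]; so no element of
    [D :\: Q] was lost in [C]. *)
Lemma exchange_circuit Q Z D : (forall C, ~~ splits M C Q) -> (forall C, ~~ splits M C Z) ->
  circuit M (Q :|: Z) -> Q != set0 -> Z != set0 -> [disjoint Q & Z] ->
  circuit M D -> Q \subset D -> [disjoint D & Z] -> circuit M ((D :\: Q) :|: Z).
Proof.
move=> uQ uZ cQZ /set0Pn [e eQ] /set0Pn [z zZ] dQZ cD QD dDZ.
have eD := subsetP QD e eQ.
have [f fD fQ] : exists2 f, f \in D & f \notin Q.
  apply/subsetPn/negP => sDQ; have E := circuit_eq cD cQZ (subset_trans sDQ (subsetUl _ _)).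
  by have := disjointFl dDZ zZ; rewrite E inE zZ orbT.
have fZ : f \notin Z by rewrite (disjointFr dDZ fD).
have fQZ : f \notin Q :|: Z by rewrite inE negb_or fQ.
have eQZ : e \in Q :|: Z by rewrite inE eQ.
have [C [cC fC eC sC]] := circuit_elim cD cQZ eD eQZ fD fQZ.
have dCQ : [disjoint C & Q].
  by apply: contraR eC => /(unsplit_sub cC (uQ C))/subsetP/(_ e eQ).
have mZ : ~~ [disjoint C & Z].
  apply/negP => dCZ; have sCD : C \subset D.
    apply/subsetP => x xC; have := subsetP sC x xC.
    by rewrite !inE (disjointFr dCZ xC) orbF => /orP [//|/(subsetP QD)].
  by move: eC; rewrite (circuit_eq cC cD sCD) eD.
have ZC := unsplit_sub cC (uZ C) mZ.
have zC := subsetP ZC z zZ.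
have zQZ : z \in Q :|: Z by rewrite inE zZ orbT.
have [C' [cC' fC' zC' sC']] := circuit_elim cC cQZ zC zQZ fC fQZ.
have dC'Z : [disjoint C' & Z].
  by apply: contraR zC' => /(unsplit_sub cC' (uZ C'))/subsetP/(_ z zZ).
have E : C' = D.
  apply: (circuit_eq cC' cD); apply/subsetP => x xC'; have xZ := disjointFr dC'Z xC'.
  have := subsetP sC' x xC'; rewrite !inE xZ orbF => /orP [/(subsetP sC)|/(subsetP QD) //].
  by rewrite !inE xZ orbF => /orP [//|/(subsetP QD)].
suff <- : C = D :\: Q :|: Z by [].
apply/setP => x; apply/idP/idP => [xC|].
  have xQ := disjointFr dCQ xC; have := subsetP sC x xC.
  by rewrite !inE xQ.
rewrite !inE => /orP [/andP [xQ xD]|/(subsetP ZC) //].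
rewrite E in sC'; have := subsetP sC' x xD; rewrite !inE (negbTE xQ) (disjointFr dDZ xD) /=.
by rewrite orbF.
Qed.

End Exchange.

Section DeletePath.
Variables (T : finType) (M : matroid T) (h : rel T) (L Q Z : {set T}).
Hypothesis hM : ordered M h.
Hypothesis conn : mconnected M.
Hypothesis dg : digon M L Q Z.
Hypothesis uQ : forall C, ~~ splits M C Q.
Hypothesis uZ : forall C, ~~ splits M C Z.
Implicit Types (C D : {set T}) (e f : T).

Let N := deletion M Z.

Let QL : Q \subset L.
Proof. by case: dg => _ _ [q _ s] _ _; apply: subset_trans s (cls_sub _ _ _). Qed.
Let dZL : [disjoint Z & L]. Proof. by case: dg. Qed.
Let dQZ : [disjoint Q & Z]. Proof. by rewrite disjoint_sym; apply: disjointWr QL dZL. Qed.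
Let cQZ : circuit M (Q :|: Z). Proof. by case: dg => _ _ _ _ []. Qed.
Let Q0 : Q != set0. Proof. by case: dg. Qed.
Let cardQZ : #|Q| = #|Z|.
Proof. by case: (dg) => _ _ [q qL s] _ _; case: (digon_quad hM dg qL s). Qed.
Let Z0 : Z != set0. Proof. by rewrite -card_gt0 -cardQZ card_gt0. Qed.

Lemma delete_path_circuit C : circuit M C <-> [\/ circuit N C,
  exists D, [/\ circuit N D, Q \subset D & C = (D :\: Q) :|: Z] | C = Q :|: Z].
Proof.
split=> [cC|[|[D [+ QD ->]]|->] //]; last first.
- by rewrite deletion_circuit => /andP [cD dD]; apply: exchange_circuit.
- by rewrite deletion_circuit => /andP [].
have [dC|mZ] := boolP [disjoint C & Z]; first by apply: Or31; rewrite deletion_circuit cC.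
have ZC := unsplit_sub cC (uZ C) mZ.
have [dC|mQ] := boolP [disjoint C & Q]; last first.
  have QC := unsplit_sub cC (uQ C) mQ.
  by apply: Or33; apply/esym; apply: (circuit_eq cQZ cC); rewrite subUset QC.
have dZQ : [disjoint Z & Q] by rewrite disjoint_sym.
apply: Or32; exists ((C :\: Z) :|: Q); split.
- rewrite deletion_circuit; apply/andP; split; last by move: (dQZ); clear=> *; sets.
  by apply: exchange_circuit => //; rewrite setUC.
- exact: subsetUr.
- by move: (ZC) (dC) (dQZ); clear=> *; sets.
Qed.

(** Leaving out a class of [L] other than that of [Q] gives such a circuit. It keeps the deletion
    connected and keeps the basepoint of the 2-sum from being a separator. *)
Lemma path_proper_circuit : exists2 C, circuit N C & Q \proper C.
Proof.
have [qL _ [q qinL s] _ _] := dg.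
have [r rL nr] : exists2 r, r \in L & r \notin cls M L q.
  apply/subsetPn/negP => sub; apply: (quad_two_classes qL (line_circuit (proj1 qL) qinL) (subsetDl _ _) qinL qinL).
  by rewrite setUid; apply: subset_trans sub; apply: subsetDl.
have [cL nL] := proj1 qL.
have dis : [disjoint cls M L q & cls M L r].
  by apply: cls_disj => //; apply: contra nr => /eqP ->; apply: cls_refl.
exists (L :\: cls M L r).
  rewrite deletion_circuit (line_circuit (proj1 qL) rL) /=.
  by move: (dZL); clear=> *; sets.
rewrite properE; apply/andP; split.
  by move: (QL) (s) (dis); clear=> *; sets.
apply/negP => sub.
apply: (quad_two_classes qL (line_circuit (proj1 qL) rL) (subsetDl _ _) qinL qinL).
by rewrite setUid; apply: subset_trans sub s.
Qed.

Lemma delete_path_connected : mconnected N.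
Proof.
have gN : ground N = ground M :\: Z by [].
move=> e f; rewrite gN !inE => /andP [eZ eE] /andP [fZ fE].
have [->|[C [cC eC fC]]] := conn eE fE; first by left.
right; case/delete_path_circuit: cC => [cC|[D [cD QD EC]]|EC].
- by exists C.
- move: eC fC; rewrite EC !inE (negbTE eZ) (negbTE fZ) !orbF => /andP [_ eD] /andP [_ fD].
  by exists D.
- move: eC fC; rewrite EC !inE (negbTE eZ) (negbTE fZ) !orbF => eQ fQ.
  have [D cD /proper_sub/subsetP QD] := path_proper_circuit.
  by exists D; rewrite !QD.
Qed.

Lemma delete_path_ordered : ordered N h.
Proof.
by have [hs hc] := hM; split=> // C; rewrite deletion_circuit => /andP [cC _]; apply: hc.
Qed.

Lemma delete_path_quad : quad N L.
Proof.
have [[[/eqP cL nL] cards] _ _ _ _] := dg.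
have nE (Y : {set T}) : Y \subset L -> nul N Y = nul M Y.
  by move=> sY; rewrite nul_deletion; congr nul; move: (sY) (dZL); clear=> *; sets.
have coreE (Y : {set T}) : Y \subset L -> core N Y = core M Y.
  move=> sY; apply/setP => x; rewrite !in_core !nE //; apply: subset_trans sY; exact: subsetDl.
split; first by split; [apply/eqP; rewrite coreE | rewrite nE].
have -> : cls N L @: L = cls M L @: L; last by [].
apply: eq_imset => x; apply/setP => y; rewrite !in_cls coreE //; exact: subsetDl.
Qed.

Lemma delete_path_ground : #|ground N| < #|ground M|.
Proof.
apply: proper_card; apply/properP; split; first exact: subsetDl.
have [z zZ] := set0Pn _ Z0; exists z; last by rewrite !inE zZ.
by apply: (subsetP (cyc_ground (circuit_cyc cQZ))); rewrite inE zZ orbT.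
Qed.

(** The basepoint must lie outside both ground sets, and [T] may have no spare element. Both
    matroids are moved to [option T], where [None] is the basepoint. *)
Lemma delete_path_obtainable n : obtainable n N -> obtainable n M.
Proof.
have si (K : matroid T) : {in ground K &, injective Some} by move=> x y _ _ [].
move=> oN.
have oA : obtainable n (relabel (si N)) by apply: obtainable_iso oN _; exists Some; apply: relabel_iso.
have [t tQ] := set0Pn _ Q0.
suff oB : obtainable n (relabel (si M)).
  apply: obtainable_iso oB _; exists (odflt t); apply: iso_sym (relabel_iso (si M)) _.
  by [].
apply: obtainable_parallel_path oA _.
have inS x (X : {set T}) : (Some x \in Some @: X) = (x \in X).
  by rewrite mem_imset // => ? ? [].
have NN (X : {set T}) : None \notin Some @: X by apply/imsetP => - [].
have im (C : {set option T}) : circuit (relabel (si N)) C <-> exists2 D, circuit N D & C = Some @: D.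
  exact: iso_circuit (relabel_iso _) C.
have imM (C : {set option T}) : circuit (relabel (si M)) C <-> exists2 D, circuit M D & C = Some @: D.
  exact: iso_circuit (relabel_iso _) C.
have inj : injective (@Some T) by move=> ? ? [].
have gQ : Q \subset ground M :\: Z.
  by have := cyc_ground (circuit_cyc cQZ); move: (dQZ); clear=> *; sets.
have imD (X Y : {set T}) : Some @: (X :\: Y) = Some @: X :\: Some @: Y.
  apply/setP => -[x|]; first by rewrite inE !inS inE.
  by rewrite inE !(negbTE (NN _)) andbF.
have [C0 cC0 pC0] := path_proper_circuit.
apply: (@parallel_path_intro _ _ _ (Some @: Q) (Some @: Z) (Some t) None _ _ _ _ _ _ _ (Some @: C0)).
- by rewrite inS.
- exact: imsetS.
- rewrite -setI_eq0 -imsetI; last by move=> ? ? _ _; apply: inj.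
  by rewrite /= (_ : Z :&: _ = set0) ?imset0 //; clear; sets.
- exact: NN.
- exact: NN.
- by rewrite !card_imset.
- move=> C /im [D cD ->] m; apply: imsetS; move: cD; rewrite deletion_circuit => /andP [cD _].
  apply: unsplit_sub cD (uQ D) _; apply: contra m; rewrite -!setI_eq0 -imsetI; last by move=> ? ? _ _; apply: inj.
  by move=> /eqP ->; rewrite imset0.
- by apply/im; exists C0.
- have [s [x xC xQ]] := properP pC0; apply/properP; split; first exact: imsetS.
  by exists (Some x); rewrite inS.
- rewrite /= -imsetU; suff -> : ground M :\: Z :|: Z = ground M by [].
  apply/setP => x; rewrite !inE.
  case xZ: (x \in Z); rewrite ?orbF ?orbT //=.
  by apply/esym;apply: (subsetP (cyc_ground (circuit_cyc cQZ))); rewrite inE xZ orbT.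
move=> C; rewrite imM; split.
  case=> D /delete_path_circuit [cD ->|[D' [cD' QD' ->]] ->|-> ->].
  - by apply: Or31; apply/im; exists D.
  - apply: Or32; exists (Some @: D'); split; [by apply/im; exists D' | exact: imsetS |].
    by rewrite imsetU imD.
  - by apply: Or33; rewrite imsetU.
case=> [/im [D cD ->]|[D' [/im [D cD ->] sD ->]]|->].
- by exists D => //; apply/delete_path_circuit; apply: Or31.
- have QD : Q \subset D by apply/subsetP => x xQ; rewrite -inS (subsetP sD) // inS.
  exists (D :\: Q :|: Z); first by apply/delete_path_circuit; apply: Or32; exists D.
  by rewrite imsetU imD.
- by exists (Q :|: Z); rewrite ?imsetU.
Qed.

End DeletePath.

(** * From orders to constructions *)

(** The relation is adjacency in some circuit; consistency makes this adjacency in every circuit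
    that contains the pair. *)
Lemma orderable_ordered (T : finType) (M : matroid T) : orderable M -> exists h, ordered M h.
Proof.
case=> O [hO hc].
pose h e f := (e != f) && [exists C, [&& circuit M C, e \in C, f \in C & adjacent (O C) e f]].
exists h; split.
  move=> x y; rewrite /h eq_sym; congr (_ && _); apply: eq_existsb => C.
  by rewrite /adjacent; case: (x \in C); case: (y \in C); case: (x \in O C); case: (y \in O C);
    rewrite ?andbF // orbC.
move=> C cC; have [uC memC] := hO C cC; exists (next (O C)); split.
  split=> [x|x y]; rewrite -!memC => xC; first by rewrite mem_next.
  by move=> yC; rewrite (fconnect_cycle (cycle_next uC) xC).
move=> x y xC yC; rewrite /h; case: (eqVneq x y) => //= xy.
apply/existsP/idP => [[D /and4P [cD xD yD a]]|a].
  have := hc _ _ _ _ xy cD cC _ a; rewrite /adjacent => /(_ _)/and3P [|_ _] //.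
  by apply/subsetP => z; rewrite !inE => /orP [] /eqP ->; rewrite ?xC ?xD ?yC ?yD.
by exists C; rewrite cC xC yC /adjacent !memC xC yC.
Qed.

Lemma minimal_digon (T : finType) (M : matroid T) L Q Z : digon M L Q Z ->
  exists L' Q' Z', digon M L' Q' Z' /\ forall L'' Q'' Z'', digon M L'' Q'' Z'' -> #|Q'| <= #|Q''|.
Proof.
elim: {Q}_.+1 {-2}Q L Z (ltnSn #|Q|) => // m IH Q L Z lt dg.
have [[L' [Q' [Z' [dg' lt']]]]|no] := classic (exists L' Q' Z', digon M L' Q' Z' /\ #|Q'| < #|Q|).
  by apply: IH dg'; apply: leq_trans lt' _.
exists L, Q, Z; split=> // L' Q' Z' dg'; rewrite leqNgt; apply/negP => lt'.
by case: no; exists L', Q', Z'.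
Qed.

Lemma ordered_obtainable (T : finType) (M : matroid T) h L :
  ordered M h -> mconnected M -> quad M L -> exists n, 4 <= n /\ obtainable n M.
Proof.
elim: {M}_.+1 {-2}M L (ltnSn #|ground M|) => // m IH M L lt hM conn qL.
have [[L1 [Q1 [Z1 dg1]]]|no] := classic (exists L Q Z, digon M L Q Z); last first.
  by apply: (no_digon_obtainable hM conn _ qL) => L' Q Z dg; apply: no; exists L', Q, Z.
have [L' [Q [Z [dg min]]]] := minimal_digon dg1.
have uQ C := min_digon_unsplit hM dg min C.
(* [Z] has the size of [Q], so the digon with the roles of the paths exchanged is minimal too. *)
have uZ C : ~~ splits M C Z.
  apply: (min_digon_unsplit hM (digon_sym hM dg)) => L2 Q2 Z2 /min.
  by case: (dg) => _ _ [q qL' s] _ _; have [_ <- _ _] := digon_quad hM dg qL' s.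
have [n [n4 o]] : exists n, 4 <= n /\ obtainable n (deletion M Z).
  apply: (IH _ L').
  - rewrite ltnS in lt; apply: leq_trans lt; exact: delete_path_ground hM dg.
  - exact: delete_path_ordered.
  - exact: delete_path_connected hM conn dg uQ uZ.
  - exact: delete_path_quad dg.
exists n; split=> //; exact: delete_path_obtainable hM dg uQ uZ _ o.
Qed.

Lemma nonbinary_quad (T : finType) (M : matroid T) : ~ binary M -> exists L, quad M L.
Proof.
by move=> nb; apply: NNPP => no; apply: nb; apply: no_quad_binary => L qL; apply: no; exists L.
Qed.

(** * Cyclic covers *)

Import Order.TTheory GRing.Theory Num.Theory.

Lemma cyclic_order (T : finType) (C : {set T}) nx x : cyclic_on C nx -> x \in C ->
  [/\ iter (order nx x) nx x = x, fcycle nx (orbit nx x) & orbit nx x =i C].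
Proof.
move=> cn xC; have hC : {homo nx : x / x \in C} by move=> y; apply: (proj1 cn).
have inj := cyclic_inj cn; split.
- exact: (iter_order_in hC inj).
- exact: (cycle_orbit_in hC inj).
move=> y; rewrite -fconnect_orbit; apply/idP/idP => [/iter_findex <-|yC].
  exact: cyclic_iter.
exact: (proj2 cn).
Qed.

Lemma cyclic_sum (T : finType) (C : {set T}) nx x (F : T -> int) : cyclic_on C nx -> x \in C ->
  (\sum_(y <- traject nx x (order nx x)) F y = \sum_(y in C) F y)%R.
Proof.
move=> cn xC; have [_ _ memC] := cyclic_order cn xC.
rewrite -/(orbit nx x) big_uniq ?orbit_uniq //=; apply: eq_bigl => y; exact: memC.
Qed.

(** Carries a weighted cycle along a bijection; the two maps need to be inverse only between [C] and
    [D]. *)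
Lemma cyclic_transport (T1 T2 : finType) (C : {set T1}) (D : {set T2}) (f : T1 -> T2) (g : T2 -> T1) nx
    (w : T1 -> T1 -> int) : cyclic_on C nx ->
  {in C, forall e, f e \in D} -> {in D, forall x, g x \in C} ->
  {in C, cancel f g} -> {in D, cancel g f} ->
  exists nx', [/\ cyclic_on D nx', {in D &, forall x y, (x != y) && ((nx' x == y) || (nx' y == x)) =
      (g x != g y) && ((nx (g x) == g y) || (nx (g y) == g x))}
    & (\sum_(x in D) w (g x) (g (nx' x)) = \sum_(e in C) w e (nx e))%R].
Proof.
move=> cn fC gD fK gK; pose nx' x := f (nx (g x)).
have nC e : e \in C -> nx e \in C by apply: (proj1 cn).
have it n x : x \in D -> iter n nx' x = f (iter n nx (g x)).
  move=> xD; elim: n => [|n IH] /=; first by rewrite gK.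
  by rewrite IH /nx' fK //; apply: cyclic_iter => //; apply: gD.
have inj : {in D &, injective g} by apply: can_in_inj gK.
exists nx'; split.
- split=> [x xD|x y xD yD]; first by apply: fC; apply: nC; apply: gD.
  have [n E] := cyclic_reach cn (gD x xD) (gD y yD).
  have <- : iter n nx' x = y by rewrite it // -E gK.
  exact: fconnect_iter.
- move=> x y xD yD; rewrite (inj_in_eq inj) //.
  have E u v : u \in D -> v \in D -> (nx (g u) == g v) = (nx' u == v).
    by move=> uD vD; rewrite /nx'; apply/eqP/eqP => [->|<-]; rewrite ?gK ?fK ?nC ?gD.
  by rewrite !E.
have gC : g @: D = C.
  apply/setP => e; apply/imsetP/idP => [[x xD ->]|eC]; first exact: gD.
  by exists (f e); rewrite ?fC ?fK.
by rewrite -gC big_imset //=; apply: eq_bigr => x xD; rewrite /nx' fK ?nC ?gD.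
Qed.

Section Cover.
Local Open Scope ring_scope.
Variables (T1 T2 : finType) (proj : T2 -> T1) (idx : T2 -> int) (k : nat).
Variables (h : rel T1) (w : T1 -> T1 -> int).
Implicit Types (e f : T1) (x y : T2) (C : {set T1}) (D : {set T2}).

(* [h] and [w] are the adjacency and the voltages of a base graph; a point x lies over [proj x] at
   height [idx x] modulo k, and each edge e -> f lifts to the edges that climb by [w e f]. *)
Definition climbs x y : bool := (k %| idx y - idx x - w (proj x) (proj y))%Z.

Definition cover_rel x y : bool := h (proj x) (proj y) && (climbs x y || climbs y x).

(** The carry: how often the height wraps around modulo [k] when climbing from [x] to [y]. The
    division is exact when the step climbs, and [cover_weight] gives a step that does not climb
    minus the carry of its reverse. *)
Definition excess x y : int := ((w (proj x) (proj y) - (idx y - idx x)) %/ k)%Z.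

Definition cover_weight x y : int := if climbs x y then excess x y else - excess y x.

Lemma cover_rel_sym : symmetric h -> symmetric cover_rel.
Proof. by move=> hs x y; rewrite /cover_rel hs orbC. Qed.

Lemma excessE x y : climbs x y -> excess x y * k = w (proj x) (proj y) - (idx y - idx x).
Proof. by rewrite /climbs -rpredN => d; apply/eqP; rewrite -dvdz_eq; congr (_ %| _)%Z: d; ring. Qed.

Lemma climbs_opp x y : w (proj y) (proj x) = - w (proj x) (proj y) -> climbs y x = climbs x y.
Proof. by move=> E; rewrite /climbs E -rpredN; congr (_ %| _)%Z; ring. Qed.

Hypothesis k0 : (0 < k)%N.

Let kz : (k : int) != 0. Proof. by lia. Qed.

(** If the base weights are opposite, a step climbs iff its reverse does, and the carries are
    opposite. On a two-element circuit the base weights sum to 1 or -1, which [k] does not divide,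
    so just one direction climbs and [cover_weight] is antisymmetric by definition. *)
Lemma cover_weight_opp x y : cover_rel x y ->
  w (proj y) (proj x) = - w (proj x) (proj y) \/
    (1 < k)%N /\ `|w (proj x) (proj y) + w (proj y) (proj x)| = 1 ->
  cover_weight y x = - cover_weight x y.
Proof.
rewrite /cover_rel /cover_weight => /andP [_ c] [E|[k1 E]].
  have cc := climbs_opp E; rewrite cc orbb in c; rewrite cc c.
  apply: (mulIf kz); rewrite mulNr !excessE ?cc // E; ring.
case cxy: (climbs x y); case cyx: (climbs y x); rewrite ?opprK //; last by rewrite cxy cyx in c.
have : (k %| w (proj x) (proj y) + w (proj y) (proj x))%Z.
  rewrite -rpredN; move: cxy cyx; rewrite /climbs => a b.
  by have := rpredD a b; congr (_ %| _)%Z; ring.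
rewrite dvdzE; move: E; move: (_ + _)%R => u E; have -> : (absz u = 1)%N by lia.
by rewrite dvdn1; lia.
Qed.

Section Lift.
Variables (C : {set T1}) (D : {set T2}) (nx : T1 -> T1) (pt : T1 -> int -> T2).
Hypothesis cn : cyclic_on C nx.
Hypothesis C1 : (1 < #|C|)%N.
Hypothesis hC : {in C &, forall e f, h e f = (e != f) && ((nx e == f) || (nx f == e))}.
Hypothesis wC : `|\sum_(e in C) w e (nx e)| = 1.
Hypothesis wopp : {in C, forall e, nx (nx e) != e -> w (nx e) e = - w e (nx e)}.
Hypothesis projD : {in D, forall x, proj x \in C}.
Hypothesis ptD : {in C, forall e z, pt e z \in D}.
Hypothesis proj_pt : {in C, forall e z, proj (pt e z) = e}.
Hypothesis idx_pt : {in C, forall e z, (k %| idx (pt e z) - z)%Z}.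
Hypothesis ptE : {in D &, forall x y, proj x = proj y -> (k %| idx x - idx y)%Z -> x = y}.
Hypothesis fiber : {in C, forall e, #|[set x in D | proj x == e]| = k}.

Let nx' x := pt (nx (proj x)) (idx x + w (proj x) (nx (proj x))).
Let s := \sum_(e in C) w e (nx e).

Let nxC e : e \in C -> nx e \in C. Proof. exact: (proj1 cn). Qed.

Let nx_neq e : e \in C -> nx e != e.
Proof.
move=> eC; apply/eqP => E; have := @cyclic_period _ C nx e 1 cn eC isT E.
by rewrite leqNgt C1.
Qed.

Let nx'D x : x \in D -> nx' x \in D.
Proof. by move=> xD; apply: ptD; apply: nxC; apply: projD. Qed.

Let proj_nx' x : x \in D -> proj (nx' x) = nx (proj x).
Proof. by move=> xD; apply: proj_pt; apply: nxC; apply: projD. Qed.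

Let climbs_nx' x : x \in D -> climbs x (nx' x).
Proof.
move=> xD; rewrite /climbs proj_nx' //; have := idx_pt (nxC (projD xD)) (idx x + w (proj x) (nx (proj x))).
by rewrite -/(nx' x); congr (_ %| _)%Z; ring.
Qed.

Let nx'E x y : x \in D -> y \in D -> (nx' x == y) = (nx (proj x) == proj y) && climbs x y.
Proof.
move=> xD yD; apply/eqP/andP => [<-|[/eqP E c]].
  by rewrite proj_nx' // eqxx climbs_nx'.
apply: ptE => //; [exact: nx'D | by rewrite proj_nx' | ].
have := rpredB (climbs_nx' xD) c; rewrite proj_nx' // E.
by congr (_ %| _)%Z; ring.
Qed.

Let iter_nx' n x : x \in D -> [/\ iter n nx' x \in D, proj (iter n nx' x) = iter n nx (proj x)
  & (k %| idx (iter n nx' x) - (idx x + \sum_(e <- traject nx (proj x) n) w e (nx e)))%Z].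
Proof.
elim: n x => [|n IH] x xD; first by rewrite /= big_nil addr0 subrr dvdz0.
have [a b c] := IH (nx' x) (nx'D xD); rewrite proj_nx' // in b c.
rewrite !iterSr b; split=> //.
rewrite /= big_cons; have := rpredD c (climbs_nx' xD); rewrite proj_nx' //.
by congr (_ %| _)%Z; ring.
Qed.

(** One full turn around [C] comes back over the same element, raised by the total voltage [s]. *)
Let turn x n : x \in D -> exists m, [/\ iter m nx' x \in D, proj (iter m nx' x) = proj x
  & (k %| idx (iter m nx' x) - (idx x + s *+ n))%Z].
Proof.
move=> xD; have eC := projD xD; have [it _ _] := cyclic_order cn eC.
elim: n => [|n [m [a b c]]]; first by exists 0%N; rewrite /= mulr0n addr0 subrr dvdz0.
have [a' b' c'] := iter_nx' (order nx (proj x)) a.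
exists (order nx (proj x) + m)%N; rewrite iterD; split=> //; first by rewrite b' b it.
rewrite b (cyclic_sum _ cn eC) -/s in c'; have := rpredD c' c.
by rewrite mulrS; congr (_ %| _)%Z; ring.
Qed.

Let nx'_connect x y : x \in D -> y \in D -> fconnect nx' x y.
Proof.
move=> xD yD; have [n E] := cyclic_reach cn (projD xD) (projD yD).
have [zD Ez _] := iter_nx' n xD; move: zD Ez; set z := iter n nx' x; rewrite -E => zD Ez.
apply: (connect_trans (fconnect_iter nx' n x)); rewrite -/z.
(* Since [s] is 1 or -1, it is its own inverse; this many turns, each worth [s], make up the
   difference in height modulo [k]. *)
pose a := ((idx y - idx z) * s %% k)%Z.
pose q := ((idx y - idx z) * s %/ k)%Z.
have a0 : 0 <= a by apply: modz_ge0.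
have [m [mD Em Im]] := turn `|a|%N zD.
suff <- : iter m nx' z = y by apply: fconnect_iter.
apply: ptE => //; first by rewrite Em.
have ss : s * s = 1 by move: wC; rewrite -/s; case: (ler0P s) => _ E1; nia.
have Ea : s *+ `|a|%N = idx y - idx z - q * s * k.
  rewrite -mulr_natr natz gez0_abs // /a /modz mulrBr.
  have -> : s * ((idx y - idx z) * s) = idx y - idx z by rewrite mulrC -mulrA ss mulr1.
  by rewrite -/q; congr (_ + _); ring.
have := rpredB Im (dvdz_mull (q * s) (dvdzz k)).
by rewrite Ea; congr (_ %| _)%Z; ring.
Qed.

Let sumD (F : T1 -> int) : \sum_(x in D) F (proj x) = (\sum_(e in C) F e) *+ k.
Proof.
rewrite (partition_big proj (mem C)) //= -sumrMnl; apply: eq_bigr => e eC.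
rewrite (eq_bigr (fun=> F e)); last by move=> x /andP [_ /eqP ->].
by rewrite sumr_const -[in RHS](fiber eC); congr (_ *+ _); apply: eq_card => x; rewrite !inE.
Qed.

(** A unit total voltage lets the lift reach every height, so it is a single cycle. The sum of the
    carries is again the total voltage: base weights are counted [k] times, height differences
    cancel around the cycle, and the result is divided by [k]. *)
Lemma cover_cyclic : exists nx'', [/\ cyclic_on D nx'',
  {in D &, forall x y, cover_rel x y = (x != y) && ((nx'' x == y) || (nx'' y == x))}
  & \sum_(x in D) cover_weight x (nx'' x) = \sum_(e in C) w e (nx e)].
Proof.
have cn' : cyclic_on D nx' by split=> x; [apply: nx'D | apply: nx'_connect].
exists nx'; split=> //.
- move=> x y xD yD; have xC := projD xD; have yC := projD yD.
  rewrite /cover_rel hC // !nx'E //.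
  have -> : (proj x != proj y) && ((nx (proj x) == proj y) || (nx (proj y) == proj x)) =
      (nx (proj x) == proj y) || (nx (proj y) == proj x).
    case: eqVneq => //= <-; by rewrite orbb (negbTE (nx_neq xC)).
  have -> : (x != y) && ((nx (proj x) == proj y) && climbs x y || (nx (proj y) == proj x) && climbs y x) =
      (nx (proj x) == proj y) && climbs x y || (nx (proj y) == proj x) && climbs y x.
    by case: eqVneq => //= <-; rewrite orbb (negbTE (nx_neq xC)).
  have opp u v : u \in C -> v \in C -> nx u = v -> nx v != u -> w v u = - w u v.
    by move=> uC vC <-; apply: wopp.
  case: eqVneq => [E1|N1]; case: eqVneq => [E2|N2] //=; rewrite ?orbF.
    by rewrite (climbs_opp (opp _ _ xC yC E1 N2)) orbb.
  by rewrite (climbs_opp (opp _ _ yC xC E2 N1)) orbb.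
have E x : x \in D -> cover_weight x (nx' x) * k = w (proj x) (nx (proj x)) - (idx (nx' x) - idx x).
  by move=> xD; rewrite /cover_weight climbs_nx' // excessE ?climbs_nx' // proj_nx'.
apply: (mulIf kz); rewrite mulr_suml (eq_bigr _ E) sumrB sumrB (sumD (fun e => w e (nx e))).
have -> : \sum_(x in D) idx x = \sum_(x in D) idx (nx' x).
  by rewrite -{1}(cyclic_img cn') big_imset //; apply: cyclic_inj.
by rewrite subrr subr0 -mulr_natr natz.
Qed.

End Lift.
End Cover.

(** * From constructions to orders *)

Section SeriesCircuit.
Variables (T1 T2 : finType) (M1 : matroid T1) (M2 : matroid T2) (S : T1 -> {set T2}) (r : T1 -> T2).
Hypothesis gM2 : ground M2 = \bigcup_(e in ground M1) S e.
Hypothesis ser : {in ground M1, forall e, {in S e &, forall x y, x != y -> in_series M2 x y}}.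
Hypothesis rS : {in ground M1, forall e, r e \in S e}.
Hypothesis iso : matroid_iso r M1 (contraction M2 (ground M2 :\: r @: ground M1)).
Implicit Types (C : {set T1}) (D : {set T2}).

Let inS D e x y : circuit M2 D -> e \in ground M1 -> x \in S e -> y \in S e -> x \in D -> y \in D.
Proof.
move=> cD eE xS yS xD; have [<- //|ne] := eqVneq x y.
by have /in_seriesP [_ _ <-] := ser eE xS yS ne.
Qed.

Let base D := [set e in ground M1 | r e \in D].

Let baseE D : circuit M2 D -> D = \bigcup_(e in base D) S e.
Proof.
move=> cD; apply/setP => x; apply/idP/bigcupP => [xD|[e]].
  have := subsetP (cyc_ground (circuit_cyc cD)) x xD; rewrite gM2 => /bigcupP [e eE xS].
  by exists e => //; rewrite inE eE (inS cD eE xS (rS eE) xD).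
by rewrite inE => /andP [eE rD] xS; apply: inS cD eE (rS eE) xS rD.
Qed.

Let dep C : C \subset ground M1 -> ~~ indep M1 C <-> exists2 D, circuit M2 D & base D \subset C.
Proof.
have [inj _ ind] := iso => sC; rewrite ind //.
set X := ground M2 :\: r @: ground M1.
have sX : X \subset ground M2 by apply: subsetDl.
have rE e : e \in ground M1 -> r e \in ground M2.
  by move=> eE; rewrite gM2; apply/bigcupP; exists e => //; apply: rS.
have sub D (B : {set T1}) : circuit M2 D -> B \subset ground M1 ->
    (D \subset X :|: r @: B) = (base D \subset B).
  move=> cD sB; apply/subsetP/subsetP => s.
    move=> e; rewrite inE => /andP [eE /s]; rewrite !inE imset_f //= => /imsetP [f fC].
    by move/inj => -> //; apply: (subsetP sB).
  move=> x xD; have xE := subsetP (cyc_ground (circuit_cyc cD)) x xD.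
  rewrite !inE xE andbT; case: (boolP (x \in r @: ground M1)) => //= /imsetP [e eE Ex].
  by rewrite Ex imset_f // s // inE eE -Ex.
have nX : nul M2 X = 0.
  apply: nul_circuit_sub => D cD; apply/negP => s.
  have s' : D \subset X :|: r @: (set0 : {set T1}) by apply: subset_trans s (subsetUl _ _).
  have := baseE cD; rewrite sub ?sub0set // subset0 in s'; rewrite (eqP s') big_set0.
  by have [x xD] := circuit_n0 cD => E; rewrite E inE in xD.
have sI : r @: C \subset ground M2 :\: X.
  apply/subsetP => _ /imsetP [e eC ->]; have eE := subsetP sC e eC.
  by rewrite !inE rE // imset_f.
rewrite contraction_indep // sI nX /= -lt0n; split=> [/nul_circuit [D cD s]|[D cD s]].
  by exists D => //; rewrite -sub.
by rewrite -(circuit_nul1 cD); apply: nulS; rewrite sub.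
Qed.

(** A circuit of [M2] contains each [S e] entirely or not at all, so it is determined by which
    representatives [r e] it contains; dependence in the contraction only sees these. *)
Lemma series_circuit D : circuit M2 D <-> exists2 C, circuit M1 C & D = \bigcup_(e in C) S e.
Proof.
have sub X : base X \subset ground M1 by apply/subsetP => e; rewrite inE => /andP [].
split=> [cD|[C /minsetP [/andP [sC /(dep sC) [D' cD' s]] mC] ->]].
  have nd : ~~ indep M1 (base D) by apply/(dep (sub D)); exists D.
  exists (base D); last exact: baseE.
  apply/minsetP; split; first by rewrite sub.
  move=> C /andP [sC /(dep sC) [D' cD' s]] sCD.
  have sDD : D' \subset D.
    rewrite (baseE cD') (baseE cD); apply/bigcupsP => e eb; apply: bigcup_sup.
    by apply: (subsetP sCD); apply: (subsetP s).
  have E := circuit_eq cD' cD sDD; rewrite E in s.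
  by apply/eqP; rewrite eqEsubset sCD.
rewrite -(mC (base D')) -?baseE //.
by rewrite sub; apply/(dep (sub D')); exists D'.
Qed.

End SeriesCircuit.

(** * Orderings with weights *)

Section Winding.
Local Open Scope ring_scope.

(* [w x y] is the displacement of the step from [x] to [y]; going once around a circuit makes a net
   turn of one, which is what makes the covers of a circuit connected. *)
Record winding (T : finType) (M : matroid T) (h : rel T) (w : T -> T -> int) : Prop := Winding {
  winding_sym : symmetric h;
  winding_card : forall C, circuit M C -> (1 < #|C|)%N;
  winding_cyclic : forall C, circuit M C -> exists nx, [/\ cyclic_on C nx,
    {in C &, forall x y, h x y = (x != y) && ((nx x == y) || (nx y == x))}
    & `|\sum_(x in C) w x (nx x)| = 1];
  winding_opp : forall x y, h x y -> ~~ circuit M [set x; y] -> w y x = - w x y;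
  winding_sep : forall x y, h x y -> exists2 C, circuit M C & (x \in C) != (y \in C) }.

Lemma winding_ordered (T : finType) (M : matroid T) h w : winding M h w -> ordered M h.
Proof.
by case=> hs _ hc _ _; split=> // C /hc [nx [cn hn _]]; exists nx.
Qed.

Lemma winding_empty (T : finType) (M : matroid T) : (forall C, ~~ circuit M C) ->
  winding M (fun _ _ => false) (fun _ _ => 0).
Proof. by move=> no; split=> // C cC; have := no C; rewrite cC. Qed.

Section Facts.
Variables (T : finType) (M : matroid T) (h : rel T) (w : T -> T -> int).
Hypothesis W : winding M h w.
Implicit Types (C : {set T}) (x y : T).

(** If [x] and its successor formed a circuit, it would be all of [C], and two steps would lead back
    to [x]. *)
Lemma winding_next_opp C nx x : circuit M C -> cyclic_on C nx ->
  {in C &, forall x y, h x y = (x != y) && ((nx x == y) || (nx y == x))} ->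
  x \in C -> nx (nx x) != x -> w (nx x) x = - w x (nx x).
Proof.
move=> cC cn hn xC nn; have nC := proj1 cn x xC; have nnC := proj1 cn _ nC.
have neq y : y \in C -> nx y != y.
  move=> yC; apply/eqP => E; have := @cyclic_period _ C nx y 1 cn yC isT E.
  by rewrite leqNgt (winding_card W cC).
apply: (winding_opp W); first by rewrite hn // eqxx eq_sym neq.
apply/negP => c2; have s : [set x; nx x] \subset C.
  by apply/subsetP => y; rewrite !inE => /orP [] /eqP ->.
by move: nnC; rewrite -(circuit_eq c2 cC s) !inE (negbTE nn) (negbTE (neq _ nC)).
Qed.

Lemma winding_pair x y : h x y -> circuit M [set x; y] -> `|w x y + w y x| = 1.
Proof.
move=> hxy c2; have [nx [cn hn sn]] := winding_cyclic W c2.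
have x2 : x \in [set x; y] by rewrite !inE eqxx.
have y2 : y \in [set x; y] by rewrite !inE eqxx orbT.
have xy : x != y by apply: contraTneq hxy => ->; rewrite hn // eqxx.
have neq z : z \in [set x; y] -> nx z != z.
  move=> zC; apply/eqP => E; have := @cyclic_period _ _ nx z 1 cn zC isT E.
  by rewrite leqNgt (winding_card W c2).
have nxx : nx x = y by have := proj1 cn x x2; rewrite !inE (negbTE (neq x x2)) => /eqP.
have nxy : nx y = x by have := proj1 cn y y2; rewrite !inE (negbTE (neq y y2)) orbF => /eqP.
by move: sn; rewrite big_setU1 ?inE //= big_set1 nxx nxy.
Qed.

End Facts.

Lemma winding_iso (T1 T2 : finType) (f : T1 -> T2) (g : T2 -> T1) (M1 : matroid T1) (M2 : matroid T2) h w :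
  matroid_iso f M1 M2 -> {in ground M1, cancel f g} -> winding M1 h w ->
  winding M2 (fun x y => [&& x \in ground M2, y \in ground M2 & h (g x) (g y)])
    (fun x y => w (g x) (g y)).
Proof.
move=> iso fK W; have iso' := iso_sym iso fK; have [_ fE _] := iso.
have gK : {in ground M2, cancel g f}.
  by move=> y; rewrite -fE => /imsetP [x xE ->]; rewrite fK.
have gE x : x \in ground M2 -> g x \in ground M1.
  by case: iso' => _ <- _ xE; apply: imset_f.
have img (C : {set T2}) x : C \subset ground M2 -> x \in ground M2 -> (g x \in g @: C) = (x \in C).
  move=> sC xE; apply/imsetP/idP => [[y yC E]|xC]; last by exists x.
  by rewrite -(gK x xE) E (gK y (subsetP sC y yC)).
have sub C : circuit M2 C -> C \subset ground M2 by move/circuit_cyc/cyc_ground.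
split.
- by move=> x y; rewrite (winding_sym W) andbCA.
- move=> C cC; have := winding_card W (iso_circuit_imset iso' cC).
  by move/leq_trans; apply; apply: leq_imset_card.
- move=> C cC; have cgC := iso_circuit_imset iso' cC.
  have sC := sub C cC; have [nx [cn hn sn]] := winding_cyclic W cgC.
  have [|||| nx' [cn' hn' sn']] := @cyclic_transport _ _ _ C f g nx w cn.
  + by move=> _ /imsetP [x xC ->]; rewrite gK // (subsetP sC).
  + by move=> x xC; apply: imset_f.
  + by move=> _ /imsetP [x xC ->]; rewrite gK // (subsetP sC).
  + by move=> x xC; rewrite gK // (subsetP sC).
  exists nx'; split=> //; last by rewrite sn'.
  by move=> x y xC yC; rewrite (subsetP sC x xC) (subsetP sC y yC) hn' //= hn // imset_f.
- move=> x y /and3P [xE yE hxy] nc; apply: (winding_opp W hxy); apply: contra nc.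
  by move/(iso_circuit_imset iso); rewrite imsetU1 imset_set1 !gK.
- move=> x y /and3P [xE yE] /(winding_sep W) [C cC ne].
  have [D cD E] := proj1 (iso_circuit iso' C) cC; exists D => //.
  by move: ne; rewrite E !img ?sub.
Qed.

End Winding.

(** The new circuits are k-fold covers of the old: [proj] sends an element to the one it replaces,
    [idx] is its place in the enumeration of [S e], and [pt] finds the element over [e] at a given
    height modulo k. *)
Lemma winding_series (T1 T2 : finType) (M1 : matroid T1) (M2 : matroid T2) h w :
  winding M1 h w -> balanced_series_extension M1 M2 -> exists h' w', winding M2 h' w'.
Proof.
move=> W [_ [k [S [k1 gM2 dS hS [r rS iso]]]]].
have ser : {in ground M1, forall e, {in S e &, forall x y, x != y -> in_series M2 x y}}.
  by move=> e /hS [].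
have cardS e : e \in ground M1 -> #|S e| = k by move=> /hS [].
have cE := series_circuit gM2 ser rS iso.
have sub1 C : circuit M1 C -> C \subset ground M1 by move/circuit_cyc/cyc_ground.
(* [proj] needs a default value, which an empty ground set cannot supply. *)
have [E0|[e0 e0E]] := set_0Vmem (ground M1).
  exists (fun _ _ => false), (fun _ _ => 0%R); apply: winding_empty => D; apply/negP => /cE [C cC _].
  by have [e eC] := circuit_n0 cC; have := subsetP (sub1 C cC) e eC; rewrite E0 inE.
pose proj x := odflt e0 [pick e in ground M1 | x \in S e].
have projE e x : e \in ground M1 -> x \in S e -> proj x = e.
  move=> eE xe; rewrite /proj; case: pickP => [f /andP [fE xf]|/(_ e)]; last by rewrite /= eE xe.
  by apply/eqP; apply: contraTT xf => /= ne; rewrite (disjointFl (dS _ _ fE eE ne) xe).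
have projP x : x \in ground M2 -> proj x \in ground M1 /\ x \in S (proj x).
  by rewrite gM2 => /bigcupP [e eE xe]; rewrite (projE e).
pose idx x : int := index x (enum (S (proj x))).
pose pt e (z : int) := nth (r e0) (enum (S e)) `|(z %% k)%Z|%N.
have kz : (k : int) != 0%R by lia.
have modk (z : int) : (`|(z %% k)%Z| < k)%N.
  by have := modz_ge0 z kz; have := ltz_pmod z (_ : (0 < k :> int)%R); lia.
have ptS e z : e \in ground M1 -> pt e z \in S e.
  by move=> eE; rewrite /pt -mem_enum mem_nth // -cardE cardS.
have idx_pt e z : e \in ground M1 -> (k %| (idx (pt e z) - z)%R)%Z.
  move=> eE; rewrite /idx (projE e) ?ptS // /pt index_uniq ?enum_uniq -?cardE ?cardS //.
  by rewrite gez0_abs ?modz_ge0 // -eqz_mod_dvd modz_mod.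
have memD (C : {set T1}) x : C \subset ground M1 -> x \in ground M2 ->
    (x \in \bigcup_(e in C) S e) = (proj x \in C).
  move=> sC xE; have [pE xp] := projP x xE; apply/bigcupP/idP => [[e eC xe]|pC].
    by rewrite (projE e) // (subsetP sC).
  by exists (proj x).
exists (fun x y => [&& x \in ground M2, y \in ground M2 & cover_rel proj idx k h w x y]).
exists (cover_weight proj idx k w); split.
- by move=> x y; rewrite (cover_rel_sym _ _ _ _ (winding_sym W)) andbCA.
- move=> D /cE [C cC ->]; have [e eC] := circuit_n0 cC.
  apply: leq_trans k1 _; rewrite -(cardS e (subsetP (sub1 C cC) e eC)).
  by apply: subset_leq_card; apply: bigcup_sup.
- move=> D cD; have sD := cyc_ground (circuit_cyc cD).
  have [C cC ED] := proj1 (cE D) cD; have sC := sub1 C cC.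
  have [nx [cn hn sn]] := winding_cyclic W cC.
  have inD x : (x \in D) = (x \in ground M2) && (proj x \in C).
    case xE: (x \in ground M2); last by apply: contraFF xE => /(subsetP sD).
    by rewrite ED memD.
  have Sg e x : e \in ground M1 -> x \in S e -> x \in ground M2.
    by move=> eE xe; rewrite gM2; apply/bigcupP; exists e.
  case: (@cover_cyclic _ _ proj idx k h w _ C D nx pt cn _ hn sn).
  + by lia.
  + exact: (winding_card W cC).
  + by move=> e eC; apply: (winding_next_opp W cC cn hn).
  + by move=> x; rewrite inD => /andP [].
  + move=> e eC z; have eE := subsetP sC e eC; rewrite inD (projE e) ?ptS // eC andbT.
    by apply: (Sg e); rewrite ?ptS.
  + by move=> e /(subsetP sC) eE z; rewrite (projE e) ?ptS.
  + by move=> e /(subsetP sC) eE z; apply: idx_pt.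
  + move=> x y; rewrite !inD => /andP [xE _] /andP [yE _] E d.
    have [pE xp] := projP x xE; have [_ yp] := projP y yE; rewrite -E in yp.
    have sz u : u \in S (proj x) -> (index u (enum (S (proj x))) < k)%N.
      by move=> up; rewrite -(cardS (proj x) pE) cardE index_mem mem_enum.
    have lx := sz x xp; have ly := sz y yp.
    rewrite -eqz_mod_dvd /idx -E !modz_nat !modn_small // in d.
    move/eqP: d => [d].
    by rewrite -(nth_index x (_ : x \in enum (S (proj x)))) ?mem_enum // d nth_index ?mem_enum.
  + move=> e eC; have eE := subsetP sC e eC; rewrite -(cardS e eE); apply: eq_card => x.
    rewrite !inE inD; apply/andP/idP => [[/andP [xE _] /eqP <-]|xe]; first by case: (projP x xE).
    by rewrite (projE e) // eqxx eC (Sg e).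
  move=> nx' [cn' hn' sn']; exists nx'; split=> //; last by rewrite sn'.
  by move=> x y xD yD; rewrite -hn' // !(subsetP sD).
- move=> x y /and3P [xE yE c] _; apply: cover_weight_opp; rewrite ?(ltnW k1) //; first exact: c.
  have hxy : h (proj x) (proj y) by case/andP: c.
  have [c2|nc] := boolP (circuit M1 [set proj x; proj y]); last by left; apply: (winding_opp W).
  by right; split=> //; apply: (winding_pair W).
- move=> x y /and3P [xE yE /andP [/(winding_sep W) [C cC ne] _]].
  exists (\bigcup_(e in C) S e); first by apply/cE; exists C.
  by rewrite !memD ?sub1.
Qed.

Lemma ordered_orderable (T : finType) (M : matroid T) h : ordered M h -> orderable M.
Proof.
move=> [hs hc].
pose ok (C : {set T}) s := [&& uniq s, [forall x, (x \in s) == (x \in C)]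
  & [forall x in C, forall y in C, (x != y) ==> (adjacent s x y == h x y)]].
pose O (C : {set T}) := if [pick s : #|C|.-tuple T | ok C s] is Some s then tval s else [::].
have okO C : circuit M C -> ok C (O C).
  move=> cC; rewrite /O; case: pickP => [s //|no]; exfalso.
  have [nx [cn hn]] := hc C cC; have [x xC] := circuit_n0 cC.
  have [_ fc memC] := cyclic_order cn xC.
  have sz : size (orbit nx x) == #|C|.
    by rewrite -(card_uniqP (orbit_uniq nx x)); apply/eqP/eq_card.
  have := no (Tuple sz); rewrite /ok /= orbit_uniq /= => /negbT /negP; apply.
  apply/andP; split; first by apply/forallP => y; rewrite memC.
  apply/forall_inP => y yC; apply/forall_inP => z zC; apply/implyP => yz.
  rewrite /adjacent !memC yC zC hn // yz /=.
  have E u : u \in C -> next (orbit nx x) u = nx u.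
    by rewrite -memC => uo; apply/esym/eqP; apply: next_cycle fc uo.
  by rewrite !E.
exists O; split=> [C /okO /and3P [u /forallP m _]|e f C D ef cC cD].
  by split=> // x; apply/eqP.
rewrite subsetI => /andP [/subsetP sC /subsetP sD].
have [eC fC] : e \in C /\ f \in C by rewrite !sC // !inE eqxx ?orbT.
have [eD fD] : e \in D /\ f \in D by rewrite !sD // !inE eqxx ?orbT.
have adj B : circuit M B -> e \in B -> f \in B -> adjacent (O B) e f = h e f.
  case/okO/and3P => _ _ /forall_inP H eB fB; have /forall_inP := H e eB.
  by move=> /(_ f fB); rewrite ef => /eqP.
by rewrite !adj.
Qed.

(** * The base case U_{2,n} *)

Section Uniform.
Variable n : nat.
Hypothesis n4 : 3 < n.
Implicit Types C : {set 'I_n}.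

Lemma uniform2_circuit C : circuit (uniform 2 n) C = (#|C| == 3).
Proof.
apply/minsetP/eqP => [[]|C3].
  rewrite /= subsetT /= /uniform_indep -ltnNge => C3 mC; apply/eqP; rewrite eqn_leq C3 andbT leqNgt.
  apply/negP => C4; have [x xC] : exists x, x \in C by apply/set0Pn; rewrite -card_gt0; lia.
  have cD : #|C| = #|C :\ x|.+1 by rewrite (cardsD1 x) xC.
  have := mC (C :\ x); rewrite subsetT -ltnNge subD1set => E.
  have {}E : C :\ x = C by apply: E => //; rewrite /= -ltnS -cD.
  by move: cD; rewrite E => /eqP; rewrite -{1}[#|C|]addn0 -addn1 eqn_add2l.
split; first by rewrite /= subsetT /uniform_indep C3.
move=> D /andP [_ D3] sDC; apply/eqP; rewrite eqEcard sDC C3.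
by move: D3; rewrite /= /uniform_indep -ltnNge.
Qed.

(** Circuits are triples. Going around a triple there are two ascents and one descent or the
    reverse, so the signs sum to 1 or -1. *)
Lemma winding_uniform : winding (uniform 2 n) (fun x y => x != y)
  (fun x y : 'I_n => if (x < y)%N then 1 else -1)%R.
Proof.
split.
- by move=> x y; rewrite eq_sym.
- by move=> C; rewrite uniform2_circuit => /eqP ->.
- move=> C; rewrite uniform2_circuit => C3.
  have [a aC] : exists a, a \in C by apply/set0Pn; rewrite -card_gt0 (eqP C3).
  have := cardsD1 a C; rewrite aC (eqP C3) => /= -[/esym/eqP/cards2P [b [c [bc E]]]].
  have [ab ac] : a != b /\ a != c.
    by split; apply/negP => /eqP Ea; have := setD11 a C; rewrite E !inE Ea eqxx ?orbT.
  have EC : C = a |: [set b; c] by rewrite -E setD1K.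
  pose nx x := if x == a then b else if x == b then c else a.
  have na : nx a = b by rewrite /nx eqxx.
  have nb : nx b = c by rewrite /nx eq_sym (negbTE ab) eqxx.
  have nc : nx c = a by rewrite /nx eq_sym (negbTE ac) eq_sym (negbTE bc).
  have inC x : x \in C -> [\/ x = a, x = b | x = c].
    by rewrite EC !inE => /or3P [] /eqP; [apply: Or31 | apply: Or32 | apply: Or33].
  exists nx; split.
  + split=> [x /inC [] ->|x y /inC hx /inC hy]; rewrite ?na ?nb ?nc ?EC ?inE ?eqxx ?orbT //.
    have c1 x' : fconnect nx x' (nx x') by apply: fconnect1.
    have [cab cbc cca] : [/\ fconnect nx a b, fconnect nx b c & fconnect nx c a].
      by have := c1 a; have := c1 b; have := c1 c; rewrite na nb nc.
    have cac := connect_trans cab cbc; have cba := connect_trans cbc cca.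
    have ccb := connect_trans cca cab.
    by case: hx hy => -> [] ->; rewrite ?connect0.
  + move=> x y /inC hx /inC hy; rewrite -[LHS]andbT; case: eqVneq => //= ne; apply/esym.
    by case: hx hy ne => -> [] ->; rewrite ?na ?nb ?nc ?eqxx ?orbT.
  + rewrite EC big_setU1 ?inE ?negb_or ?ab //= big_setU1 ?inE //= big_set1 na nb nc.
    move: ab ac bc; rewrite -!(inj_eq val_inj) /=.
    case: (ltngtP a b) => // ab'; case: (ltngtP b c) => // bc'; case: (ltngtP c a) => // ca' _ _ _.
      by have := ltn_trans (ltn_trans ab' bc') ca'; rewrite ltnn.
    by have := ltn_trans (ltn_trans ca' bc') ab'; rewrite ltnn.
- move=> x y; rewrite -(inj_eq val_inj) /= => ne _.
  by case: ltngtP ne => // _; rewrite opprK.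
move=> x y ne.
(* As n is at least 4, two elements remain besides [x] and [y]; together with [x] they form a
   circuit without [y]. *)
have : 1 < #|[set: 'I_n] :\: [set x; y]|.
  have := cardsID [set x; y] [set: 'I_n]; rewrite setTI cardsT card_ord cards2 ne; lia.
case/card_gt1P => a [b [aD bD ab]]; move: aD bD; rewrite !inE !negb_or !andbT => /andP [ax ay] /andP [bx by'].
exists (x |: [set a; b]).
  by rewrite uniform2_circuit cardsU1 cards2 ab !inE negb_or ![x == _]eq_sym ax bx.
by rewrite !inE eqxx ![y == _]eq_sym (negbTE ne) (negbTE ay) (negbTE by').
Qed.

End Uniform.

(** The operation does not say which branch of the graph is which class. The three branches are
    distinct series classes of [N], so they are among [X1], [X2], [X3], and by counting they are all
    of them. *)
Lemma theta_series_circuit (V T : finType) (G : graph V T) (N : matroid T) (X1 X2 X3 C : {set T}) :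
  theta_graph G -> cycle_matroid_of G N ->
  (forall S, series_class N S <-> [\/ S = X1, S = X2 | S = X3]) ->
  circuit N C <-> exists X Y, [/\ X \in [set X1; X2; X3], Y \in [set X1; X2; X3], X != Y & C = X :|: Y].
Proof.
move=> [u [v [w1 [w2 [w3 th]]]]] [gN cN] sN.
have [n0 dj eE cE] := theta_data_cycles th.
set A := branch _ in n0 dj eE cE.
have Ainj : injective A.
  move=> i j E; apply/eqP; apply: contraNT (n0 i) => /dj.
  by rewrite E -setI_eq0 setIid.
pose F := A @: setT.
have cF D : circuit N D <-> exists X Y, [/\ X \in F, Y \in F, X != Y & D = X :|: Y].
  rewrite cN cE; split=> [[i [j [ij ->]]]|[_ [_ [/imsetP [i _ ->] /imsetP [j _ ->] ne ->]]]].
    by exists (A i), (A j); rewrite !imset_f // (inj_eq Ainj).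
  by exists i, j; split=> //; apply: contraNneq ne => ->.
have trivF : trivIset F.
  apply/trivIsetP => _ _ /imsetP [i _ ->] /imsetP [j _ ->] ne; apply: dj.
  by apply: contraNneq ne => ->.
have F0 : set0 \notin F by apply/imsetP => -[j _ E]; have := n0 j; rewrite -E eqxx.
have F3 : #|F| = 3 by rewrite card_imset // cardsT card_ord.
have gF : ground N = cover F.
  rewrite gN; apply/setP => e; rewrite eE; apply/existsP/bigcupP => [[j ej]|[_ /imsetP [j _ ->] ej]].
    by exists (A j) => //; apply: imset_f.
  by exists j.
have F2 : 2 < #|F| by rewrite F3.
suff <- : F = [set X1; X2; X3] by [].
apply/eqP; rewrite eqEcard F3; apply/andP; split.
  apply/subsetP => S /(theta_series_class trivF F0 F2 S gF cF)/sN.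
  by rewrite !inE; case=> ->; rewrite eqxx ?orbT.
by rewrite -setUA cardsU1 cards2; case: (_ \notin _); case: (_ != _).
Qed.

Lemma parallel_path_circuits (T : finType) (A B : matroid T) : parallel_path_addition A B ->
  exists P P' C0 : {set T}, [/\ [/\ P != set0, circuit A C0 & P \subset C0],
    [disjoint P' & ground A], #|P'| = #|P|,
    (forall C, circuit A C -> ~~ [disjoint C & P] -> P \subset C) &
    forall C, circuit B C <-> [\/ circuit A C,
      exists D : {set T}, [/\ circuit A D, P \subset D & C = (D :\: P) :|: P'] | C = P :|: P']].
Proof.
case=> P [Q [P' [t [t' [M' [N [V [G]]]]]]]].
case=> [[sQ PQ tP] [t'A dP' t'P' cardP] isoM [thG cyN serN] [gMN nsM _ _ cB]].
have [/and3P [sQA _ /forall_inP serQ] _] := maxsetP sQ.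
have sP : P \subset ground A by apply: subset_trans PQ sQA.
have t'P : t' \notin P by apply: contra t'A; apply: (subsetP sP).
have dPP' : [disjoint P & P'] by rewrite disjoint_sym; apply: disjointWr dP'.
have gC C : circuit A C -> C \subset ground A by move/circuit_cyc/cyc_ground.
have hP C : circuit A C -> ~~ [disjoint C & P] -> P \subset C.
  move=> cC /pred0Pn [x /andP /= [xC xP]]; apply/subsetP => y yP.
  have [<- //|ne] := eqVneq x y.
  have /forall_inP/(_ y (subsetP PQ y yP)) := serQ x (subsetP PQ x xP).
  by rewrite ne /= => hs; have /in_seriesP [_ _ <-] : in_series A x y := hs.
have cM' := contract_path_circuit tP sP hP isoM.
have neP (X Y : {set T}) x : x \in X -> [disjoint X & Y] -> X != Y.
  by move=> xX; apply: contraTneq => <-; rewrite -setI_eq0 setIid; apply/set0Pn; exists x.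
have cN C : circuit N C <-> [\/ C = t' |: P, C = t' |: P' | C = P :|: P'].
  rewrite (theta_series_circuit C thG cyN serN); split.
    case=> X [Y [+ + + ->]]; rewrite !inE -!orbA.
    case/or3P=> /eqP -> /or3P [] /eqP ->; rewrite ?eqxx // => _.
    + exact: Or31.
    + exact: Or32.
    + by apply: Or31; rewrite setUC.
    + exact: Or33.
    + by apply: Or32; rewrite setUC.
    + by apply: Or33; rewrite setUC.
  case=> ->; [exists [set t'], P | exists [set t'], P' | exists P, P']; rewrite !inE !eqxx ?orbT; split=> //.
  + by apply: (neP _ _ t'); rewrite ?set11 // disjoints1.
  + by apply: (neP _ _ t'); rewrite ?set11 // disjoints1.
  + exact: (neP _ _ t).
(* If no circuit of [A] contained [P], no circuit of [M'] would contain [t'], and [t'] would be a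
   separator. *)
have [C0 cC0 PC0] : exists2 C0, circuit A C0 & P \subset C0.
  have [/existsP [C /andP [cC PC]]|no] := boolP [exists C, circuit A C && (P \subset C)].
    by exists C.
  case: nsM; split.
    by rewrite -gMN subsetIl.
  move=> e f; rewrite inE => /eqP -> _ [<-|[C [/cM' cC t'C _]]]; first exact: set11.
  case: cC => [[cC _]|[D [cD PD _]]]; first by have := subsetP (gC C cC) t' t'C; rewrite (negbTE t'A).
  by case/negP: no; apply/existsP; exists D; rewrite cD.
exists P, P', C0; split=> //; first by split=> //; apply/set0Pn; exists t.
by move=> C; rewrite cB; apply: path_sum_circuit isoM t'P' cN C.
Qed.

(** * Weights under parallel-path addition *)

Section ParallelPathWinding.
Variables (T : finType) (A B : matroid T) (P P' C0 : {set T}) (h : rel T) (w : T -> T -> int).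
Implicit Types (C D X : {set T}) (x y e f : T).
Hypothesis W : winding A h w.
Hypothesis P0 : P != set0.
Hypothesis cC0 : circuit A C0.
Hypothesis PC0 : P \subset C0.
Hypothesis dP' : [disjoint P' & ground A].
Hypothesis cardP : #|P'| = #|P|.
Hypothesis hP : forall C, circuit A C -> ~~ [disjoint C & P] -> P \subset C.
Hypothesis cB : forall C, circuit B C <-> [\/ circuit A C,
  exists D : {set T}, [/\ circuit A D, P \subset D & C = (D :\: P) :|: P'] | C = P :|: P'].

Let gC C : circuit A C -> C \subset ground A. Proof. by move/circuit_cyc/cyc_ground. Qed.
Let sP : P \subset ground A. Proof. exact: subset_trans PC0 (gC cC0). Qed.
Let dPP' : [disjoint P & P']. Proof. by rewrite disjoint_sym; apply: disjointWr dP'. Qed.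

Let ntP' C x : circuit A C -> x \in P' -> x \notin C.
Proof. by move=> cC xP'; apply/negP => /(subsetP (gC cC)); rewrite (disjointFr dP' xP'). Qed.

Let mem_meet C x : circuit A C -> x \in P -> x \in C -> P \subset C.
Proof. by move=> cC xP xC; apply: (hP cC); apply/pred0Pn; exists x; rewrite /= xC. Qed.

(** Elements of [P] lie in the same circuits, whereas [winding_sep] gives a circuit containing only
    one of two adjacent elements. *)
Let h_inner x y : x \in P -> y \in P -> h x y = false.
Proof.
move=> xP yP; apply/negP => /(winding_sep W) [C cC /negP []]; apply/eqP.
apply/idP/idP => [xC|yC]; first exact: (subsetP (mem_meet cC xP xC)).
exact: (subsetP (mem_meet cC yP yC)).
Qed.

(** Matches the two paths by position: the element of [X] at the index that [x] has in the other
    path. *)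
Let nthP X x := nth x (enum X) (index x (enum (if X == P then P' else P))).

Let PneP' : P' != P.
Proof. by apply: contraNneq P0 => E; move: (dPP'); rewrite -setI_eq0 E setIid. Qed.

Let copy x := if x \in P then nthP P' x else x.
Let fold x := if x \in P' then nthP P x else x.

Let copyP x : x \in P -> copy x \in P' /\ fold (copy x) = x.
Proof.
move=> xP; have lt : index x (enum P) < size (enum P') by rewrite -cardE cardP cardE index_mem mem_enum.
have cP' : copy x \in P' by rewrite /copy xP /nthP (negbTE PneP') -mem_enum mem_nth.
split=> //; rewrite /fold cP' /copy xP /nthP (negbTE PneP') eqxx index_uniq ?enum_uniq //.
rewrite (set_nth_default x) ?nth_index ?mem_enum //.
by rewrite index_mem mem_enum.
Qed.

Let foldP x : x \in P' -> fold x \in P /\ copy (fold x) = x.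
Proof.
move=> xP; have lt : index x (enum P') < size (enum P) by rewrite -cardE -cardP cardE index_mem mem_enum.
have fP : fold x \in P by rewrite /fold xP /nthP eqxx -mem_enum mem_nth.
split=> //; rewrite /copy fP /fold xP /nthP eqxx (negbTE PneP') index_uniq ?enum_uniq //.
rewrite (set_nth_default x) ?nth_index ?mem_enum //.
by rewrite index_mem mem_enum.
Qed.

Let fold_id x : x \notin P' -> fold x = x. Proof. by rewrite /fold => /negbTE ->. Qed.

(* The new circuit [P :|: P'] alternates between its two halves: it is the [#|P|]-fold cover of a
   two-element circuit with total voltage one. *)
Let proj x := x \in P'.
Let idx x : int := index x (enum (if proj x then P' else P)).
Let k := #|P|.
Let wb (b c : bool) : int := if b then 1%R else 0%R.
Let hb (b c : bool) := b != c.
Let cross x y := (x \in P) && (y \in P') || (x \in P') && (y \in P).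

(** A pair with one element on each path is governed by the cover, every other pair by [A] after
    [P'] is folded onto [P]. The two rules do not interfere, since [P :|: P'] is the only circuit
    containing crossing pairs. *)
Let h' x y := if cross x y then cover_rel proj idx k hb wb x y else h (fold x) (fold y).
Let w' x y := if cross x y then cover_weight proj idx k wb x y else w (fold x) (fold y).

Let k0 : 0 < k. Proof. by rewrite /k card_gt0. Qed.

Let cross_sym x y : cross x y = cross y x.
Proof. by rewrite /cross orbC; congr (_ || _); rewrite andbC. Qed.

Let h'_sym : symmetric h'.
Proof.
move=> x y; rewrite /h' cross_sym (winding_sym W); case: cross => //.
by rewrite (cover_rel_sym _ _ _ _ _) // => a b; rewrite /hb eq_sym.
Qed.

Let cross_cycle : exists nx, [/\ cyclic_on (P :|: P') nx,
  {in P :|: P' &, forall x y, h' x y = (x != y) && ((nx x == y) || (nx y == x))}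
  & (`|\sum_(x in P :|: P') w' x (nx x)| = 1)%R].
Proof.
have [p pP] := set0Pn _ P0.
have sumb : (`|\sum_(b in [set: bool]) wb b (~~ b)| = 1)%R.
  by rewrite (eq_bigl xpredT) ?big_bool // => b; rewrite inE.
pose half b := if b then P' else P.
have cardh b : #|half b| = k by case: b.
have halfE x : x \in P :|: P' -> x \in half (proj x).
  by rewrite inE /half /proj; case: (boolP (x \in P')) => // _; rewrite orbF.
have projh b x : x \in half b -> proj x = b.
  by rewrite /half /proj; case: b => // xP; rewrite (disjointFr dPP' xP).
have halfS b : half b \subset P :|: P' by case: b; rewrite ?subsetUl ?subsetUr.
pose pt b (z : int) := nth p (enum (half b)) `|(z %% k)%Z|%N.
have kz : (k : int) != 0%R by rewrite eqz_nat -lt0n.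
have modk (z : int) : (`|(z %% k)%Z| < k)%N.
  by rewrite -ltz_nat gez0_abs ?modz_ge0 //; apply: ltz_pmod.
have pth b z : pt b z \in half b by rewrite -mem_enum mem_nth // -cardE cardh.
have [||||||||||| nx [cn hn sn]] := @cover_cyclic _ _ proj idx k hb wb k0 [set: bool] (P :|: P') negb pt.
- split=> [b _|a b _ _]; first by rewrite inE.
  have [->|ne] := eqVneq a b; first exact: connect0.
  have -> : b = ~~ a by case: (a) (b) ne => -[].
  exact: fconnect1.
- by rewrite cardsT card_bool.
- by move=> [] [].
- exact: sumb.
- by move=> b _; rewrite negbK eqxx.
- by move=> x _; rewrite inE.
- by move=> b _ z; apply: (subsetP (halfS b)).
- by move=> b _ z; apply: (projh b).
- move=> b _ z; rewrite /idx (projh b) // -/(half b) /pt index_uniq ?enum_uniq -?cardE ?cardh //.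
  by rewrite gez0_abs ?modz_ge0 // -eqz_mod_dvd modz_mod.
- move=> x y xD yD E d; have xh := halfE x xD; have yh := halfE y yD; rewrite -E in yh.
  have sz u : u \in half (proj x) -> (index u (enum (half (proj x))) < k)%N.
    by move=> uh; rewrite -(cardh (proj x)) cardE index_mem mem_enum.
  have lx := sz x xh; have ly := sz y yh.
  rewrite -eqz_mod_dvd /idx -E -/(half (proj x)) !modz_nat !modn_small // in d.
  move/eqP: d => [d].
  by rewrite -(nth_index x (_ : x \in enum (half (proj x)))) ?mem_enum // d nth_index ?mem_enum.
- move=> b _; rewrite -(cardh b); apply: eq_card => x; rewrite inE.
  apply/andP/idP => [[xD /eqP <-]|xb]; first exact: halfE.
  by rewrite (projh b) // eqxx (subsetP (halfS b)).
have crossE x y : x \in P :|: P' -> y \in P :|: P' -> cross x y = (proj x != proj y).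
  rewrite !inE /cross /proj => xD yD; case xP': (x \in P'); case yP': (y \in P');
    rewrite ?(disjointFl dPP' xP') ?(disjointFl dPP' yP') ?andbF //=.
  - by move: yD; rewrite yP' orbF => ->.
  - by move: xD; rewrite xP' orbF => ->.
have foldPP x : x \in P :|: P' -> fold x \in P.
  by case: (boolP (x \in P')) => [/foldP [] //|xP']; rewrite inE fold_id // (negbTE xP') orbF.
have h'E x y : x \in P :|: P' -> y \in P :|: P' -> h' x y = cover_rel proj idx k hb wb x y.
  move=> xD yD; rewrite /h' crossE //; case: eqVneq => //= E.
  by rewrite /cover_rel /hb E eqxx /=; apply: h_inner; apply: foldPP.
exists nx; split=> //; first by move=> x y xD yD; rewrite h'E // hn.
have -> : (\sum_(x in P :|: P') w' x (nx x) = \sum_(x in P :|: P') cover_weight proj idx k wb x (nx x))%R.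
  apply: eq_bigr => x xD; have nD := proj1 cn x xD; rewrite /w' crossE //.
  have xn : x != nx x.
    apply/eqP => E; have := @cyclic_period _ _ nx x 1 cn xD isT (esym E).
    by move: (dPP'); rewrite cardsU -setI_eq0 => /eqP ->; rewrite cards0 subn0 cardP -/k; have := k0; clear; lia.
  have := hn x (nx x) xD nD; rewrite xn eqxx /= /cover_rel => /andP [+ _].
  by rewrite /hb => ->.
by rewrite sn; exact: sumb.
Qed.

Lemma winding_parallel_path : exists h'' w'', winding B h'' w''.
Proof.
exists h', w'; split; first exact: h'_sym.
- move=> C /cB [/(winding_card W) //|[D [cD PD ->]]|->].
    have d : (D :\: P) :&: P' = set0.
      apply/setP => x; rewrite !inE; case xP': (x \in P'); rewrite ?andbF //.
      by rewrite (negbTE (ntP' cD xP')) andbF.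
    have := winding_card W cD.
    by rewrite cardsU d cards0 subn0 cardP -(cardsID P D) (setIidPr PD) addnC.
  by move: (dPP'); rewrite cardsU -setI_eq0 => /eqP ->; rewrite cards0 subn0 cardP -/k; have := k0; clear; lia.
- move=> C /cB [cC|[D [cD PD ->]]|->]; last exact: cross_cycle.
    have [nx [cn hn sn]] := winding_cyclic W cC.
    have fid x : x \in C -> fold x = x by move=> xC; apply: fold_id; apply: contraL xC; apply: ntP'.
    have nc x y : x \in C -> y \in C -> cross x y = false.
      move=> xC yC; rewrite /cross; have nP z : z \in C -> z \in P' = false.
        by move=> zC; apply/negP => /(ntP' cC); rewrite zC.
      by rewrite !nP // andbF.
    exists nx; split=> //; first by move=> x y xC yC; rewrite /h' nc // !fid // hn.
    by rewrite -sn; congr `|_|%R; apply: eq_bigr => x xC; rewrite /w' nc ?fid //; apply: (proj1 cn).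
  have [nx [cn hn sn]] := winding_cyclic W cD.
  have foldD x : x \in D :\: P :|: P' -> fold x \in D.
    rewrite !inE; case: (boolP (x \in P')) => [xP' _|xP']; last by rewrite fold_id // orbF => /andP [].
    by apply: (subsetP PD); case: (foldP xP').
  have copyD e : e \in D -> copy e \in D :\: P :|: P'.
    move=> eD; rewrite !inE; case: (boolP (e \in P)) => eP; first by case: (copyP eP) => -> _; rewrite orbT.
    by rewrite /copy (negbTE eP) eP eD.
  have [||||nx' [cn' hn' sn']] := @cyclic_transport _ _ D (D :\: P :|: P') copy fold nx w cn.
  + exact: copyD.
  + exact: foldD.
  + move=> e eD; case: (boolP (e \in P)) => eP; first by case: (copyP eP).
    by rewrite /copy (negbTE eP) fold_id //; apply: contraL eD; apply: ntP'.
  + move=> x xD; case: (boolP (x \in P')) => xP'; first by case: (foldP xP').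
    by rewrite fold_id // /copy; move: xD; rewrite !inE (negbTE xP') orbF => /andP [/negbTE ->].
  have nP x : x \in D :\: P :|: P' -> x \in P = false.
    rewrite !inE => /orP [/andP [/negbTE //]|xP']; exact: disjointFl dPP' xP'.
  have nc x y : x \in D :\: P :|: P' -> y \in D :\: P :|: P' -> cross x y = false.
    by move=> xD yD; rewrite /cross !nP ?andbF.
  exists nx'; split=> //; first by move=> x y xD yD; rewrite hn' // /h' nc // hn // foldD.
  rewrite -sn -sn'; congr `|_|%R; apply: eq_bigr => x xD; rewrite /w' nc //; exact: (proj1 cn').
- move=> x y; rewrite /h' /w' [cross y x]cross_sym; case: ifP => [c hxy nB|nc hxy nB].
    apply: (cover_weight_opp k0 hxy).
    (* The base weights 0 and 1 sum to 1, which suffices for k > 1. For k = 1 a crossing pair is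
       itself the circuit [P :|: P'], which is exempt. *)
    have [k1|k1] := ltnP 1 k.
      by right; split=> //; move: hxy => /andP [+ _]; rewrite /hb /wb; case: (proj x); case: (proj y).
    have {}k1 : k = 1 by apply/eqP; rewrite eqn_leq k1 k0.
    have P1 z : z \in P -> P = [set z].
      by move=> zP; apply/esym/eqP; rewrite eqEcard sub1set zP cards1 -/k k1.
    have P1' z : z \in P' -> P' = [set z].
      by move=> zP; apply/esym/eqP; rewrite eqEcard sub1set zP cards1 cardP -/k k1.
    case/negP: nB; apply/cB; apply: Or33.
    by case/orP: c => /andP [xP yP]; [rewrite (P1 x) // (P1' y) | rewrite (P1 y) // (P1' x) // setUC].
  apply: (winding_opp W hxy); apply: contra nB => c2.
  (* A two-element circuit through [fold u] contains [P], and [v] is not in [P]; so both paths are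
     single elements, and exchanging them turns this circuit into [[set u; v]]. *)
  have aux u v : u \in P' -> v \notin P' -> v \notin P -> circuit A [set fold u; v] -> circuit B [set u; v].
    move=> uP' vP' vP c; have [fP fu] := foldP uP'.
    have PD : P \subset [set fold u; v] by apply: (mem_meet c fP); rewrite !inE eqxx.
    have EP : P = [set fold u].
      apply/setP => z; rewrite inE; apply/idP/eqP => [zP|-> //].
      by have := subsetP PD z zP; rewrite !inE => /orP [] /eqP // E; rewrite -E zP in vP.
    have EP' : P' = [set u] by apply/esym/eqP; rewrite eqEcard sub1set uP' cards1 cardP EP cards1.
    apply/cB; apply: Or32; exists [set fold u; v]; split=> //; rewrite EP EP'.
    apply/setP => z; rewrite !inE; case: (eqVneq z (fold u)) => [->|] //=; last by rewrite orbC.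
    by rewrite (_ : fold u == v = false) ?orbF //; apply: contraNF vP => /eqP <-.
  move/negbT: nc; rewrite /cross negb_or !negb_and => /andP [n1 n2].
  case: (boolP (x \in P')) n1 n2 c2 hxy => xP' n1 n2; case: (boolP (y \in P')) n1 n2 => yP' n1 n2.
  + by rewrite (h_inner (foldP xP').1 (foldP yP').1).
  + by rewrite (fold_id yP') => c2 _; apply: aux.
  + by rewrite (fold_id xP') setUC => c2 _; rewrite setUC; apply: aux => //; move: n1; rewrite orbF.
  + by rewrite !fold_id // => c2 _; apply/cB; apply: Or31.
move=> x y; rewrite /h'; case: ifP => [c _|nc].
  exists C0; first by apply/cB; apply: Or31.
  by case/orP: c => /andP [h1 h2]; rewrite ?(subsetP PC0 _ h1) ?(subsetP PC0 _ h2) ?(negbTE (ntP' cC0 h1)) ?(negbTE (ntP' cC0 h2)).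
case/(winding_sep W) => C cC ne.
(* If the circuit misses [fold u], it serves unchanged, since it also misses [u]. Otherwise it
   contains [P] and is rerouted through [P'], which brings in [u] and leaves membership of [v] as it
   was. *)
have aux u v : u \in P' -> v \notin P' -> v \notin P -> (fold u \in C) != (v \in C) ->
    exists2 D, circuit B D & (u \in D) != (v \in D).
  move=> uP' vP' vP ne'; have [fP _] := foldP uP'.
  case: (boolP (fold u \in C)) ne' => fC ne'; last first.
    by exists C; [apply/cB; apply: Or31 | rewrite (negbTE (ntP' cC uP'))].
  exists ((C :\: P) :|: P'); last by rewrite !inE uP' (negbTE vP') vP orbT orbF.
  by apply/cB; apply: Or32; exists C; split=> //; apply: mem_meet fP fC.
move/negbT: nc; rewrite /cross negb_or !negb_and => /andP [n1 n2].
case: (boolP (x \in P')) n1 n2 ne => xP' n1 n2; case: (boolP (y \in P')) n1 n2 => yP' n1 n2.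
- case/eqP; have [fx _] := foldP xP'; have [fy _] := foldP yP'.
  by apply/idP/idP => [/(mem_meet cC fx)|/(mem_meet cC fy)]/subsetP; apply.
- by rewrite (fold_id yP'); apply: aux.
- rewrite (fold_id xP') eq_sym => ne; have [D cD nD] : exists2 D, circuit B D & (y \in D) != (x \in D).
    by apply: aux => //; move: n1; rewrite orbF.
  by exists D => //; rewrite eq_sym.
- by rewrite !fold_id // => ne; exists C => //; apply/cB; apply: Or31.
Qed.

End ParallelPathWinding.

Lemma obtainable_winding n (T : finType) (M : matroid T) : 3 < n -> obtainable n M ->
  exists h w, winding M h w.
Proof.
move=> n4; elim=> {T M} [|T1 T2 M1 M2 _ [h [w W]] [f iso]|T1 T2 M1 M2 _ [h [w W]] b|T M1 M2 _ [h [w W]] p].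
- by do 2 eexists; apply: winding_uniform.
- have [inj fE _] := iso.
  have [E0|[e0 e0E]] := set_0Vmem (ground M1).
    exists (fun _ _ => false), (fun _ _ => 0%R); apply: winding_empty => C; apply/negP => cC.
    have [x xC] := circuit_n0 cC; have := subsetP (cyc_ground (circuit_cyc cC)) x xC.
    by rewrite -fE E0 imset0 inE.
  pose g y := odflt e0 [pick e in ground M1 | f e == y].
  have fK : {in ground M1, cancel f g}.
    move=> e eE; rewrite /g; case: pickP => [e' /andP [e'E /eqP]|/(_ e)]; first exact: inj.
    by rewrite /= eE eqxx.
  by do 2 eexists; apply: (winding_iso iso fK W).
- exact: winding_series W b.
have [P [P' [C0 [[P0 cC0 PC0] dP' cardP hP cB]]]] := parallel_path_circuits p.
exact: winding_parallel_path W P0 cC0 PC0 dP' cardP hP cB.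
Qed.

Theorem theorem2 (T : finType) (M : matroid T)
    (hconn : mconnected M) (hnonbin : ~ binary M) :
  orderable M <-> exists n : nat, 4 <= n /\ obtainable n M.
Proof.
split=> [/orderable_ordered [h hM]|[n [n4 /(obtainable_winding n4) [h [w W]]]]].
  have [L qL] := nonbinary_quad hnonbin; exact: ordered_obtainable hM hconn qL.
exact: ordered_orderable (winding_ordered W).
Qed.
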